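(* Let $G$ be a homogeneous Carnot group with homogeneous dimension $Q>3$, and let $\nabla_{\mathcal L}$, $\mathcal L$ and $\rho_2$ be as in the context. Let $p\ge2$ and $\theta\in\mathbb{R}$ satisfy $$(Q-p(\theta+2))(p\theta+Q(p-1))\ge0,\qquad\rho_2^{-p\theta}|\nabla_{\mathcal L}\rho_2|^{-2(p-1)}\in L^1_{\mathrm{loc}}(G).$$ Then every $u\in C_c^\infty(G\setminus\{0\})$ satisfies $$\left(\frac{(Q-p(\theta+2))(p\theta+Q(p-1))}{p^2}\right)^p\int_G\frac{|u|^p}{\rho_2^{p(\theta+2)}}|\nabla_{\mathcal L}\rho_2|^2\,dx\le\int_G\frac{|\mathcal L u|^p}{\rho_2^{p\theta}|\nabla_{\mathcal L}\rho_2|^{2(p-1)}}\,dx.$$ The constant is sharp (it cannot be replaced by a larger one for all $u\in C_c^\infty(G\setminus\{0\})$), and equality occurs formally, up to a multiplicative factor, for the non-admissible function $u=\rho_2^{\frac{p(\theta+2)-Q}{p}}$, in the sense that for this $u$ the integrands of the two sides (the left one multiplied by the constant) coincide pointwise wherever $\nabla_{\mathcal L}\rho_2\ne0$.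
   Context: A homogeneous Carnot group is a Lie group $G=(\mathbb{R}^N,\circ)$ such that: (1) $\mathbb{R}^N=\mathbb{R}^{N_1}\times\dots\times\mathbb{R}^{N_r}$ and, for every $\lambda>0$, the dilation $\delta_\lambda(x^{(1)},\dots,x^{(r)})=(\lambda x^{(1)},\lambda^2x^{(2)},\dots,\lambda^rx^{(r)})$, $x^{(i)}\in\mathbb{R}^{N_i}$, is an automorphism of $G$; (2) if $X_1,\dots,X_{N_1}$ are the left-invariant vector fields on $G$ with $X_j(0)=\frac{\partial}{\partial x_j}\big|_0$, then $\mathrm{rank}(\mathrm{Lie}\{X_1,\dots,X_{N_1}\}(x))=N$ for every $x\in\mathbb{R}^N$. Put $\nabla_{\mathcal L}=(X_1,\dots,X_{N_1})$, $\mathcal L=\sum_{i=1}^{N_1}X_i^2$, and $Q=N_1+2N_2+\dots+rN_r$. Integration is with respect to Lebesgue measure (which is the Haar measure). A homogeneous norm on $G$ is a continuous $\rho:G\to[0,+\infty)$ with $\rho(\delta_\lambda x)=\lambda\rho(x)$ for all $\lambda>0$, $x\in G$, and $\rho(x)>0$ for $x\ne0$. It is known that there is a homogeneous norm $\rho_2\in C^\infty(G\setminus\{0\})$ such that $\rho_2^{2-Q}$ is, up to a multiplicative constant, the fundamental solution of $-\mathcal L$; $\rho_2$ denotes this norm. Functions are real-valued. *)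

(* Defs.v *)
From HB Require Import structures.
From mathcomp Require Import all_boot all_order all_algebra.
From mathcomp Require Import all_classical all_reals all_analysis.

Set Implicit Arguments.
Unset Strict Implicit.
Unset Printing Implicit Defensive.

Import Order.TTheory GRing.Theory Num.Theory.
Import numFieldNormedType.Exports.

Local Open Scope classical_set_scope.
Local Open Scope ring_scope.

(* Lebesgue measure on R^n is built on [n.-tuple (measurableTypeR R)], which carries the
product sigma-algebra of the Borel sets of [R]; [n.-tuple R] alone would not
do, the sigma-algebra of the bare type [R] being the trivial default one.
Functions on ['rV[R]_n] are integrated through [rv_of_tuple]. *)

Section lebesgue_tuple.
Variable R : realType.

Definition tuple_cons n
    (z : measurableTypeR R * n.-tuple (measurableTypeR R)) :
    n.+1.-tuple (measurableTypeR R) := [tuple of z.1 :: z.2].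

Fixpoint lebesgue_tuple n : set (n.-tuple (measurableTypeR R)) -> \bar R :=
  match n with
  | 0 => dirac [tuple]
  | n'.+1 =>
      pushforward (lebesgue_measure \x lebesgue_tuple (n := n'))%E
                  (@tuple_cons n')
  end.

Lemma measurable_tuple_cons n : measurable_fun setT (@tuple_cons n).
Proof. exact: measurable_cons. Qed.

Lemma measurable_tuple_uncons n :
  measurable_fun setT (fun t : n.+1.-tuple (measurableTypeR R) =>
    (thead t, [tuple of behead t])).
Proof.
apply: measurable_fun_pair; first exact: measurable_tnth.
exact: measurable_behead.
Qed.

Lemma lebesgue_tuple_step n
    (m : {sigma_finite_measure set (n.-tuple (measurableTypeR R)) -> \bar R}) :
  exists m' : {sigma_finite_measure set (n.+1.-tuple (measurableTypeR R)) -> \bar R},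
    (m' : set _ -> \bar R) =
      pushforward (lebesgue_measure \x m)%E (@tuple_cons n).
Proof.
pose P : {measure set (measurableTypeR R * n.-tuple (measurableTypeR R)) -> \bar R} :=
  (lebesgue_measure \x m)%E.
pose q : {measure set _ -> \bar R} :=
  measure_function_pushforward__canonical__measure_function_Measure P
    (@measurable_tuple_cons n).
have sfq : sigma_finite setT q.
  have /sigma_finiteP[F [TF ndF Foo]] := sigma_finiteT (@lebesgue_measure R).
  have /sigma_finiteP[G [TG ndG Goo]] := sigma_finiteT m.
  exists (fun k => (fun t : n.+1.-tuple (measurableTypeR R) =>
      (thead t, [tuple of behead t])) @^-1` (F k `*` G k)).
    rewrite -preimage_bigcup (_ : \bigcup_k _ = setT) ?preimage_setT//.
    apply/seteqP; split => // -[x y] _.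
    have [i _ Fi] : (\bigcup_k F k) x by rewrite -TF.
    have [j _ Gj] : (\bigcup_k G k) y by rewrite -TG.
    exists (maxn i j) => //; split => /=.
      by move: x Fi; exact/subsetPset/ndF/leq_maxl.
    by move: y Gj; exact/subsetPset/ndG/leq_maxr.
  move=> k; have [mF PF] := Foo k; have [mG PG] := Goo k; split.
    rewrite -[X in measurable X]setTI; apply: measurable_tuple_uncons => //.
    exact: measurableX.
  rewrite /= /pushforward -comp_preimage.
  rewrite (_ : _ \o _ = id); last first.
    by apply/funext => -[x t] /=; congr pair; exact: val_inj.
  by rewrite preimage_id product_measure1E// lte_mul_pinfty// ge0_fin_numE.
pose S := Measure_isSigmaFinite.Build _ _ _ q sfq.
pose q' : {sigma_finite_measure set _ -> \bar R} := HB.pack (Measure.sort q) (Measure.class q) S.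
by exists q'.
Qed.

Lemma lebesgue_tuple_sigma_finite n :
  exists m : {sigma_finite_measure set (n.-tuple (measurableTypeR R)) -> \bar R},
    (m : set _ -> \bar R) = lebesgue_tuple (n := n).
Proof.
elim: n => [|n [m mE]] /=; first by exists (dirac [tuple]).
by rewrite -mE; exact: lebesgue_tuple_step.
Qed.

Lemma lebesgue_tuple0 n : lebesgue_tuple (set0 : set (n.-tuple _)) = 0%E.
Proof. by have [m <-] := lebesgue_tuple_sigma_finite n; rewrite measure0. Qed.

Lemma lebesgue_tuple_ge0 n (A : set (n.-tuple _)) : (0 <= lebesgue_tuple A)%E.
Proof. by have [m <-] := lebesgue_tuple_sigma_finite n. Qed.

Lemma lebesgue_tuple_sigma_additive n :
  semi_sigma_additive (lebesgue_tuple (n := n)).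
Proof.
have [m <-] := lebesgue_tuple_sigma_finite n.
exact: measure_semi_sigma_additive.
Qed.

HB.instance Definition _ n := isMeasure.Build _ _ _ (@lebesgue_tuple n)
  (@lebesgue_tuple0 n) (@lebesgue_tuple_ge0 n)
  (@lebesgue_tuple_sigma_additive n).

Lemma lebesgue_tuple_sigma_finiteT n :
  sigma_finite setT (@lebesgue_tuple n).
Proof. by have [m <-] := lebesgue_tuple_sigma_finite n; exact: (sigma_finiteT m). Qed.

HB.instance Definition _ n := Measure_isSigmaFinite.Build _ _ _
  (@lebesgue_tuple n) (@lebesgue_tuple_sigma_finiteT n).

Lemma lebesgue_tuple_box n (A : 'I_n -> set (measurableTypeR R)) :
  (forall i, measurable (A i)) ->
  lebesgue_tuple [set t | forall i, A i (tnth t i)] =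
  (\prod_(i < n) lebesgue_measure (A i))%E.
Proof.
elim: n A => [|n IHn] A mA.
  by rewrite big_ord0 /= diracE mem_set//= => -[].
rewrite big_ord_recl -IHn //= /pushforward -product_measure1E//; last first.
  rewrite (_ : [set t | _] =
      \bigcap_(i in setT) ((fun t => tnth t i) @^-1` A (lift ord0 i))).
    apply: fin_bigcap_measurable => // i _.
    by rewrite -[X in measurable X]setTI; exact: measurable_tnth.
  by apply/seteqP; split => [t /= At i _|t /= At i]; [exact: At|exact: (At i I)].
congr product_measure1; apply/seteqP; split => -[x t] /=.
  move=> At; split => [|i]; first exact: (At ord0).
  by have := At (lift ord0 i); rewrite tnthS.
move=> [Ax At] i; case: (unliftP ord0 i) => [j|] -> //.
by rewrite tnthS.
Qed.

End lebesgue_tuple.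

Section calculus.
Variable R : realType.

Definition rv_of_tuple n (t : n.-tuple (measurableTypeR R)) : 'rV[R]_n :=
  \row_i (tnth t i : R).

Definition integral_rV n (f : 'rV[R]_n -> \bar R) : \bar R :=
  (\int[lebesgue_tuple (n := n)]_t f (rv_of_tuple t))%E.

Definition locally_integrable_rV n (f : 'rV[R]_n -> \bar R) : Prop :=
  forall K : set 'rV[R]_n, compact K ->
    (lebesgue_tuple (n := n)).-integrable (@rv_of_tuple n @^-1` K)
      (f \o @rv_of_tuple n).

Definition partial n (i : 'I_n) (f : 'rV[R]_n -> R) : 'rV[R]_n -> R :=
  fun x => 'D_(delta_mx 0 i) f x.

Definition smooth_on n (O : set 'rV[R]_n) (f : 'rV[R]_n -> R) : Prop :=
  forall (s : seq 'I_n) (x : 'rV[R]_n), O x ->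
    {for x, continuous (foldr (@partial n) f s)} /\
    forall i, derivable (foldr (@partial n) f s) x (delta_mx 0 i).

Definition smooth_map m n (F : 'rV[R]_m -> 'rV[R]_n) : Prop :=
  forall k, smooth_on setT (fun x => F x 0 k).

Definition test_function n (O : set 'rV[R]_n) (f : 'rV[R]_n -> R) : Prop :=
  [/\ smooth_on setT f, compact (closure [set x | f x != 0])
    & closure [set x | f x != 0] `<=` O].

(* A vector field is given by its components in the coordinate frame. *)
Definition vfield n := 'rV[R]_n -> 'rV[R]_n.

Definition vderiv n (V : vfield n) (f : 'rV[R]_n -> R) : 'rV[R]_n -> R :=
  fun x => \sum_(k < n) V x 0 k * partial k f x.

Definition lie_bracket n (V W : vfield n) : vfield n := fun x =>
  \row_k (vderiv V (fun y => W y 0 k) x - vderiv W (fun y => V y 0 k) x).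

Inductive lie_generated n (S : set (vfield n)) : vfield n -> Prop :=
| LieGen V : S V -> lie_generated S V
| LieZero : lie_generated S (fun=> 0)
| LieLin (a : R) V W : lie_generated S V -> lie_generated S W ->
    lie_generated S (fun x => a *: V x + W x)
| LieBracket V W : lie_generated S V -> lie_generated S W ->
    lie_generated S (lie_bracket V W).

Definition lie_rank_at n (S : set (vfield n)) (x : 'rV[R]_n) (k : nat) : Prop :=
  exists2 U : {vspace 'rV[R]_n}, \dim U = k &
    forall v, v \in U <-> exists2 V, lie_generated S V & V x = v.

End calculus.

Section carnot.
Variable R : realType.

Definition lie_group_law n (op : 'rV[R]_n -> 'rV[R]_n -> 'rV[R]_n) : Prop :=
  [/\ associative op,
      smooth_map (fun z : 'rV[R]_(n + n) => op (lsubmx z) (rsubmx z))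
    & exists e inv, [/\ left_id e op, right_id e op, left_inverse e inv op,
                        right_inverse e inv op & smooth_map inv]].

Definition left_invariant n (op : 'rV[R]_n -> 'rV[R]_n -> 'rV[R]_n)
    (V : vfield R n) : Prop :=
  smooth_map V /\ forall a x, V (op a x) = 'D_(V x) (op a) x.

(* The dimensions N_1, ..., N_r of the strata are the entries of [d], so that
   N = sumn d; the 0-based index of the stratum of the coordinate [i] is
   [reshape_index d i]. *)
Definition dilation (d : seq nat) (lambda : R) (x : 'rV[R]_(sumn d)) :
    'rV[R]_(sumn d) :=
  \row_i (lambda ^+ (reshape_index d i).+1 * x 0 i).

Definition homogeneous_dim (d : seq nat) : nat :=
  (\sum_(i < size d) i.+1 * nth 0 d i)%N.

Record homogeneous_carnot_group (d : seq nat)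
    (op : 'rV[R]_(sumn d) -> 'rV[R]_(sumn d) -> 'rV[R]_(sumn d))
    (X : 'I_(head 0%N d) -> vfield R (sumn d)) : Prop := {
  carnot_lie_group : lie_group_law op ;
  carnot_dilation : forall lambda : R, 0 < lambda ->
    {morph dilation lambda : x y / op x y >-> op x y} ;
  carnot_left_invariant : forall j, left_invariant op (X j) ;
  carnot_at0 : forall j, X j 0 = \row_k ((k == j :> nat)%:R) ;
  carnot_rank : forall x, lie_rank_at (range X) x (sumn d) }.

Definition hgrad_norm n m (X : 'I_m -> vfield R n) (f : 'rV[R]_n -> R) :
    'rV[R]_n -> R :=
  fun x => Num.sqrt (\sum_(j < m) vderiv (X j) f x ^+ 2).

Definition sublaplacian n m (X : 'I_m -> vfield R n) (f : 'rV[R]_n -> R) :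
    'rV[R]_n -> R :=
  fun x => \sum_(j < m) vderiv (X j) (vderiv (X j) f) x.

Record homogeneous_norm (d : seq nat) (rho : 'rV[R]_(sumn d) -> R) : Prop := {
  hnorm_continuous : continuous rho ;
  hnorm_ge0 : forall x, 0 <= rho x ;
  hnorm_dilation : forall lambda x, 0 < lambda ->
    rho (dilation lambda x) = lambda * rho x ;
  hnorm_gt0 : forall x, x != 0 -> 0 < rho x }.

(* Gamma is the fundamental solution, with pole at 0, of -L: -L Gamma is the
   Dirac mass at 0 in the sense of distributions and Gamma vanishes at
   infinity. The X_j being divergence free, L is its own formal adjoint. The
   value of Gamma at 0 is irrelevant. *)
Record fundamental_solution n m (X : 'I_m -> vfield R n)
    (Gamma : 'rV[R]_n -> R) : Prop := {
  fsol_smooth : smooth_on (~` [set 0]) Gamma ;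
  fsol_locint : locally_integrable_rV (EFin \o Gamma) ;
  fsol_dirac : forall phi, test_function setT phi ->
    integral_rV (fun x => (Gamma x * - sublaplacian X phi x)%:E) = (phi 0)%:E ;
  fsol_infty : forall eps : R, 0 < eps ->
    exists M : R, forall x, M < `|x| -> `|Gamma x| < eps }.

(* This determines rho_2 up to a positive multiplicative constant. *)
Definition fundamental_norm (d : seq nat) (X : 'I_(head 0%N d) -> vfield R (sumn d))
    (rho : 'rV[R]_(sumn d) -> R) : Prop :=
  [/\ homogeneous_norm rho, smooth_on (~` [set 0]) rho &
      exists c : R, fundamental_solution X
        (fun x => c * rho x `^ (2 - (homogeneous_dim d)%:R))].

Section rellich.
Variables (n m : nat) (X : 'I_m -> vfield R n) (rho : 'rV[R]_n -> R).
Variables (p theta : R).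

Definition rellich_lhs (u : 'rV[R]_n -> R) (x : 'rV[R]_n) : R :=
  `|u x| `^ p / rho x `^ (p * (theta + 2)) * hgrad_norm X rho x ^+ 2.

(* The inverse is taken in the extended reals, where 0^-1 = +oo: the weight is
   infinite where the horizontal gradient of rho vanishes. *)
Definition rellich_weight (x : 'rV[R]_n) : \bar R :=
  ((rho x `^ (p * theta) * hgrad_norm X rho x `^ (2 * (p - 1)))%:E^-1)%E.

Definition rellich_rhs (u : 'rV[R]_n -> R) (x : 'rV[R]_n) : \bar R :=
  ((`|sublaplacian X u x| `^ p)%:E * rellich_weight x)%E.

End rellich.

End carnot.

(* Main.v *)
(** Away from [0] the function [rho^(2-Q)] is annihilated by [L], because it is so
in the sense of distributions and the fields [X j] are divergence free (the
[k]-th component of [X j] is homogeneous of degree [s_k - 1], [s_k] being the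
weight of the coordinate [k], so that its [k]-th derivative is homogeneous of
degree [-1] and continuous at [0], hence zero). Therefore
[L rho = (Q - 1) |grad rho|^2 / rho], and functions of [rho] are handled by
one-variable calculus.

Put [a = (Q - p (theta + 2)) / p], [A = a (Q - 2 - a)] and
[g = p (theta + 2) - 2]; the constant of the theorem is [A^p]. The divergence of
an explicit combination of [u |u|^(p-2) rho^-g grad u] and
[|u|^p rho^(-g-1) grad rho] is [u |u|^(p-2) rho^-g L u] plus
[A |u|^p rho^(-g-2) |grad rho|^2] plus a square, the square vanishing for
[u = rho^-a]. With Young's inequality this gives the Rellich inequality
pointwise up to a divergence, and the divergence of a [C^1] field compactly
supported off [0] has integral zero.

For the sharpness, [rho^-a] is cut off smoothly at [|ln rho| = T]. Both
integrands become [H (ln rho) rho^-Q |grad rho|^2], whose integral depends only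
on the integral of [H] since [H' (ln rho) rho^-Q |grad rho|^2] is a divergence.
Comparing [H] with trapezoids, the plateau contributes a multiple of [T] and the
transition layers stay bounded. The critical set of [rho] has empty interior, as
the weight would be infinite on it. *)
Require Import Defs.
From HB Require Import structures.
From mathcomp Require Import all_boot all_order all_algebra.
From mathcomp Require Import all_classical all_reals all_analysis.
From mathcomp Require Import measurable_realfun.
From mathcomp Require Import ring lra.

Import Order.TTheory GRing.Theory Num.Theory.
Import numFieldNormedType.Exports.

Set Implicit Arguments.
Unset Strict Implicit.
Unset Printing Implicit Defensive.

Local Open Scope classical_set_scope.
Local Open Scope ring_scope.

(** The exponent [a] is the one for which [u = rho^-a] turns [|u|^p rho^(-p (theta + 2))] into
    [rho^-Q], whose integral against [|grad rho|^2] diverges only logarithmically, and [A] is read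
    off from [L (rho^-a) = -A rho^(-a-2) |grad rho|^2]. As [p >= 2], the function [u |u|^(p-2)] is
    of class C^1, so the field can be differentiated across the zeros of [u]. Two obstacles shape
    the argument. First, [rho] is smooth only off 0, and smoothness means continuity of iterated
    coordinate derivatives: identities are proved off 0 and integrated only for functions vanishing
    near 0, and each chain rule has a scalar outer function and is obtained by restriction to a
    line. Secondly, the weight is infinite at the critical points of [rho], where the right
    integrand may read 0 times infinity. In the inequality the right integral is therefore only
    bounded from below, by the integral of a continuous function; in the sharpness it is computed
    for functions whose sub-Laplacian carries a factor [|grad rho|^2] that absorbs the weight. *)

Lemma is_derive_mull (R : realType) (V : normedModType R) (f : V -> R)
    (c : R) x v df : is_derive x v f df ->
  is_derive x v (fun y => c * f y) (c * df).
Proof. by move=> D; have := @is_deriveZ _ _ _ f c x v df D. Qed.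

Lemma is_derive_linear (R : realType) (c x : R) : is_derive x 1 (fun y => c * y) c.
Proof. by rewrite -[X in is_derive _ _ _ X]mulr1; exact: is_derive_mull. Qed.

(** * Functions with continuous partial derivatives up to order k on a set *)

Section Ck.
Variables (R : realType) (n : nat).
Implicit Types (O : set 'rV[R]_n) (f g : 'rV[R]_n -> R).

Definition continuous_at_all O f := forall x, O x -> {for x, continuous f}.

(** The innermost derivative is peeled off, so that an induction on [k] replaces [f] by
    [partial i f]; no total differential is involved. *)
Fixpoint Ck k O f : Prop :=
  match k with
  | 0 => continuous_at_all O f
  | k'.+1 => continuous_at_all O f /\ forall i,
      (forall x, O x -> derivable f x (delta_mx 0 i)) /\ Ck k' O (partial i f)
  end.

Lemma Ck_continuous k O f : Ck k O f -> continuous_at_all O f.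
Proof. by case: k => [//|k] []. Qed.

Lemma CkS k O f : Ck k.+1 O f -> Ck k O f.
Proof.
elim: k f => [f []//|k IH f [cf df]]; split => // i.
by have [dfi cfi] := df i; split => //; exact: IH.
Qed.

Lemma Ck_partial k O f i : Ck k.+1 O f -> Ck k O (partial i f).
Proof. by case=> _ /(_ i)[]. Qed.

Lemma Ck_derivable k O f i x : Ck k.+1 O f -> O x ->
  derivable f x (delta_mx 0 i).
Proof. by case=> _ /(_ i)[+ _] => /[apply]. Qed.

Lemma Ck_subset k O O' f : O' `<=` O -> Ck k O f -> Ck k O' f.
Proof.
move=> sO; elim: k f => [f cf x /sO /cf//|k IH f [cf df]].
split=> [x /sO /cf//|i]; have [dfi cfi] := df i.
by split=> [x /sO/dfi//|]; exact: IH.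
Qed.

Lemma Ck_setU k O O' f : Ck k O f -> Ck k O' f -> Ck k (O `|` O') f.
Proof.
elim: k f => [f cf cf' x [/cf|/cf']//|k IH f [cf df] [cf' df']].
split=> [x [/cf|/cf']//|i].
have [dfi cfi] := df i; have [dfi' cfi'] := df' i.
by split=> [x [/dfi|/dfi']//|]; exact: IH.
Qed.

Lemma near_open O f g x : open O -> (forall y, O y -> f y = g y) -> O x ->
  \near x, f x = g x.
Proof.
move=> oO fg Ox; have : nbhs x O by exact: open_nbhs_nbhs.
by apply: filterS => y; exact: fg.
Qed.

Lemma partial_eq_open O f g i : open O -> (forall y, O y -> f y = g y) ->
  forall x, O x -> partial i f x = partial i g x.
Proof. by move=> oO fg x Ox; apply/near_eq_derive/(near_open oO). Qed.

Lemma vderiv_eq_open (V : vfield R n) O f g : open O ->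
  (forall y, O y -> f y = g y) -> forall x, O x -> vderiv V f x = vderiv V g x.
Proof.
move=> oO fg x Ox; apply: eq_bigr => i _.
by rewrite (partial_eq_open _ oO fg).
Qed.

Lemma continuous_eq_open O f g : open O -> (forall x, O x -> f x = g x) ->
  continuous_at_all O f -> continuous_at_all O g.
Proof.
move=> oO fg cf x Ox; rewrite /prop_for /continuous_at -(fg x Ox).
apply: cvg_trans (cf x Ox); apply: (near_eq_cvg (F := nbhs x)).
exact: (near_open oO).
Qed.

(** On an open set a pointwise identity can be differentiated; in the inductions below this replaces
    a derivative by its formula. *)
Lemma Ck_eq_open k O f g : open O -> (forall x, O x -> f x = g x) ->
  Ck k O f -> Ck k O g.
Proof.
move=> oO; elim: k f g => [|k IH] f g fg; first exact: continuous_eq_open.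
move=> [cf df]; split; first exact: continuous_eq_open cf.
move=> i; have [dfi cfi] := df i; split.
  move=> x Ox; apply: near_eq_derivable (dfi _ Ox).
  exact: (near_open oO).
apply: IH cfi => x Ox; exact: (partial_eq_open _ oO fg).
Qed.

Lemma partial_cst (c : R) i : partial i (fun _ : 'rV[R]_n => c) = fun=> 0.
Proof. by apply/funext => x; rewrite /partial derive_cst. Qed.

Lemma Ck_cst k O (c : R) : Ck k O (fun=> c).
Proof.
have cc (c' : R) : continuous_at_all O (fun=> c').
  by move=> x _; exact: cst_continuous.
elim: k c => [|k IH] c /=; first exact: cc.
split; first exact: cc.
by move=> i; rewrite partial_cst; split=> // x _; exact: derivable_cst.
Qed.

Lemma partialD f g i x : derivable f x (delta_mx 0 i) ->
  derivable g x (delta_mx 0 i) ->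
  partial i (fun y => f y + g y) x = partial i f x + partial i g x.
Proof. exact: deriveD. Qed.

Lemma partialM f g i x : derivable f x (delta_mx 0 i) ->
  derivable g x (delta_mx 0 i) ->
  partial i (fun y => f y * g y) x = f x * partial i g x + g x * partial i f x.
Proof. exact: deriveM. Qed.

Lemma CkD k O f g : open O -> Ck k O f -> Ck k O g ->
  Ck k O (fun x => f x + g x).
Proof.
move=> oO; elim: k f g => [|k IH] f g.
  by move=> cf cg x Ox; apply: continuousD; [exact: cf|exact: cg].
move=> [cf df] [cg dg]; split.
  by move=> x Ox; apply: continuousD; [exact: cf|exact: cg].
move=> i; have [dfi cfi] := df i; have [dgi cgi] := dg i; split.
  by move=> x Ox; apply: derivableD; [exact: dfi|exact: dgi].
apply: Ck_eq_open oO _ (IH _ _ cfi cgi) => x Ox; apply/esym/partialD.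
  exact: dfi.
exact: dgi.
Qed.

Lemma CkM k O f g : open O -> Ck k O f -> Ck k O g ->
  Ck k O (fun x => f x * g x).
Proof.
move=> oO; elim: k f g => [|k IH] f g.
  by move=> cf cg x Ox; apply: continuousM; [exact: cf|exact: cg].
move=> /[dup] /CkS ckf [cf df] /[dup] /CkS ckg [cg dg]; split.
  by move=> x Ox; apply: continuousM; [exact: cf|exact: cg].
move=> i; have [dfi cfi] := df i; have [dgi cgi] := dg i; split.
  by move=> x Ox; apply: derivableM; [exact: dfi|exact: dgi].
apply: (Ck_eq_open oO _ (CkD oO (IH _ _ ckf cgi) (IH _ _ ckg cfi))).
by move=> x Ox; apply/esym/partialM; [exact: dfi|exact: dgi].
Qed.

Lemma CkN k O f : open O -> Ck k O f -> Ck k O (fun x => - f x).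
Proof.
move=> oO cf; have := CkM oO (Ck_cst k O (-1)) cf.
by apply: Ck_eq_open => // x _; rewrite mulN1r.
Qed.

Lemma CkB k O f g : open O -> Ck k O f -> Ck k O g ->
  Ck k O (fun x => f x - g x).
Proof. by move=> oO cf cg; apply: CkD => //; exact: CkN. Qed.

Lemma Ck_sum k O (I : Type) (s : seq I) (F : I -> 'rV[R]_n -> R) : open O ->
  (forall i, Ck k O (F i)) -> Ck k O (fun x => \sum_(i <- s) F i x).
Proof.
move=> oO cF; elim: s => [|i s IH].
  by apply: Ck_eq_open oO _ (Ck_cst k O 0) => x _; rewrite big_nil.
apply: Ck_eq_open oO _ (CkD oO (cF i) IH) => x _.
by rewrite big_cons.
Qed.

Lemma Ck_prod k O (I : Type) (s : seq I) (F : I -> 'rV[R]_n -> R) : open O ->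
  (forall i, Ck k O (F i)) -> Ck k O (fun x => \prod_(i <- s) F i x).
Proof.
move=> oO cF; elim: s => [|i s IH].
  by apply: Ck_eq_open oO _ (Ck_cst k O 1) => x _; rewrite big_nil.
apply: Ck_eq_open oO _ (CkM oO (cF i) IH) => x _.
by rewrite big_cons.
Qed.

Lemma is_derive_coord (x v : 'rV[R]_n) j :
  is_derive x v (fun y : 'rV[R]_n => y 0 j) (v 0 j).
Proof.
have : is_derive x v (@id 'rV[R]_n) v by exact: is_derive_id.
move=> [did Did].
apply: DeriveDef; first by move/derivable_mxP : did => /(_ 0 j).
by move: (Did); rewrite derive_mx// => /matrixP/(_ 0 j); rewrite !mxE.
Qed.

Lemma Ck_coord k O j : open O -> Ck k O (fun x => x 0 j).
Proof.
have cc : continuous_at_all O (fun x => x 0 j).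
  by move=> x _; exact: coord_continuous.
move=> oO; case: k => [//|k]; split=> // i; split.
  by move=> x _; have [] := is_derive_coord x (delta_mx 0 i) j.
apply: (Ck_eq_open oO _ (Ck_cst k O ((delta_mx 0 i : 'rV[R]_n) 0 j))).
by move=> x _; rewrite /partial; have [_ ->] := is_derive_coord x (delta_mx 0 i) j.
Qed.

(** The derivative is existential rather than [derive1 phi], so that regularity is shown by
    exhibiting a formula valid on [U]. *)
Fixpoint Ck1d k (U : set R) (phi : R -> R) : Prop :=
  match k with
  | 0 => forall y, U y -> {for y, continuous phi}
  | k'.+1 => exists2 dphi, (forall y, U y -> is_derive y 1 phi (dphi y)) &
      Ck1d k' U dphi
  end.

Lemma derive_line f x v :
  'D_v f x = derive1 (fun t : R => f (t *: v + x)) 0.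
Proof.
rewrite derive1E /derive; congr (lim _).
have -> // : (fun k : R => k^-1 *: ((f \o shift x) (k *: v) - f x)) =
  (fun k : R => k^-1 *: (((fun t : R => f (t *: v + x)) \o shift 0) (k *: 1)
     - f (0 *: v + x))).
by apply/funext => t /=; rewrite addr0 scale0r add0r [t *: 1]mulr1.
Qed.

Lemma is_derive_line f x v df : is_derive x v f df ->
  is_derive (0 : R) 1 (fun t : R => f (t *: v + x)) df.
Proof.
move=> [dfx Df]; have dg := (derivable1P _ _ _).1 dfx.
by apply: (DeriveDef dg); rewrite -derive1E -derive_line.
Qed.

(** Along the line [h |-> x + h v] this is the chain rule in one variable; only the derivative of
    [f] in the direction [v] enters. *)
Lemma is_derive_comp (phi : R -> R) f x v (dphi df : R) :
  is_derive (f x) 1 phi dphi -> is_derive x v f df ->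
  is_derive x v (phi \o f) (dphi * df).
Proof.
move=> dp dfx; pose g (h : R) := f (h *: v + x).
have dpg : is_derive (0 : R) 1 (phi \o g) (dphi * df).
  apply: is_derive1_comp; last exact: is_derive_line.
  by rewrite /g scale0r add0r.
have dpf : derivable (phi \o f) x v by apply/derivable1P; case: dpg.
by apply: (DeriveDef dpf); rewrite derive_line derive1E; case: dpg.
Qed.

Lemma partial_comp (phi : R -> R) f x i (dphi : R) :
  is_derive (f x) 1 phi dphi -> derivable f x (delta_mx 0 i) ->
  partial i (phi \o f) x = dphi * partial i f x.
Proof.
move=> dp dfx.
by rewrite /partial; have [_ ->] := is_derive_comp dp (derivableP dfx).
Qed.

Lemma Ck1d_continuous k (U : set R) phi y : Ck1d k U phi -> U y ->
  {for y, continuous phi}.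
Proof.
case: k => [|k]; first by move=> /[apply].
move=> [dphi dp _] /dp[dy _].
by apply: differentiable_continuous; exact/derivable1_diffP.
Qed.

Lemma Ck_comp k O (U : set R) phi f : open O -> (forall x, O x -> U (f x)) ->
  Ck1d k U phi -> Ck k O f -> Ck k O (phi \o f).
Proof.
move=> oO OU; elim: k phi f OU => [|k IH] phi f OU.
  move=> cp cf x Ox; apply: (@continuous_comp _ _ _ f phi); first exact: cf.
  by apply: cp; exact: OU.
move=> /[dup] cp [dphi dp cdp] /[dup] /CkS cSf [cf df]; split.
  move=> x Ox; apply: (@continuous_comp _ _ _ f phi); first exact: cf.
  by apply: (Ck1d_continuous cp); exact: OU.
move=> i; have [dfi cfi] := df i; split.
  move=> x Ox.
  by have [] := is_derive_comp (dp _ (OU _ Ox))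
    (derivableP (dfi _ Ox)).
apply: (Ck_eq_open oO _ (CkM oO (IH _ _ OU cdp cSf) cfi)).
by move=> x Ox; rewrite (partial_comp (dp _ (OU _ Ox)) (dfi _ Ox)).
Qed.

(** In [foldr] the head of [s] is the outermost derivative, whereas [Ck] strips the innermost one;
    hence lists are extended at their end. *)
Lemma smooth_onP O f : smooth_on O f <-> forall k, Ck k O f.
Proof.
split.
  move=> sf k; elim: k f sf => [|k IH] f sf.
    by move=> x Ox; have [] := sf [::] _ Ox.
  split; first by move=> x Ox; have [] := sf [::] _ Ox.
  move=> i; split; first by move=> x Ox; have [_ /(_ i)] := sf [::] _ Ox.
  apply: IH => s x Ox; have := sf (rcons s i) x Ox.
  by rewrite foldr_rcons.
move=> cf s; elim/last_ind: s f cf => [|s i IH] f cf x Ox.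
  by have [cf0 df] := cf 1; split=> [|i]; [exact: cf0|have [/(_ x Ox)] := df i].
rewrite foldr_rcons; apply: IH => // k; exact: Ck_partial.
Qed.

Lemma vderivD V k O f g x : Ck k.+1 O f -> Ck k.+1 O g -> O x ->
  vderiv V (fun y => f y + g y) x = vderiv V f x + vderiv V g x.
Proof.
move=> cf cg Ox; rewrite /vderiv -big_split/=; apply: eq_bigr => i _.
by rewrite (partialD (Ck_derivable cf Ox) (Ck_derivable cg Ox)) mulrDr.
Qed.

Lemma vderivM V k O f g x : Ck k.+1 O f -> Ck k.+1 O g -> O x ->
  vderiv V (fun y => f y * g y) x = f x * vderiv V g x + g x * vderiv V f x.
Proof.
move=> cf cg Ox; rewrite /vderiv !mulr_sumr -big_split/=.
apply: eq_bigr => i _.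
by rewrite (partialM (Ck_derivable cf Ox) (Ck_derivable cg Ox)); ring.
Qed.

Lemma vderiv_cst (V : vfield R n) (c : R) : vderiv V (fun=> c) = fun=> 0.
Proof.
by apply/funext => x; rewrite /vderiv big1// => i _; rewrite partial_cst mulr0.
Qed.

Lemma vderivZ V k O f c x : Ck k.+1 O f -> O x ->
  vderiv V (fun y => c * f y) x = c * vderiv V f x.
Proof.
move=> cf Ox; rewrite (vderivM _ (Ck_cst k.+1 O c) cf)//.
by rewrite vderiv_cst mulr0 addr0.
Qed.

Lemma vderivB V k O f g x : open O -> Ck k.+1 O f -> Ck k.+1 O g -> O x ->
  vderiv V (fun y => f y - g y) x = vderiv V f x - vderiv V g x.
Proof.
move=> oO cf cg Ox; rewrite (vderivD _ cf (CkN oO cg) Ox); congr (_ + _).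
transitivity (vderiv V (fun y => -1 * g y) x).
  by congr (vderiv V _ x); apply/funext => y; rewrite mulN1r.
by rewrite (vderivZ _ _ cg Ox) mulN1r.
Qed.

Lemma vderiv_comp V k O (phi : R -> R) f x (dphi : R) : Ck k.+1 O f -> O x ->
  is_derive (f x) 1 phi dphi ->
  vderiv V (phi \o f) x = dphi * vderiv V f x.
Proof.
move=> cf Ox dp; rewrite /vderiv mulr_sumr; apply: eq_bigr => i _.
by rewrite (partial_comp dp (Ck_derivable cf Ox)); ring.
Qed.

Lemma Ck_vderiv (V : vfield R n) k O f : open O -> (forall i, Ck k O (fun x => V x 0 i)) ->
  Ck k.+1 O f -> Ck k O (vderiv V f).
Proof.
move=> oO cV cf; apply: Ck_sum => // i; apply: CkM => //.
exact: Ck_partial.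
Qed.

End Ck.

(** * Measurability and integrability of continuous functions with compact support *)

Section integration.
Variable R : realType.

Local Notation leb n := (lebesgue_tuple (R := R) (n := n)).

Lemma measurable_tnth_tuple n (i : 'I_n) : measurable_fun setT
  (fun t : n.-tuple (measurableTypeR R) => tnth t i).
Proof. exact: measurable_tnth. Qed.

Lemma measurable_ballR (x e : R) :
  measurable (ball x e : set (measurableTypeR R)).
Proof.
exact: (@open_measurable R (ball x e) (ball_open x e)).
Qed.

Lemma measurable_rv_ball n (x : 'rV[R]_n) (e : R) :
  measurable (@rv_of_tuple R n @^-1` ball x e).
Proof.
(* A ball of nonpositive radius is empty even for [n = 0], where an intersection over the
   coordinates would be the whole space. *)
have [e0|e0] := ltP 0 e; last first.
  rewrite (_ : _ @^-1` _ = set0)//; apply/seteqP; split=> // t [] /=.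
  by rewrite ltNge e0.
rewrite (_ : _ @^-1` _ = \bigcap_(i in [set: 'I_n])
    ((fun t => tnth t i) @^-1` (ball (x 0 i) e : set (measurableTypeR R)))).
  apply: fin_bigcap_measurable => // i _.
  rewrite -[X in measurable X]setTI; apply: measurable_tnth_tuple => //.
  exact: measurable_ballR.
apply/seteqP; split => [t [_ xt] i _|t xt]; first by have := xt 0 i; rewrite mxE.
by split=> // i j; rewrite mxE ord1; exact: xt.
Qed.

(** An open set is the countable union of the balls it contains with rational centre and radius
    [1/(k+1)], and balls of row vectors are boxes. *)
Lemma measurable_rv_open n (O : set 'rV[R]_n) : open O ->
  measurable (@rv_of_tuple R n @^-1` O).
Proof.
move=> oO.
pose F (u : 'rV[rat]_n * nat) : set (n.-tuple (measurableTypeR R)) :=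
  let b := ball (\row_i (ratr (u.1 0 i) : R)) (u.2.+1%:R^-1) in
  if `[< b `<=` O >] then @rv_of_tuple R n @^-1` b else set0.
rewrite (_ : _ @^-1` O = \bigcup_u F u).
  apply: countable_bigcupT_measurable => [|u]; first exact: countableP.
  rewrite /F.
  by case: asboolP => // _; exact: measurable_rv_ball.
apply/seteqP; split => [t /= Ot|t [u _]]; last first.
  by rewrite /F; case: asboolP => // + tu; exact.
have /nbhs_ballP[e /= e0 eO] : nbhs (rv_of_tuple t) O by exact: open_nbhs_nbhs.
(* If the centre is within [1/(k+1)] of [t], the ball of that radius stays within [2/(k+1) <= e] of
   [t]. *)
have [k ke] : exists k : nat, k.+1%:R^-1 + k.+1%:R^-1 <= e :> R.
  have e20 : 0 < e / 2 by rewrite divr_gt0.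
  have [k _ ke] := near_infty_natSinv_lt (PosNum e20).
  by exists k; rewrite (splitr e); apply: lerD; apply/ltW/ke => /=.
have /choice[q qt] (i : 'I_n) : exists q : rat,
    ball (tnth t i : R) (k.+1%:R^-1) (ratr q : R).
  have /rat_in_itvoo[q] : (tnth t i : R) < tnth t i + k.+1%:R^-1.
    by rewrite ltrDl invr_gt0.
  rewrite in_itv/= => /andP[q1 q2]; exists q.
  by rewrite /ball/= ltr_distlC q2 andbT (lt_trans _ q1)// ltrBlDr ltrDl invr_gt0.
exists (\row_i q i, k) => //; rewrite /F.
have qb : ball (\row_i (ratr ((\row_i q i) 0 i) : R)) (k.+1%:R^-1) (rv_of_tuple t).
  split; first by rewrite invr_gt0.
  by move=> i j; rewrite !mxE; apply: ball_sym; exact: qt.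
case: asboolP => // -[] y /= qy; apply: eO.
apply: le_ball ke _ _.
by apply: ball_triangle qy; exact: ball_sym.
Qed.

Lemma measurable_continuous_rv n (f : 'rV[R]_n -> R) : continuous f ->
  measurable_fun setT (fun t => f (rv_of_tuple t) : measurableTypeR R).
Proof.
move=> cf; apply: (measurability _ (RGenOpens.measurableE R)).
move=> _ [_ [a [b ->] <-]]; rewrite setTI.
rewrite -[X in measurable X]/(@rv_of_tuple R n @^-1` (f @^-1` `]a, b[)).
apply: measurable_rv_open.
by apply: open_comp; [move=> x _; exact: cf|exact: interval_open].
Qed.

Lemma norm_coord_le n (x : 'rV[R]_n) i : `|x 0 i| <= `|x|.
Proof.
rewrite [leRHS]/Num.Def.normr/= mx_normrE.
exact: (le_bigmax _ (fun u => `|x u.1 u.2|) (0, i)).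
Qed.

Lemma norm_le_coord n (x : 'rV[R]_n) M : 0 <= M ->
  (forall i, `|x 0 i| <= M) -> `|x| <= M.
Proof.
move=> M0 xM; rewrite [leLHS]/Num.Def.normr/= mx_normrE.
by apply: bigmax_le => // -[i j] _; rewrite ord1; exact: xM.
Qed.

Definition Cc n (f : 'rV[R]_n -> R) :=
  continuous f /\ exists M : R, forall x, M < `|x| -> f x = 0.

Lemma closed_le_norm n (M : R) : closed [set x : 'rV[R]_n | `|x| <= M].
Proof.
rewrite -[X in closed X]/((fun x : 'rV[R]_n => `|x|) @^-1` [set r | r <= M]).
by apply: closed_comp => [x _|]; [exact: norm_continuous|exact: closed_le]. Qed.

Lemma compact_le_norm n (M : R) : compact [set x : 'rV[R]_n | `|x| <= M].
Proof.
apply: bounded_closed_compact; last exact: closed_le_norm.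
by exists M; split; [exact: num_real|move=> N MN x /= xM; exact: le_trans xM (ltW MN)].
Qed.

Lemma Cc_bounded n (f : 'rV[R]_n -> R) : Cc f -> exists2 B, 0 < B &
  forall x, `|f x| <= B.
Proof.
move=> [cf [M fM]].
have cK : compact (f @` [set x | `|x| <= M]).
  apply: continuous_compact; last exact: compact_le_norm.
  exact: continuous_subspaceT.
have [B [_ BB]] := compact_bounded cK.
exists (`|B| + 1) => [|x]; first by rewrite ltr_pwDr.
have [xM|xM] := leP `|x| M; last by rewrite fM// normr0 addr_ge0.
by apply: BB; [rewrite (le_lt_trans (ler_norm _))// ltrDl|exists x].
Qed.

Lemma measurable_rv_closed n (K : set 'rV[R]_n) : closed K ->
  measurable (@rv_of_tuple R n @^-1` K).
Proof.
move=> cK; rewrite -[K]setCK preimage_setC; apply: measurableC.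
by apply: (@measurable_rv_open n (~` K)); exact: closed_openC.
Qed.

Lemma leb_le_norm_lty n (M : R) :
  (leb n (@rv_of_tuple R n @^-1` [set x | (`|x| <= M)%R]) < +oo)%E.
Proof.
apply: (@le_lt_trans _ _ (leb n [set t : n.-tuple (measurableTypeR R) | forall i : 'I_n,
    (`[- M, M]%classic : set (measurableTypeR R)) (tnth t i)])).
  apply: le_measure; rewrite ?inE.
  - apply: measurable_rv_closed; exact: closed_le_norm.
  - rewrite (_ : [set t | _] = \bigcap_(i in [set: 'I_n])
      ((fun t => tnth t i) @^-1` (`[- M, M]%classic : set (measurableTypeR R)))).
      apply: fin_bigcap_measurable => // i _.
      by rewrite -[X in measurable X]setTI; exact: (@measurable_tnth_tuple n).
    by apply/seteqP; split => [t tM i _|t tM i]; exact: tM.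
  - move=> t /= tM i; rewrite /= in_itv/= -ler_norml.
    apply: le_trans tM.
    have -> : tnth t i = rv_of_tuple t 0 i :> R by rewrite mxE.
    exact: (@norm_coord_le n).
rewrite (lebesgue_tuple_box (A := fun _ : 'I_n => `[- M, M]%classic));
  last by move=> i; exact: measurable_itv.
suff : (\prod_(i < n) lebesgue_measure (`[(- M)%R, M]%classic : set (measurableTypeR R)))%E
    \is a fin_num by rewrite fin_numElt => /andP[].
elim/big_ind : _ => // [x y|i _]; first exact: fin_numM.
by rewrite lebesgue_measure_itv/=; case: ifP.
Qed.

Lemma integrable_Cc n (f : 'rV[R]_n -> R) : Cc f ->
  (leb n).-integrable setT (fun t => (f (rv_of_tuple t))%:E).
Proof.
move=> cf; have [B B0 fB] := Cc_bounded cf; have [cof [M fM]] := cf.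
pose K := @rv_of_tuple R n @^-1` [set x | `|x| <= M].
have mK : measurable K by apply: measurable_rv_closed; exact: closed_le_norm.
rewrite -(setTI K) in mK.
have : (leb n).-integrable K (EFin \o (fun t => f (rv_of_tuple t))).
  apply: measurable_bounded_integrable.
  - by rewrite -(setTI K).
  - exact: leb_le_norm_lty.
  - apply: measurable_funTS; exact: measurable_continuous_rv.
  - by exists B; split; [exact: num_real|move=> C BC t _; exact: le_trans (fB _) (ltW BC)].
rewrite integrable_mkcond; last by rewrite -(setTI K).
apply: eq_integrable => // t _; rewrite /patch; case: ifPn => //.
by rewrite notin_setE /K/= => /negP; rewrite -ltNge => /fM ->.
Qed.

End integration.

(** * The integral of a partial derivative of a compactly supported function *)

Section integral_partial.
Variable R : realType.

Local Notation leb n := (lebesgue_tuple (R := R) (n := n)).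

Definition rv_cons n (x : R) (v : 'rV[R]_n) : 'rV[R]_n.+1 :=
  \row_i (if unlift ord0 i is Some j then v 0 j else x).

Lemma rv_cons0 n x (v : 'rV[R]_n) : rv_cons x v 0 ord0 = x.
Proof. by rewrite mxE unlift_none. Qed.

Lemma rv_consS n x (v : 'rV[R]_n) j : rv_cons x v 0 (lift ord0 j) = v 0 j.
Proof. by rewrite mxE liftK. Qed.

Lemma rv_of_tuple_cons n x (t : n.-tuple (measurableTypeR R)) :
  rv_of_tuple (tuple_cons (x, t)) = rv_cons x (rv_of_tuple t).
Proof.
apply/rowP => i; case: (unliftP ord0 i) => [j|] ->.
  by rewrite rv_consS !mxE tnthS.
by rewrite rv_cons0 mxE.
Qed.

Lemma rv_consDl n h x (v : 'rV[R]_n) :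
  rv_cons (h + x) v = h *: delta_mx 0 ord0 + rv_cons x v.
Proof.
apply/rowP => i; case: (unliftP ord0 i) => [j|] ->.
  by rewrite rv_consS [RHS]mxE rv_consS !mxE mulr0 add0r.
by rewrite rv_cons0 [RHS]mxE rv_cons0 !mxE eqxx mulr1.
Qed.

Lemma rv_consDr n h x (v : 'rV[R]_n) j :
  rv_cons x (h *: delta_mx 0 j + v) = h *: delta_mx 0 (lift ord0 j) + rv_cons x v.
Proof.
apply/rowP => i; case: (unliftP ord0 i) => [k|] ->.
  by rewrite rv_consS [RHS]mxE rv_consS !mxE (inj_eq lift_inj).
by rewrite rv_cons0 [RHS]mxE rv_cons0 !mxE mulr0 add0r.
Qed.

Lemma ler_norm_rv_consl n x (v : 'rV[R]_n) : `|x| <= `|rv_cons x v|.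
Proof. by have := norm_coord_le (rv_cons x v) ord0; rewrite rv_cons0. Qed.

Lemma ler_norm_rv_consr n x (v : 'rV[R]_n) : `|v| <= `|rv_cons x v|.
Proof.
apply: norm_le_coord => // i.
by have := norm_coord_le (rv_cons x v) (lift ord0 i); rewrite rv_consS.
Qed.

Lemma continuous_rv_consr n x : continuous (@rv_cons n x).
Proof.
move=> v; apply/(@cvgrPdist_le R _ _ _ (nbhs_filter v) (@rv_cons n x)) => e e0; near=> w.
have -> : rv_cons x v - rv_cons x w = rv_cons 0 (v - w).
  apply/rowP => i; case: (unliftP ord0 i) => [j|] ->.
    by rewrite rv_consS [LHS]mxE [X in _ + X]mxE !rv_consS !mxE.
  by rewrite rv_cons0 [LHS]mxE [X in _ + X]mxE !rv_cons0 subrr.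
apply: (@le_trans _ _ `|v - w|).
  apply: norm_le_coord => // i; case: (unliftP ord0 i) => [j|] ->.
    by rewrite rv_consS norm_coord_le.
  by rewrite rv_cons0 normr0.
by near: w; apply/nbhs_ballP; exists e => // w; rewrite -ball_normE/= => /ltW.
Unshelve. all: by end_near. Qed.

Lemma rv_cons_line n x (v : 'rV[R]_n) :
  rv_cons x v = x *: delta_mx 0 ord0 + rv_cons 0 v.
Proof. by rewrite -rv_consDl addr0. Qed.

Lemma continuous_rv_consl n (v : 'rV[R]_n) : continuous (fun x => rv_cons x v).
Proof.
move=> x; apply: differentiable_continuous.
rewrite (_ : (fun x => rv_cons x v) =
    (fun x : R => x *: delta_mx 0 ord0) + cst (rv_cons 0 v)).
  by apply: differentiableD => //; apply: differentiableZl.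
by apply/funext => y; rewrite rv_cons_line.
Qed.

Lemma derive_rv_consl n (f : 'rV[R]_n.+1 -> R) x (v : 'rV[R]_n) :
  derivable f (rv_cons x v) (delta_mx 0 ord0) ->
  is_derive x 1 (fun y => f (rv_cons y v)) (partial ord0 f (rv_cons x v)).
Proof.
have E (h : R) : h^-1 *: (f (rv_cons (h *: 1 + x) v) - f (rv_cons x v)) =
    h^-1 *: (f (h *: delta_mx 0 ord0 + rv_cons x v) - f (rv_cons x v)).
  by rewrite [h *: 1]mulr1 rv_consDl.
move=> df; apply: DeriveDef; rewrite /derivable /partial /derive/=.
  by under eq_fun do rewrite E.
by under eq_fun do rewrite E.
Qed.

Lemma derivable_rv_consr n (f : 'rV[R]_n.+1 -> R) x (v : 'rV[R]_n) j :
  derivable f (rv_cons x v) (delta_mx 0 (lift ord0 j)) ->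
  derivable (f \o rv_cons x) v (delta_mx 0 j).
Proof. by rewrite /derivable/=; under [in X in _ -> X]eq_fun do rewrite rv_consDr. Qed.

Lemma partial_rv_consr n (f : 'rV[R]_n.+1 -> R) x j :
  partial j (f \o rv_cons x) = partial (lift ord0 j) f \o rv_cons x.
Proof.
by apply/funext => v; rewrite /partial /derive/=; under eq_fun do rewrite rv_consDr.
Qed.

Lemma Cc_partial n (f : 'rV[R]_n -> R) i : Ck 1 setT f ->
  (exists M : R, forall x, M < `|x| -> f x = 0) -> Cc (partial i f).
Proof.
move=> [_ df] [M fM]; split.
  by have [_ +] := df i; move=> + x; exact.
exists M => x xM.
have oM : open [set y : 'rV[R]_n | (M < `|y|)%R].
  rewrite -[X in open X]/((fun x : 'rV[R]_n => `|x|) @^-1` [set r | (M < r)%R]).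
  by apply: open_comp => [y _|]; [exact: norm_continuous|exact: open_gt].
by rewrite (partial_eq_open i oM fM)// partial_cst.
Qed.

Lemma integral_derive_cpt (g dg : R -> R) (M : R) : (forall x : R, is_derive x 1 g (dg x)) ->
  continuous dg -> (forall x, M < `|x| -> (g x = 0) /\ (dg x = 0)) ->
  (\int[@lebesgue_measure R]_x (dg x)%:E = 0)%E.
Proof.
move=> Dg cdg gM.
have cg : continuous g.
  by move=> x; apply: differentiable_continuous; apply/derivable1_diffP; have [] := Dg x.
pose N := `|M| + 1.
have N0 : 0 < N by rewrite ltr_pwDr.
have MN : M < N by rewrite (le_lt_trans (ler_norm M))// ltrDl.
transitivity (\int[lebesgue_measure]_(x in
  (`[(- N)%R, N]%classic : set (measurableTypeR R))) (dg x)%:E)%E.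
  rewrite [RHS]integral_mkcond; apply: eq_integral => x _.
  rewrite patchE; case: ifPn => //; rewrite notin_setE/= in_itv/= -ler_norml => /negP.
  by rewrite -ltNge => /(lt_trans MN)/gM[_ ->].
rewrite (@continuous_FTC2 _ dg g).
- rewrite (gM N _).1 ?(gM (- N) _).1 ?subee// ?normrN gtr0_norm//.
- by rewrite gtrN.
- exact: continuous_subspaceT.
- split.
  + by move=> x _; have [] := Dg x.
  + exact/cvg_at_right_filter/cg.
  + exact/cvg_at_left_filter/cg.
- by move=> x _; rewrite derive1E; have [_ ->] := Dg x.
Qed.

(** Fubini's theorem splits off the first coordinate, in the order that keeps the differentiated
    variable inside: if it is the first one, the inner integral vanishes by the fundamental theorem
    of calculus, otherwise by induction on the dimension. *)
Lemma integral_rV_partial n i (f : 'rV[R]_n -> R) : Ck 1 setT f ->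
  (exists M : R, forall x, M < `|x| -> f x = 0) ->
  integral_rV (fun x => (partial i f x)%:E) = 0%E.
Proof.
elim: n i f => [[]//|n IH] i f cf [M fM].
have cpf : Cc (partial i f) by apply: Cc_partial => //; exists M.
have ipf := integrable_Cc cpf.
pose F := (fun t : n.+1.-tuple (measurableTypeR R) => (partial i f (rv_of_tuple t))%:E).
have mF : measurable_fun [set: n.+1.-tuple (measurableTypeR R)] (F : _ -> \bar (measurableTypeR R)).
  by apply/measurable_EFinP; apply: measurable_continuous_rv; case: cpf.
pose P := ((@lebesgue_measure R) \x leb n)%E.
have mc : measurable_fun setT (@tuple_cons R n) by exact: measurable_tuple_cons.
have iP : P.-integrable setT (F \o @tuple_cons R n).
  apply/integrableP; split; first exact: measurableT_comp.
  move/integrableP : ipf => [_]; apply: le_lt_trans.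
  rewrite [X in (_ <= X)%E](_ : _ =
    (\int[pushforward P (@tuple_cons R n)]_x `|F x|)%E)//.
  rewrite ge0_integral_pushforward//.
  exact: measurableT_comp.
have -> : integral_rV (fun x => (partial i f x)%:E) = (\int[P]_z (F \o @tuple_cons R n) z)%E.
  rewrite /integral_rV [LHS](_ : _ =
    (\int[pushforward P (@tuple_cons R n)]_x F x)%E)//.
  by rewrite integral_pushforward.
case: (unliftP ord0 i) => [j ij|i0].
  rewrite -integral12_prod_meas1//.
  rewrite integral0_eq// => x _; rewrite /fubini_F.
  rewrite -[RHS](IH j (f \o rv_cons x)).
  - by apply: eq_integral => t _; rewrite /F/= rv_of_tuple_cons partial_rv_consr ij.
  - case: cf => cf df; split.
      by move=> v _; apply: continuous_comp; [exact: continuous_rv_consr|exact: cf].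
    move=> k; have [d1 d2] := df (lift ord0 k); split.
      by move=> v _; apply: derivable_rv_consr; exact: d1.
    rewrite partial_rv_consr => v _.
    by apply: continuous_comp; [exact: continuous_rv_consr|exact: d2].
  - by exists M => v vM; apply: fM; apply: lt_le_trans vM (ler_norm_rv_consr _ _).
rewrite -integral21_prod_meas1//.
rewrite integral0_eq// => t _; rewrite /fubini_G.
have [cpf1 [N pN]] := cpf.
under eq_integral do rewrite /F/= rv_of_tuple_cons.
apply: (@integral_derive_cpt (fun x => f (rv_cons x (rv_of_tuple t))) _ (Num.max M N)).
- move=> x; rewrite i0; apply: derive_rv_consl.
  by case: cf => _ /(_ ord0)[d _]; exact: d.
- move=> x; apply: (@continuous_comp _ _ _ (fun x => rv_cons x (rv_of_tuple t)) (partial i f)).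
    exact: continuous_rv_consl.
  exact: cpf1.
- move=> x; rewrite gt_max => /andP[xM xN]; split.
    by apply: fM; apply: lt_le_trans xM (ler_norm_rv_consl _ _).
  by apply: pN; apply: lt_le_trans xN (ler_norm_rv_consl _ _).
Qed.

End integral_partial.

(** * Homogeneity and vanishing divergence of the left-invariant fields *)

Section carnot_fields.
Variables (R : realType) (d : seq nat).
Local Notation n := (sumn d).
Variables (op : 'rV[R]_n -> 'rV[R]_n -> 'rV[R]_n).
Variable (X : 'I_(head 0%N d) -> vfield R n).
Hypothesis carnot : homogeneous_carnot_group op X.

Lemma dilationZ (l c : R) (x : 'rV[R]_n) : dilation l (c *: x) = c *: dilation l x.
Proof. by apply/rowP => i; rewrite !mxE; ring. Qed.

Lemma dilationD (l : R) (x y : 'rV[R]_n) :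
  dilation l (x + y) = dilation l x + dilation l y.
Proof. by apply/rowP => i; rewrite !mxE; ring. Qed.

Lemma dilation_delta (l : R) k : dilation l (delta_mx 0 k : 'rV[R]_n) =
  l ^+ (reshape_index d k).+1 *: delta_mx 0 k.
Proof.
by apply/rowP => i; rewrite !mxE; case: (eqVneq i k) => [->|_]//; rewrite andbF !mulr0.
Qed.

Lemma dilationK (l : R) : l != 0 ->
  cancel (dilation l^-1) (@dilation R d l).
Proof.
move=> l0 x; apply/rowP => i; rewrite !mxE mulrA -exprMn mulfV//.
by rewrite expr1n mul1r.
Qed.

Lemma norm_dilation_le (l : R) (x : 'rV[R]_n) : 0 <= l <= 1 ->
  `|dilation l x| <= l * `|x|.
Proof.
move=> /andP[l0 l1]; apply: norm_le_coord => [|i]; first by rewrite mulr_ge0.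
rewrite mxE normrM ger0_norm ?exprn_ge0//.
apply: ler_pM => //; [exact: exprn_ge0|exact: ler_iXnr|exact: norm_coord_le].
Qed.

(** An automorphism fixes the neutral element [e], in particular [dilation 2] does; it multiplies
    each coordinate by a power [2^k] with [k >= 1], so [e = 0]. *)
Lemma carnot_op0x : left_id 0 op.
Proof.
have [_ _ [e [inv [e1 e2 _ _ _]]]] := carnot_lie_group carnot.
suff -> : 0 = e by [].
have de : dilation 2 e = e.
  rewrite -[RHS](dilationK (l := 2)) ?pnatr_eq0//.
  rewrite -[in RHS](e1 (dilation 2^-1 e)) (carnot_dilation carnot)//.
  by rewrite dilationK ?pnatr_eq0// e2.
apply/rowP => i; move/rowP : de => /(_ i); rewrite !mxE => /eqP.
rewrite -subr_eq0 -{2}(mul1r (e 0 i)) -mulrBl mulf_eq0 subr_eq0.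
rewrite gt_eqF ?exprn_egt1 ?ltr1n//=.
by move=> /eqP ->.
Qed.

Lemma carnot_opx0 : right_id 0 op.
Proof.
have [_ _ [e [inv [e1 e2 _ _ _]]]] := carnot_lie_group carnot.
suff -> : 0 = e by [].
by rewrite -[RHS]carnot_op0x e2.
Qed.

Lemma carnot_direction j : exists k : 'I_n,
  [/\ reshape_index d k = 0%N & X j 0 = delta_mx 0 k].
Proof.
have := carnot_at0 carnot j; set v := X j 0; clearbody v.
move: v; have : (j < head 0%N d)%N by [].
move: (nat_of_ord j) => {}j.
clear; case: d => [//|a d'] /= ja v ->.
have jd : (j < a + sumn d')%N by rewrite ltn_addr.
exists (Ordinal jd); split.
  by rewrite /reshape_index/= subn_eq0 ja.
by apply/rowP => i; rewrite !mxE.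
Qed.

Lemma carnot_field_smooth j k i : Ck k setT (fun x => X j x 0 i).
Proof.
have [sX _] := carnot_left_invariant carnot j.
exact: (smooth_onP _ _).1 (sX i) k.
Qed.

(* [k] is [j] seen as a coordinate, necessarily of the first stratum. *)
Lemma carnot_field_derive j : exists k : 'I_n, reshape_index d k = 0%N /\
  forall x i, is_derive (0 : R) 1 (fun t : R => op x (t *: delta_mx 0 k) 0 i)
    (X j x 0 i).
Proof.
have [k [k0 Xk]] := carnot_direction j; exists k; split=> // x i.
have [_ sop _] := carnot_lie_group carnot.
(* Smoothness of the law at the pair [(x, 0)], used in the coordinate [k] of the second factor. *)
have dop i' : derivable (fun t : R => op x (t *: delta_mx 0 k) 0 i') 0 1.
  have [_ /(_ (rshift n k))] := sop i' [::] (row_mx x 0) Logic.I.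
  rewrite /= /derivable.
  set F := (X in cvg (X @ _) -> _); set G := (X in _ -> cvg (X @ _)).
  suff -> : F = G by [].
  apply/funext => h; rewrite /F /G /=.
  have dl : lsubmx (delta_mx 0 (rshift n k)) = 0 :> 'rV[R]_n.
    apply/rowP => u; rewrite !mxE eqxx/=.
    by case: eqVneq => // /eqP; rewrite eq_lrshift.
  have dr : rsubmx (delta_mx 0 (rshift n k)) = delta_mx 0 k :> 'rV[R]_n.
    by apply/rowP => u; rewrite !mxE eqxx/= (inj_eq (@rshift_inj _ _)).
  rewrite !linearD !linearZ/= dl dr row_mxKl row_mxKr scaler0 add0r addr0.
  by rewrite [h *: 1]mulr1 scale0r addr0.
have [_ /(_ x 0)] := carnot_left_invariant carnot j.
rewrite carnot_opx0 Xk => XE.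
have E y : (fun h : R => h^-1 *: ((op y \o shift 0) (h *: delta_mx 0 k) - op y 0)) =
    (fun h : R => h^-1 *: (((fun t : R => op y (t *: delta_mx 0 k)) \o shift 0) (h *: 1)
      - (fun t : R => op y (t *: delta_mx 0 k)) 0)).
  by apply/funext => h; rewrite /= !addr0 [h *: 1]mulr1 scale0r.
have Dop : derivable (fun t : R => op x (t *: delta_mx 0 k)) 0 1.
  by apply/derivable_mxP => u v; rewrite (ord1 u); exact: dop.
apply: DeriveDef => //.
rewrite XE /derive E -/(derive (fun t : R => op x (t *: delta_mx 0 k)) 0 1).
by rewrite derive_mx// mxE.
Qed.

(** Write [delta_l] for the dilation and [e_k] for the direction of [X j] at 0. Then [delta_l x]
    composed with [t e_k] is [delta_l] of [x] composed with [(t/l) e_k]. Differentiating at [t = 0],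
    the dilation contributes the weight of the coordinate [i] and the reparametrisation takes one
    away; the stratum index being 0-based, it equals the weight minus one. *)
Lemma carnot_field_dilation j l x i : 0 < l ->
  X j (dilation l x) 0 i = l ^+ (reshape_index d i) * X j x 0 i.
Proof.
move=> l0; have [k [k0 Xd]] := carnot_field_derive j.
have [_ <-] := Xd (dilation l x) i.
have -> : (fun t : R => op (dilation l x) (t *: delta_mx 0 k) 0 i) =
    (fun s : R => l ^+ (reshape_index d i).+1 * op x (s *: delta_mx 0 k) 0 i) \o
    (fun t : R => l^-1 * t).
  apply/funext => t /=.
  have -> : t *: delta_mx 0 k = dilation l ((l^-1 * t) *: delta_mx 0 k) :> 'rV[R]_n.
    by rewrite dilationZ dilation_delta k0 expr1 scalerA mulrAC mulVf ?gt_eqF// mul1r.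
  by rewrite -(carnot_dilation carnot)// mxE.
have D2 : is_derive (0:R) 1 (fun t : R => l^-1 * t) l^-1.
  exact: is_derive_linear.
have D1 : is_derive (l^-1 * 0) 1
   (fun s : R => l ^+ (reshape_index d i).+1 * op x (s *: delta_mx 0 k) 0 i)
   (l ^+ (reshape_index d i).+1 * X j x 0 i).
  by rewrite mulr0; apply: is_derive_mull; exact: Xd.
have [_ ->] := is_derive1_comp D1 D2.
by rewrite exprS; field; rewrite gt_eqF.
Qed.

Lemma carnot_field_divfree j i x : partial i (fun y => X j y 0 i) x = 0.
Proof.
pose a (y : 'rV[R]_n) : R := X j y 0 i.
have aS : Ck 1 setT a by exact: carnot_field_smooth.
have scal (l : R) y : 0 < l -> partial i a y = l * partial i a (dilation l y).
  move=> l0.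
  pose r := reshape_index d i.
  have lr0 : l ^+ r != 0 by rewrite expf_neq0// gt_eqF.
  apply: (mulfI lr0); rewrite mulrA -exprSr.
  have D z : is_derive (0 : R) 1 (fun t : R => a (t *: delta_mx 0 i + z)) (partial i a z).
    by apply: is_derive_line; apply: derivableP; exact: Ck_derivable aS _.
  have D1 : is_derive (0 : R) 1 (fun t : R => l ^+ r * a (t *: delta_mx 0 i + y))
     (l ^+ r * partial i a y) by apply: is_derive_mull; exact: D.
  have D2 : is_derive (0 : R) 1 ((fun t : R => a (t *: delta_mx 0 i + dilation l y)) \o
     (fun t : R => l ^+ r.+1 * t)) (partial i a (dilation l y) * l ^+ r.+1).
    apply: is_derive1_comp; first by rewrite mulr0; exact: D.
    exact: is_derive_linear.
  case: D1 => _ <-; rewrite mulrC; case: D2 => _ <-.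
  congr (derive _ _ _); apply/funext => t /=.
  by rewrite -carnot_field_dilation// dilationD dilationZ dilation_delta scalerA mulrC.
have : {for 0, continuous (partial i a)}.
  by apply: (Ck_continuous (O := setT) (k := 0)) => //; exact: Ck_partial aS.
move=> /(@cvgrPdist_le R _ _ _ (nbhs_filter (0 : 'rV[R]_n)) (partial i a)) /(_ 1 ltr01).
move=> /nbhs_ballP[e /= e0 eP].
pose B := `|partial i a 0| + 1.
have B0 : 0 < B by rewrite ltr_pwDr.
have small l : 0 < l -> l <= 1 -> l * (`|x| + 1) <= e -> `|partial i a x| <= l * B.
  move=> l0 l1 le.
  rewrite (scal l)// normrM gtr0_norm// ler_pM2l//.
  have : ball (0 : 'rV[R]_n) e (dilation l x).
    rewrite -ball_normE/= sub0r normrN (le_lt_trans (norm_dilation_le _ _))//.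
      by rewrite ltW.
    by rewrite (lt_le_trans _ le)// ltr_pM2l// ltrDl.
  move=> /eP h; rewrite -(subrK (partial i a 0) (partial i a _)).
  by rewrite (le_trans (ler_normD _ _))// addrC lerD2l distrC.
apply/eqP; rewrite -normr_eq0; apply: contraT => ne0.
have y0 : 0 < `|partial i a x| by rewrite lt_def ne0 normr_ge0.
have x1 : 0 < `|x| + 1 by rewrite ltr_pwDr.
(* The three bounds make the dilation nonexpanding, bring the dilated point into the ball where the
   derivative is at most [B], and keep [l * B] below half of the supposedly nonzero value. *)
pose l := Num.min 1 (Num.min (e / (`|x| + 1)) (`|partial i a x| / (2 * B))).
have l0 : 0 < l by rewrite !lt_min ltr01 !divr_gt0// mulr_gt0.
have := small l l0; rewrite ge_min lexx/= => /(_ isT).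
rewrite -ler_pdivlMr// 2!ge_min lexx/= orbT => /(_ isT).
rewrite leNgt => /negP[]; apply: (@le_lt_trans _ _ (`|partial i a x| / (2 * B) * B)).
  by rewrite ler_pM2r// !ge_min lexx !orbT.
rewrite invfM mulrA mulfVK ?gt_eqF// ltr_pdivrMr// mulr_natr mulr2n ltrDr//.
Qed.

End carnot_fields.

(** * The integral as a positive linear form on continuous compactly supported functions *)

Section cpt_integral.
Variables (R : realType) (n : nat).
Implicit Types (f g : 'rV[R]_n -> R).

Local Notation leb n := (lebesgue_tuple (R := R) (n := n)).

(** A real number, so that integrals can be handled by ordinary algebra; on [Cc] functions the
    integral is finite and [fine] loses nothing. *)
Definition cint f : R := fine (integral_rV (EFin \o f)).

Lemma integral_rV_cint f : Cc f -> integral_rV (EFin \o f) = (cint f)%:E.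
Proof.
move=> cf; rewrite fineK//; apply: integrable_fin_num => //.
exact: integrable_Cc.
Qed.

Lemma Cc0 : Cc (fun=> 0 : R^o) (n := n).
Proof. by split=> [x|]; [exact: cst_continuous|exists 0]. Qed.

Lemma CcD f g : Cc f -> Cc g -> Cc (fun x => f x + g x).
Proof.
move=> [cf [M fM]] [cg [N gN]]; split.
  by move=> x; apply: continuousD; [exact: cf|exact: cg].
by exists (Num.max M N) => x; rewrite gt_max => /andP[/fM -> /gN ->]; rewrite addr0.
Qed.

Lemma CcM f g : continuous f -> Cc g -> Cc (fun x => f x * g x).
Proof.
move=> cf [cg [N gN]]; split.
  by move=> x; apply: continuousM; [exact: cf|exact: cg].
by exists N => x /gN ->; rewrite mulr0.
Qed.

Lemma CcZ c g : Cc g -> Cc (fun x => c * g x).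
Proof. by apply: CcM; exact: cst_continuous. Qed.

Lemma CcB f g : Cc f -> Cc g -> Cc (fun x => f x - g x).
Proof.
move=> cf /(CcZ (-1)) cg; have := CcD cf cg.
by congr Cc; apply/funext => x; rewrite mulN1r.
Qed.

Lemma Cc_sum (I : Type) (s : seq I) (F : I -> 'rV[R]_n -> R) :
  (forall i, Cc (F i)) -> Cc (fun x => \sum_(i <- s) F i x).
Proof.
move=> cF; elim: s => [|i s IH].
  by under eq_fun do rewrite big_nil; exact: Cc0.
by under eq_fun do rewrite big_cons; exact: CcD.
Qed.

Lemma cintD f g : Cc f -> Cc g -> cint (fun x => f x + g x) = cint f + cint g.
Proof.
move=> cf cg; apply: EFin_inj; rewrite EFinD -!integral_rV_cint//; last exact: CcD.
by rewrite /integral_rV -integralD//; exact: integrable_Cc.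
Qed.

Lemma cintZ c f : Cc f -> cint (fun x => c * f x) = c * cint f.
Proof.
move=> cf; apply: EFin_inj; rewrite EFinM -!integral_rV_cint//; last exact: CcZ.
by rewrite /integral_rV -integralZl//; exact: integrable_Cc.
Qed.

Lemma cintB f g : Cc f -> Cc g -> cint (fun x => f x - g x) = cint f - cint g.
Proof.
move=> cf cg; under [X in cint X]eq_fun do rewrite -mulN1r.
by rewrite cintD ?cintZ ?mulN1r//; exact: CcZ.
Qed.

Lemma cint0 : cint (fun=> 0) = 0.
Proof. by rewrite /cint /integral_rV/= integral0. Qed.

Lemma cint_sum (I : Type) (s : seq I) (F : I -> 'rV[R]_n -> R) :
  (forall i, Cc (F i)) ->
  cint (fun x => \sum_(i <- s) F i x) = \sum_(i <- s) cint (F i).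
Proof.
move=> cF; elim: s => [|i s IH].
  by under eq_fun do rewrite big_nil; rewrite big_nil cint0.
under eq_fun do rewrite big_cons.
by rewrite big_cons cintD ?IH//; exact: Cc_sum.
Qed.

Lemma le_cint f g : Cc f -> Cc g -> (forall x, f x <= g x) -> cint f <= cint g.
Proof.
move=> cf cg fg; rewrite -lee_fin -!integral_rV_cint//.
by apply: le_integral => //; [exact: integrable_Cc..|move=> x _; rewrite lee_fin].
Qed.

Lemma lebesgue_tuple_ball_gt0 (x : 'rV[R]_n) (e : R) : 0 < e ->
  (0 < leb n (@rv_of_tuple R n @^-1` ball x e))%E.
Proof.
move=> e0.
rewrite (_ : _ @^-1` _ = [set t | forall i : 'I_n,
   (ball (x 0 i) e : set (measurableTypeR R)) (tnth t i)]).
  rewrite (lebesgue_tuple_box (A := fun i : 'I_n => ball (x 0 i) e)).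
    under eq_bigr do rewrite lebesgue_measure_ball ?ltW//.
    elim/big_ind : _ => // [|i _].
      by move=> a b; exact: mule_gt0.
    by rewrite lte_fin mulrn_wgt0.
  by move=> i; exact: measurable_ballR.
apply/seteqP; split => [t [_ xt] i|t xt]; first by have := xt 0 i; rewrite mxE.
by split=> // i j; rewrite mxE ord1; exact: xt.
Qed.

(** By continuity [f] is at least half of [f x] on a ball, and balls have positive measure. *)
Lemma cint_gt0 f x : Cc f -> (forall y, 0 <= f y) -> 0 < f x -> 0 < cint f.
Proof.
move=> cf f0 fx; rewrite -lte_fin -integral_rV_cint//.
have [e e0 ef] : exists2 e, 0 < e & forall y, ball x e y -> f x / 2 <= f y.
  have [/(_ x) + _] := cf.
  move=> /(@cvgrPdist_le R _ _ _ (nbhs_filter (x : 'rV[R]_n)) f).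
  have fx2 : 0 < f x / 2 by rewrite divr_gt0.
  move=> /(_ _ fx2)/nbhs_ballP[e /= e0 eP]; exists e => // y /eP.
  rewrite ler_norml => /andP[_]; lra.
pose B := @rv_of_tuple R n @^-1` ball x e.
have mB : measurable B by exact: measurable_rv_ball.
have mf : measurable_fun setT (fun t => (f (rv_of_tuple t))%:E).
  by apply/measurable_EFinP; apply: measurable_continuous_rv; case: cf.
apply: (@lt_le_trans _ _ (\int[leb n]_(t in B) (f (rv_of_tuple t))%:E)%E); last first.
  apply: ge0_subset_integral => //.
  by move=> t _; rewrite lee_fin.
apply: (@lt_le_trans _ _ (\int[leb n]_(t in B) (f x / 2)%:E)%E).
  rewrite integral_cst// mule_gt0// ?lte_fin ?divr_gt0//.
  exact: lebesgue_tuple_ball_gt0.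
apply: ge0_le_integral => //.
- by move=> t _; rewrite lee_fin divr_ge0// ltW.
- exact: measurable_funTS.
- by move=> t Bt; rewrite lee_fin; exact: ef.
Qed.

End cpt_integral.

(** * Functions supported in a compact subset of the punctured space *)

Section punctured.
Variables (R : realType) (n : nat).
Implicit Types (f g : 'rV[R]_n -> R).

Local Notation punctured := (~` [set (0 : 'rV[R]_n)]).

Lemma open_norm_gt (M : R) : open [set y : 'rV[R]_n | (M < `|y|)%R].
Proof.
rewrite -[X in open X]/((fun x : 'rV[R]_n => `|x|) @^-1` [set r | (M < r)%R]).
by apply: open_comp => [y _|]; [exact: norm_continuous|exact: open_gt].
Qed.

Lemma open_norm_lt (M : R) : open [set y : 'rV[R]_n | (`|y| < M)%R].
Proof.
rewrite -[X in open X]/((fun x : 'rV[R]_n => `|x|) @^-1` [set r | (r < M)%R]).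
by apply: open_comp => [y _|]; [exact: norm_continuous|exact: open_lt].
Qed.

Lemma open_punctured : open punctured.
Proof.
rewrite (_ : punctured = [set y : 'rV[R]_n | (0 < `|y|)%R]).
  exact: open_norm_gt.
by apply/seteqP; split => x /=; rewrite normr_gt0 => /eqP.
Qed.

(** Vanishing near 0 and near infinity passes through sums, products and derivatives more easily
    than a condition on the closure of the support; [test_function_cpt] and [cpt_test_function]
    translate between the two. *)
Definition cpt_punctured f := exists r M : R, 0 < r /\
  forall x, `|x| < r \/ M < `|x| -> f x = 0.

(** This is how expressions in [rho], smooth only off 0, become smooth everywhere once multiplied by
    a factor vanishing near 0. *)
Lemma Ck_extend0 k f r : 0 < r -> (forall x, `|x| < r -> f x = 0) ->
  Ck k punctured f -> Ck k setT f.
Proof.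
move=> r0 f0 cf.
have -> : setT = punctured `|` [set y : 'rV[R]_n | (`|y| < r)%R].
  apply/seteqP; split => // x _; case: (eqVneq x 0) => [->|/eqP x0].
    by right; rewrite /= normr0.
  by left.
apply: Ck_setU => //; apply: (Ck_eq_open (f := fun=> 0)).
- exact: open_norm_lt.
- by move=> x /f0 ->.
- exact: Ck_cst.
Qed.

Lemma Cc_cpt_punctured f : continuous_at_all punctured f -> cpt_punctured f -> Cc f.
Proof.
move=> cf [r [M [r0 rM]]]; split; last by exists M => x xM; apply: rM; right.
move=> x; apply: (@Ck_extend0 0 f r r0) => // y yr; apply: rM; by left.
Qed.

Lemma cpt_puncturedM f g : cpt_punctured g -> cpt_punctured (fun x => f x * g x).
Proof.
by move=> [r [M [r0 rM]]]; exists r, M; split => // x /rM ->; rewrite mulr0.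
Qed.

Lemma cpt_puncturedMl f g : cpt_punctured f -> cpt_punctured (fun x => f x * g x).
Proof.
by move=> [r [M [r0 rM]]]; exists r, M; split => // x /rM ->; rewrite mul0r.
Qed.

Lemma cpt_puncturedD f g : cpt_punctured f -> cpt_punctured g ->
  cpt_punctured (fun x => f x + g x).
Proof.
move=> [r [M [r0 rM]]] [s [N [s0 sN]]].
exists (Num.min r s), (Num.max M N); split => [|x]; first by rewrite lt_min r0.
rewrite lt_min gt_max => -[/andP[? ?]|/andP[? ?]]; rewrite rM ?sN ?addr0//.
all: by [left|right].
Qed.

Lemma cpt_puncturedB f g : cpt_punctured f -> cpt_punctured g ->
  cpt_punctured (fun x => f x - g x).
Proof.
move=> cf /(cpt_puncturedM (fun=> -1)) /(cpt_puncturedD cf).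
by congr cpt_punctured; apply/funext => x; rewrite mulN1r.
Qed.

Lemma cpt_punctured_sum (I : Type) (s : seq I) (F : I -> 'rV[R]_n -> R) :
  (forall i, cpt_punctured (F i)) -> cpt_punctured (fun x => \sum_(i <- s) F i x).
Proof.
move=> cF; elim: s => [|i s IH].
  by exists 1, 0; split=> // x _; rewrite big_nil.
by under eq_fun do rewrite big_cons; exact: cpt_puncturedD.
Qed.

Lemma cpt_punctured0 f : cpt_punctured f -> f 0 = 0.
Proof. by move=> [r [M [r0 rM]]]; apply: rM; left; rewrite normr0. Qed.

(** Identities are computed where [rho > 0]; at 0 both sides vanish, whatever default values the
    formulas take there. *)
Lemma eq_cpt_punctured f g : cpt_punctured f -> cpt_punctured g ->
  (forall x, x != 0 -> f x = g x) -> f = g.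
Proof.
move=> cf cg fg; apply/funext => x; have [->|/fg//] := eqVneq x 0.
by rewrite !cpt_punctured0.
Qed.

Lemma cpt_punctured_vderiv V f : cpt_punctured f -> cpt_punctured (vderiv V f).
Proof.
move=> [r [M [r0 rM]]]; exists r, M; split => // x [xr|xM].
  have f0 y : [set y : 'rV[R]_n | (`|y| < r)%R] y -> f y = 0 by move=> ?; apply: rM; left.
  by rewrite (vderiv_eq_open V (@open_norm_lt r) f0)// vderiv_cst.
have f0 y : [set y : 'rV[R]_n | (M < `|y|)%R] y -> f y = 0 by move=> ?; apply: rM; right.
by rewrite (vderiv_eq_open V (@open_norm_gt M) f0)// vderiv_cst.
Qed.

(** For a divergence-free field, [V f] is the sum of the partial derivatives of the products
    [V_i f], each of integral zero. *)
Lemma cint_vderiv (V : vfield R n) f :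
  (forall i, Ck 1 setT (fun x => V x 0 i)) ->
  (forall i x, partial i (fun y => V y 0 i) x = 0) ->
  Ck 1 punctured f -> cpt_punctured f -> cint (vderiv V f) = 0.
Proof.
move=> cV dV cf [r [M [r0 rM]]].
have cfT : Ck 1 setT f.
  by apply: Ck_extend0 r0 _ cf => x xr; apply: rM; left.
have cVf i : Ck 1 setT (fun x => V x 0 i * f x) by apply: CkM => //; exact: openT.
have sVf i : exists M : R, forall x, M < `|x| -> V x 0 i * f x = 0.
  by exists M => x xM; rewrite rM ?mulr0//; right.
have -> : vderiv V f = fun x => \sum_(i < n) partial i (fun y => V y 0 i * f y) x.
  apply/funext => x; apply: eq_bigr => i _.
  by rewrite (partialM (Ck_derivable (cV i) _) (Ck_derivable cfT _))// dV mulr0 addr0.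
rewrite cint_sum => [|i]; last exact: Cc_partial.
by apply: big1 => i _; rewrite /cint (integral_rV_partial _ (cVf i) (sVf i)).
Qed.

Lemma test_function_cpt u : test_function punctured u ->
  (forall k, Ck k setT u) /\ cpt_punctured u.
Proof.
move=> [/smooth_onP su cu u0]; split => //.
have : nbhs (0 : 'rV[R]_n) (~` (closure [set x | u x != 0])).
  apply: open_nbhs_nbhs; split.
    by apply: closed_openC; exact: closed_closure.
  by move=> /u0; exact.
move=> /nbhs_ballP[r /= r0 rP].
have [M [_ MP]] := compact_bounded cu.
exists r, (`|M| + 1); split => // x [xr|xM]; apply/eqP; apply: contraT => ux.
  have /rP : ball (0 : 'rV[R]_n) r x by rewrite -ball_normE/= sub0r normrN.
  by move=> []; exact: (@subset_closure _ [set x | u x != 0]).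
have := MP (`|M| + 1); rewrite (le_lt_trans (ler_norm M)) ?ltrDl// => /(_ isT).
by move=> /(_ x (@subset_closure _ [set x | u x != 0] x ux)); rewrite /= leNgt xM.
Qed.

Lemma cpt_test_function u : (forall k, Ck k punctured u) -> cpt_punctured u ->
  test_function punctured u.
Proof.
move=> cu [r [M [r0 rM]]].
have sub : closure [set x | u x != 0] `<=`
    [set x | (`|x| <= M)%R] `&` ~` [set x | (`|x| < r)%R].
  rewrite closureE; apply: smallest_sub.
    apply: closedI; first exact: closed_le_norm.
    by apply: open_closedC; exact: open_norm_lt.
  move=> x /= ux; split => /=.
    by rewrite leNgt; apply: contra ux => xM; rewrite rM//; right.
  by move=> xr; move: ux; rewrite rM ?eqxx//; left.
split.
- apply/smooth_onP => k; apply: Ck_extend0 r0 _ (cu k) => x xr; apply: rM; by left.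
- apply: (subclosed_compact _ (@compact_le_norm R n M)).
    exact: closed_closure.
  by move=> x /sub[].
- by move=> x /sub[_ /= xr] x0; apply: xr; rewrite x0 normr0.
Qed.

End punctured.

(** * One-variable calculus: real powers, a flat function, signed powers *)

Section one_variable.
Variable R : realType.

Lemma Ck1dD k (U : set R) (f g : R -> R) : Ck1d k U f -> Ck1d k U g ->
  Ck1d k U (fun y => f y + g y).
Proof.
elim: k f g => [|k IH] f g.
  by move=> cf cg y Uy; apply: continuousD; [exact: cf|exact: cg].
move=> [df f1 f2] [dg g1 g2]; exists (fun y => df y + dg y); last exact: IH.
by move=> y Uy; apply: is_deriveD; [exact: f1|exact: g1].
Qed.

Lemma Ck1dZ k (U : set R) c (f : R -> R) : Ck1d k U f ->
  Ck1d k U (fun y => c * f y).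
Proof.
elim: k f => [|k IH] f.
  by move=> cf y Uy; apply: continuousM; [exact: cst_continuous|exact: cf].
move=> [df f1 f2]; exists (fun y => c * df y); last exact: IH.
by move=> y Uy; apply: is_derive_mull; exact: f1.
Qed.

Lemma Ck1d0_is_derive (U : set R) (f df : R -> R) :
  (forall y, U y -> is_derive y 1 f (df y)) -> Ck1d 0 U f.
Proof.
move=> fd y /fd[dfy _].
by apply: differentiable_continuous; exact/derivable1_diffP.
Qed.

Lemma Ck1d_powR k (a : R) : Ck1d k [set y : R | 0 < y] (fun y => y `^ a).
Proof.
have D b (y : R) : [set y : R | 0 < y] y ->
    is_derive y 1 (fun y => y `^ b) (b * y `^ (b - 1)).
  by move=> y0; exact: (is_derive1_powR b y0).
elim: k a => [|k IH] a; first exact: Ck1d0_is_derive (D a).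
by exists (fun x => a * x `^ (a - 1)); [exact: D|exact/Ck1dZ/IH].
Qed.

Lemma Ck1d_ln k : Ck1d k [set y : R | 0 < y] (@ln R).
Proof.
have D (y : R) : 0 < y -> is_derive y 1 (@ln R) (y `^ (-1)).
  by move=> y0; rewrite powR_inv1 ?ltW//; exact: is_derive1_ln.
case: k => [|k]; first exact: Ck1d0_is_derive D.
by exists (fun y => y `^ (-1)); [exact: D|exact: Ck1d_powR].
Qed.

Lemma is_derive_quadratic (f : R -> R) x C :
  (forall h, `|f (h + x) - f x| <= C * h ^+ 2) -> is_derive x 1 f 0.
Proof.
move=> fC.
have L : (fun h => h^-1 *: ((f \o shift x) (h *: 1) - f x)) @ 0^' --> (0 : R).
  apply/cvgrPdist_le => e e0; near=> h.
  rewrite sub0r normrN /= [h *: 1]mulr1 normrM normfV.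
  have h0 : h != 0 by near: h; exact: nbhs_dnbhs_neq.
  rewrite mulrC ler_pdivrMr ?normr_gt0//.
  rewrite (le_trans (fC h))// -real_normK ?num_real// expr2 mulrA.
  rewrite ler_wpM2r//.
  have C0 : 0 < `|C| + 1 by rewrite ltr_pwDr.
  apply: (@le_trans _ _ ((`|C| + 1) * `|h|)).
    by rewrite ler_wpM2r// (le_trans (ler_norm C))// lerDl.
  rewrite mulrC -ler_pdivlMr//.
  by near: h; apply: dnbhs0_le; rewrite divr_gt0.
by apply: DeriveDef; [apply/cvg_ex; exists 0|exact/cvg_lim].
Unshelve. all: by end_near. Qed.

(** The function [x^-k exp(-1/x)] on the positive axis. [flat 0] is the classical smooth function
    flat at 0; the extra index makes the family closed under differentiation up to linear
    combinations. *)
Definition flat (k : nat) (x : R) : R :=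
  if 0 < x then x^-1 ^+ k * expR (- x^-1) else 0.

Lemma flat_le0 k x : x <= 0 -> flat k x = 0.
Proof. by rewrite /flat leNgt => /negbTE ->. Qed.

Lemma flat_gt0 k x : 0 < x -> 0 < flat k x.
Proof. by move=> x0; rewrite /flat x0 mulr_gt0 ?expR_gt0// exprn_gt0// invr_gt0. Qed.

Lemma flat_ge0 k x : 0 <= flat k x.
Proof. by have [/flat_le0 ->//|/(flat_gt0 k)/ltW] := leP x 0. Qed.

(** With [s = 1/x] this is [s^k / k! <= exp s]. *)
Lemma flat_le k x : flat k x <= k`!%:R.
Proof.
have [/flat_le0 ->//|x0] := leP x 0.
rewrite /flat x0 expRN ler_pdivrMr ?expR_gt0//.
have s0 : 0 <= x^-1 by rewrite invr_ge0 ltW.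
case: k => [|k]; first by rewrite expr0 fact0 mul1r (le_trans _ (expR_ge1Dx _))// lerDl.
rewrite mulrC -ler_pdivrMr ?ltr0n ?fact_gt0//.
by rewrite (le_trans _ (expR_ge1Dxn k s0))// lerDr.
Qed.

Lemma flatS k x : flat k x = x * flat k.+1 x.
Proof.
have [x0|x0] := leP x 0; first by rewrite !flat_le0// mulr0.
by rewrite /flat x0 exprS !mulrA mulfV ?gt_eqF// mul1r.
Qed.

Lemma is_derive_flat k (x : R) :
  is_derive x 1 (flat k) (flat k.+2 x - k%:R * flat k.+1 x).
Proof.
have [x0|x0|->] := ltgtP x 0.
- rewrite !(flat_le0 _ (ltW x0)) mulr0 subr0.
  have D0 : is_derive x 1 (cst (0 : R)) (0 : R) by exact: is_derive_cst.
  apply: near_eq_is_derive D0.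
  by near=> y; rewrite flat_le0// ltW//; near: y; exact: lt_nbhsl.
- have Di : is_derive x 1 (fun y : R => y^-1) (- x ^- 2).
    by apply: is_derive_eq; [apply: is_deriveV; rewrite ?gt_eqF//|rewrite [_ *: 1]mulr1].
  have De : is_derive x 1 (fun y => expR (- y^-1)) (expR (- x^-1) * (x ^- 2)).
    apply: (@is_derive1_comp _ expR (fun y => - y^-1)).
    by rewrite -[X in is_derive _ _ _ X]opprK; apply: is_deriveN.
  have Dx : is_derive x 1 (fun y : R => y^-1 ^+ k) (- (k%:R * x^-1 ^+ k.+1)).
    have -> : (fun y : R => y^-1 ^+ k) = (fun y : R => y^-1) ^+ k.
      by apply/funext => y; rewrite exprfctE.
    apply: (is_derive_eq (is_deriveX k Di)).
    case: k => [|k]; first by rewrite !mul0r scale0r oppr0.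
    by rewrite [_ *: - _]mulrN -exprVn -mulrA -exprD addn2.
  have D : is_derive x 1 (fun y : R => y^-1 ^+ k * expR (- y^-1))
      (flat k.+2 x - k%:R * flat k.+1 x).
    apply: (is_derive_eq (is_deriveM Dx De)).
    by rewrite /flat x0 /GRing.scale/= -exprVn !exprS; ring.
  apply: near_eq_is_derive D; near=> y; rewrite /flat; have -> // : 0 < y.
  by near: y; exact: lt_nbhsr.
(* At the junction 0 one has [flat k h = h^2 flat (k+2) h], and the last factor is bounded by
   [(k+2)!], so the increment is quadratic in [h]. *)
- rewrite !flat_le0// mulr0 subr0; apply: (@is_derive_quadratic _ _ (k.+2)`!%:R) => h.
  rewrite addr0 (flat_le0 k (lexx 0)) subr0 2!flatS mulrA -expr2 normrM.
  rewrite ger0_norm ?sqr_ge0// mulrC ler_wpM2r ?sqr_ge0//.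
  by rewrite ger0_norm ?flat_ge0// flat_le.
Unshelve. all: by end_near. Qed.

Lemma Ck1d_flat k m U : Ck1d k U (flat m).
Proof.
elim: k m => [|k IH] m.
  by apply: (@Ck1d0_is_derive U _ (fun x => flat m.+2 x - m%:R * flat m.+1 x)) => x _;
    exact: is_derive_flat.
exists (fun x => flat m.+2 x + (- m%:R) * flat m.+1 x).
  by move=> x _; rewrite mulNr; exact: is_derive_flat.
by apply: Ck1dD => //; apply: Ck1dZ.
Qed.

Lemma continuous_norm_powR (q : R) : 0 <= q -> continuous (fun t : R => `|t| `^ q).
Proof.
rewrite le_eqVlt => /predU1P[<-|q0].
  by under eq_fun do rewrite powRr0; exact: cst_continuous.
move=> t; have [->|t0] := eqVneq t 0.
  rewrite /continuous_at normr0 powR0 ?gt_eqF//; apply/cvgrPdist_le => e e0.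
  near=> s; rewrite sub0r normrN ger0_norm ?powR_ge0//.
  have : `|s| <= e `^ q^-1.
    near: s; apply/nbhs_ballP; exists (e `^ q^-1) => [|s] /=; first by rewrite powR_gt0.
    by rewrite /ball/= sub0r normrN => /ltW.
  move=> /(ge0_ler_powR (ltW q0)); rewrite !nnegrE powR_ge0 => /(_ (normr_ge0 _) isT).
  by rewrite -powRrM mulVf ?gt_eqF// powRr1 ?(ltW e0)//.
apply: (@continuous_comp _ _ _ (fun y : R => `|y|) (fun y => y `^ q)); first exact: norm_continuous.
by apply: (Ck1d_continuous (Ck1d_powR 0 q)); rewrite /= normr_gt0.
Unshelve. all: by end_near. Qed.

(** For [q = p - 2] this is the factor [u |u|^(p-2)] of the field; for [q = 1] it is the primitive
    of [2 |t|] used for the trapezoids. *)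
Definition spow (q t : R) := t * `|t| `^ q.

Lemma is_derive_spow (q t : R) : 0 <= q -> is_derive t 1 (spow q) ((q + 1) * `|t| `^ q).
Proof.
rewrite le_eqVlt => /predU1P[<-|q0].
  (* [powR 0 0] is 1, so [spow 0] is the identity at 0 as well; this is the case [p = 2]. *)
  rewrite (_ : spow 0 = id); last by apply/funext => y; rewrite /spow powRr0 mulr1.
  by rewrite powRr0 add0r mulr1; exact: is_derive_id.
have q1 : 0 < q + 1 by rewrite addr_gt0.
have [t0|t0|->] := ltgtP t 0.
- have Np : 0 < - t by rewrite oppr_gt0.
  have DN : is_derive t 1 (fun y : R => - y) (-1) by apply: is_deriveN.
  have := is_deriveN (is_derive1_comp (is_derive1_powR (q + 1) Np) DN).
  rewrite mulrN1 opprK addrK ltr0_norm//; apply: near_eq_is_derive.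
  near=> y; have y0 : y < 0 by near: y; exact: lt_nbhsl.
  rewrite /spow ltr0_norm//= -[in RHS](opprK y) mulNr; congr (- _) => /=.
  have y0' : 0 <= - y by rewrite oppr_ge0 ltW.
  by rewrite -(mulr_powRB1 y0' q1) addrK opprK.
- have := is_derive1_powR (q + 1) t0.
  rewrite addrK gtr0_norm//; apply: near_eq_is_derive.
  near=> y; have y0 : 0 < y by near: y; exact: lt_nbhsr.
  by rewrite /spow gtr0_norm// -(mulr_powRB1 (ltW y0) q1) addrK.
- rewrite normr0 powR0 ?gt_eqF// mulr0.
  have L : (fun h => h^-1 *: ((spow q \o shift 0) (h *: 1) - spow q 0)) @ 0^' --> (0 : R).
    have := @continuous_norm_powR q (ltW q0) 0.
    rewrite /continuous_at normr0 powR0 ?gt_eqF// => c0.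
    have : (fun t : R => `|t| `^ q) @ 0^' --> (0 : R).
      apply: cvg_trans c0; apply: cvg_app; exact: cvg_within.
    apply: cvg_trans; apply: near_eq_cvg; near=> h.
    have h0 : h != 0 by near: h; exact: nbhs_dnbhs_neq.
    by rewrite /spow/= addr0 [h *: 1]mulr1 mul0r subr0 [_ *: _]mulrA mulVf// mul1r.
  by apply: DeriveDef; [apply/cvg_ex; exists 0|exact/cvg_lim].
Unshelve. all: by end_near. Qed.

Lemma Ck1d_spow q U : 0 <= q -> Ck1d 1 U (spow q).
Proof.
move=> q0; exists (fun t => (q + 1) * `|t| `^ q).
  by move=> t _; exact: is_derive_spow.
apply: Ck1dZ => t _; exact: continuous_norm_powR.
Qed.

End one_variable.

(** * Horizontal gradient, sub-Laplacian and integration by parts for smooth divergence-free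
    fields *)

Section horizontal.
Variables (R : realType) (n m : nat) (X : 'I_m -> vfield R n).
Hypothesis X_smooth : forall j k i, Ck k setT (fun x => X j x 0 i).
Hypothesis X_divfree : forall j i x, partial i (fun y => X j y 0 i) x = 0.
Implicit Types (f g : 'rV[R]_n -> R) (O : set 'rV[R]_n).

Local Notation punctured := (~` [set (0 : 'rV[R]_n)]).
Local Notation L := (sublaplacian X).

(** Being polynomial in the derivatives it inherits their regularity, unlike [hgrad_norm], whose
    square it is on the diagonal. *)
Definition hdot f g (x : 'rV[R]_n) := \sum_(j < m) vderiv (X j) f x * vderiv (X j) g x.

Lemma Ck_vderivX k O f j : open O -> Ck k.+1 O f -> Ck k O (vderiv (X j) f).
Proof.
move=> oO cf; apply: Ck_vderiv => // i.
by apply: Ck_subset (X_smooth j k i).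
Qed.

Lemma Ck_hdot k O f g : open O -> Ck k.+1 O f -> Ck k.+1 O g -> Ck k O (hdot f g).
Proof. by move=> oO cf cg; apply: Ck_sum => // j; apply: CkM => //; exact: Ck_vderivX. Qed.

Lemma Ck_sublaplacian k O f : open O -> Ck k.+2 O f -> Ck k O (L f).
Proof. by move=> oO cf; apply: Ck_sum => // j; do 2 apply: Ck_vderivX => //. Qed.

Lemma hdot_ge0 f x : 0 <= hdot f f x.
Proof. by apply: sumr_ge0 => j _; rewrite -expr2 sqr_ge0. Qed.

Lemma hgrad_norm_sqr f x : hgrad_norm X f x ^+ 2 = hdot f f x.
Proof.
rewrite sqr_sqrtr; first by apply: eq_bigr => j _; rewrite expr2.
by apply: sumr_ge0 => j _; exact: sqr_ge0.
Qed.

Lemma hgrad_norm_ge0 f x : 0 <= hgrad_norm X f x.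
Proof. exact: sqrtr_ge0. Qed.

Lemma sublaplacian_comp O (U : set R) (w w' w'' : R -> R) f x :
  open O -> (forall y, O y -> U (f y)) -> Ck 2 O f ->
  (forall r, U r -> is_derive r 1 w (w' r)) ->
  (forall r, U r -> is_derive r 1 w' (w'' r)) ->
  (forall r, U r -> {for r, continuous w''}) -> O x ->
  L (w \o f) x = w'' (f x) * hdot f f x + w' (f x) * L f x.
Proof.
move=> oO OU cf dw dw' cw'' Ox.
rewrite /sublaplacian /hdot !mulr_sumr -big_split/=; apply: eq_bigr => j _.
have E y : O y -> vderiv (X j) (w \o f) y = (w' \o f) y * vderiv (X j) f y.
  by move=> Oy; rewrite (vderiv_comp _ cf Oy (dw _ (OU _ Oy))).
rewrite (vderiv_eq_open (X j) oO E Ox).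
have cw'f : Ck 1 O (w' \o f).
  by apply: Ck_comp OU _ (CkS cf) => //; exists w''.
rewrite (vderivM _ cw'f (Ck_vderivX j oO cf) Ox).
by rewrite (vderiv_comp _ cf Ox (dw' _ (OU _ Ox)))/=; ring.
Qed.

(** The integrand is the divergence of the field with components [F j] in the frame [X j]. *)
Lemma cint_div (F : 'I_m -> 'rV[R]_n -> R) :
  (forall j, Ck 1 punctured (F j)) -> (forall j, cpt_punctured (F j)) ->
  Cc (fun x => \sum_(j < m) vderiv (X j) (F j) x) /\
  cint (fun x => \sum_(j < m) vderiv (X j) (F j) x) = 0.
Proof.
move=> cF sF; have cX j : Cc (vderiv (X j) (F j)).
  apply: Cc_cpt_punctured; last exact: cpt_punctured_vderiv.
  apply: (Ck_continuous (k := 0)); apply: Ck_vderivX => //.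
  exact: open_punctured.
split; first exact: Cc_sum.
rewrite cint_sum//; apply: big1 => j _; apply: cint_vderiv => //.
Qed.

Lemma cpt_punctured_sublaplacian f : cpt_punctured f -> cpt_punctured (L f).
Proof.
by move=> cf; apply: cpt_punctured_sum => j; do 2 apply: cpt_punctured_vderiv.
Qed.

(** The difference of the integrands is the divergence of [f grad g - g grad f]. Only [g] is cut off
    near 0, with [f = rho^(2-Q)] in view, which is singular there. *)
Lemma cint_green f g : Ck 2 punctured f -> Ck 2 punctured g -> cpt_punctured g ->
  cint (fun x => f x * L g x) = cint (fun x => g x * L f x).
Proof.
move=> cf cg sg; have oP := @open_punctured R n.
have alg (a b c e : R) : a + b * c - (e + c * b) = a - e by ring.
pose F j x := f x * vderiv (X j) g x - g x * vderiv (X j) f x.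
have cF j : Ck 1 punctured (F j).
  by apply: CkB => //; apply: CkM => //;
    [exact: CkS|exact: Ck_vderivX|exact: CkS|exact: Ck_vderivX].
have sF j : cpt_punctured (F j).
  apply: cpt_puncturedB; first exact/cpt_puncturedM/cpt_punctured_vderiv.
  exact: cpt_puncturedMl.
have sfg : cpt_punctured (fun x => f x * L g x).
  exact/cpt_puncturedM/cpt_punctured_sublaplacian.
have sgf : cpt_punctured (fun x => g x * L f x) by exact: cpt_puncturedMl.
have [_] := cint_div cF sF.
rewrite (_ : (fun x => \sum_(j < m) vderiv (X j) (F j) x) =
    fun x => f x * L g x - g x * L f x); last first.
  apply: eq_cpt_punctured.
  - by apply: cpt_punctured_sum => j; exact: cpt_punctured_vderiv.
  - exact: cpt_puncturedB.
  move=> x /eqP x0; rewrite /sublaplacian !mulr_sumr -sumrB; apply: eq_bigr => j _.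
  have c1 := CkM oP (CkS cf) (Ck_vderivX j oP cg).
  have c2 := CkM oP (CkS cg) (Ck_vderivX j oP cf).
  apply: (etrans (vderivB (X j) oP c1 c2 x0)).
  have E1 := vderivM (X j) (CkS cf) (Ck_vderivX j oP cg) x0.
  have E2 := vderivM (X j) (CkS cg) (Ck_vderivX j oP cf) x0.
  apply: (etrans (congr2 (fun a b => a - b) E1 E2)).
  exact: alg.
have CL h : Ck 2 punctured h -> continuous_at_all punctured (L h).
  by move=> ch; apply: (Ck_continuous (k := 0)); exact: Ck_sublaplacian.
have Cfg : Cc (fun x => f x * L g x).
  apply: Cc_cpt_punctured => // x x0; apply: continuousM.
    exact: (Ck_continuous cf).
  exact: CL.
have Cgf : Cc (fun x => g x * L f x).
  apply: Cc_cpt_punctured => // x x0; apply: continuousM.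
    exact: (Ck_continuous cg).
  exact: CL.
move=> fg0; apply/eqP; rewrite -subr_eq0; apply/eqP.
exact: etrans (esym (cintB Cfg Cgf)) fg0.
Qed.

End horizontal.

(** * Smooth bump functions *)

Section bump.
Variables (R : realType) (n : nat).

(** The balls of the norm of row vectors are cubes, which explains the product of one-variable
    bumps. *)
Definition bump (x0 : 'rV[R]_n) (e : R) (y : 'rV[R]_n) : R :=
  \prod_(i < n) flat 0 (e ^+ 2 - (y 0 i - x0 0 i) * (y 0 i - x0 0 i)).

Lemma Ck_bump k x0 e : Ck k setT (bump x0 e).
Proof.
have oT := @openT 'rV[R]_n.
apply: Ck_prod => // i.
apply: (@Ck_comp _ _ _ _ setT (flat 0)
  (fun y => e ^+ 2 - (y 0 i - x0 0 i) * (y 0 i - x0 0 i))) => //.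
  exact: Ck1d_flat.
have cd : Ck k setT (fun y : 'rV[R]_n => y 0 i - x0 0 i).
  by apply: CkB => //; [exact: Ck_coord|exact: Ck_cst].
by apply: CkB => //; [exact: Ck_cst|exact: CkM].
Qed.

Lemma bump_ge0 x0 e y : 0 <= bump x0 e y.
Proof. by apply: prodr_ge0 => i _; exact: flat_ge0. Qed.

Lemma bump_gt0 x0 e : 0 < e -> 0 < bump x0 e x0.
Proof.
move=> e0; apply: prodr_gt0 => i _.
by rewrite subrr mulr0 subr0 flat_gt0// exprn_gt0.
Qed.

Lemma bump_out x0 e y : 0 < e -> ~ ball x0 e y -> bump x0 e y = 0.
Proof.
move=> e0 xy; have /existsNP[i /negP] : ~ (forall i : 'I_n, `|y 0 i - x0 0 i| < e).
  by move=> h; apply: xy; split=> // i j; rewrite ord1 /ball/= distrC; exact: h.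
rewrite -leNgt => ey; rewrite /bump (bigD1 i)//= flat_le0 ?mul0r//.
rewrite subr_le0 -expr2 -[leRHS]real_normK ?num_real//.
by rewrite ler_sqr ?nnegrE// ltW.
Qed.

Lemma bump_norm_out x0 e y : 0 < e -> `|x0| + e < `|y| -> bump x0 e y = 0.
Proof.
move=> e0 xy; apply: bump_out => //; rewrite -ball_normE/= => yx.
move: xy; apply/negP; rewrite -leNgt -(subrK x0 y) addrC.
by rewrite (le_trans (ler_normD _ _))// lerD2l distrC ltW.
Qed.

Lemma bump_test x0 e : 0 < e -> test_function setT (bump x0 e).
Proof.
move=> e0; split => //; first by apply/smooth_onP => k; exact: Ck_bump.
apply: (subclosed_compact _ (@compact_le_norm R n (`|x0| + e))).
  exact: closed_closure.
rewrite closureE; apply: smallest_sub; first exact: closed_le_norm.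
move=> y /= by0; rewrite leNgt; apply: contra by0 => h.
by rewrite bump_norm_out.
Qed.

End bump.

(** * Harmonicity of the fundamental solution off 0 and the equation for the norm *)

Section fundamental.
Variables (R : realType) (n m : nat) (X : 'I_m -> vfield R n).
Hypothesis X_smooth : forall j k i, Ck k setT (fun x => X j x 0 i).
Hypothesis X_divfree : forall j i x, partial i (fun y => X j y 0 i) x = 0.

Local Notation punctured := (~` [set (0 : 'rV[R]_n)]).
Local Notation L := (sublaplacian X).

Variables (rho : 'rV[R]_n -> R) (Q c : R).
Hypothesis Q_gt2 : 2 < Q.
Hypothesis rho_gt0 : forall x, x != 0 -> 0 < rho x.
Hypothesis rho_smooth : forall k, Ck k punctured rho.
Hypothesis fsol : fundamental_solution X (fun x => c * rho x `^ (2 - Q)).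

Let oP := @open_punctured R n.

Lemma rho_punctured x : punctured x -> [set r : R | 0 < r] (rho x).
Proof. by move=> /eqP; exact: rho_gt0. Qed.

Lemma Ck_rho_powR k a : Ck k punctured (fun x => rho x `^ a).
Proof. exact: (Ck_comp oP rho_punctured (@Ck1d_powR R k a) (rho_smooth k)). Qed.

(** With [c = 0] the Dirac mass would vanish on a bump that is positive at 0. *)
Lemma fundamental_coef_neq0 : c != 0.
Proof.
apply/eqP => c0; have := fsol_dirac fsol (bump_test (0 : 'rV[R]_n) ltr01).
rewrite (_ : integral_rV _ = 0%E).
  by move/esym/eqP; rewrite eqe gt_eqF// bump_gt0.
by rewrite /integral_rV integral0_eq// => t _; rewrite c0 !mul0r.
Qed.

(** A test function vanishing near 0 does not see the Dirac mass, and Green's formula moves [L] onto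
    [rho^(2-Q)]. *)
Lemma cint_test_fundamental phi : (forall k, Ck k setT phi) -> cpt_punctured phi ->
  test_function setT phi ->
  cint (fun x => phi x * L (fun y => rho y `^ (2 - Q)) x) = 0.
Proof.
move=> cphi sphi tphi.
have cphiP : Ck 2 punctured phi by apply: Ck_subset (cphi 2).
have gC : Ck 2 punctured (fun y => rho y `^ (2 - Q)) by exact: Ck_rho_powR.
have sL : cpt_punctured (fun x => rho x `^ (2 - Q) * L phi x).
  exact/cpt_puncturedM/cpt_punctured_sublaplacian.
have CL : Cc (fun x => rho x `^ (2 - Q) * L phi x).
  apply: Cc_cpt_punctured => // x x0; apply: continuousM.
    exact: (Ck_continuous gC).
  by apply: (Ck_continuous (k := 0) (O := punctured)) => //; exact: Ck_sublaplacian.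
rewrite -(cint_green X_smooth X_divfree gC cphiP sphi).
have := fsol_dirac fsol tphi; rewrite (cpt_punctured0 sphi).
rewrite (_ : integral_rV _ =
  integral_rV (EFin \o (fun x => - c * (rho x `^ (2 - Q) * L phi x)))); last first.
  by apply: eq_integral => t _ /=; congr EFin; rewrite mulrN mulNr mulrA.
rewrite integral_rV_cint; last exact: CcZ.
rewrite cintZ// => -[] /eqP; rewrite mulf_eq0 oppr_eq0.
by rewrite (negbTE fundamental_coef_neq0) => /eqP.
Qed.

(** Otherwise the function, continuous off 0, keeps its sign [s] on a ball around [x], and its
    integral against a bump supported there is not zero. *)
Lemma sublaplacian_fundamental x : x != 0 -> L (fun y => rho y `^ (2 - Q)) x = 0.
Proof.
move=> x0; have Px : punctured x by move/eqP : x0.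
apply/eqP; apply: contraT => Lx0.
set g := L _ in Lx0 *.
pose s : R := Num.sg (g x).
have sg0 : 0 < s * g x by rewrite -normrEsg normr_gt0.
have cg : continuous_at_all punctured g.
  by apply: (Ck_continuous (k := 0)); apply: Ck_sublaplacian => //; exact: Ck_rho_powR.
have /nbhs_ballP[e /= e0 eP] : nbhs x [set y | punctured y /\ 0 < s * g y].
  apply: filterI; first by apply: open_nbhs_nbhs; split.
  have : {for x, continuous (fun y => s * g y)}.
    by apply: continuousM; [exact: cst_continuous|exact: cg].
  by move=> cs; apply: (cs [set r | 0 < r]); exact: lt_nbhsr.
(* The ball avoids 0, so a bump of half its radius vanishes for [|y| < e / 2]. *)
have ex : e <= `|x|.
  rewrite leNgt; apply/negP => xe.
  have /eP[] : ball x e 0 by rewrite -ball_normE/= subr0.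
  exact.
have e20 : 0 < e / 2 by rewrite divr_gt0.
pose b := bump x (e / 2).
have sb : cpt_punctured b.
  exists (e / 2), (`|x| + e / 2); split=> // y [ye|]; last exact: bump_norm_out.
  apply: bump_out => //; rewrite -ball_normE/= => xy.
  have := ler_normD (x - y) y; rewrite subrK; lra.
have Cb k : Ck k setT b by exact: Ck_bump.
have Cbg : Cc (fun y => b y * g y).
  apply: Cc_cpt_punctured; last exact: cpt_puncturedMl.
  move=> y y0; apply: continuousM; last exact: cg.
  exact: (Ck_continuous (Cb 0)).
have Isb : cint (fun y => s * (b y * g y)) = 0.
  rewrite (cintZ s Cbg) (cint_test_fundamental Cb sb) ?mulr0//.
  exact: bump_test.
suff : 0 < cint (fun y => s * (b y * g y)) by rewrite Isb ltxx.
apply: (cint_gt0 (x := x)).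
- exact: CcZ.
- move=> y; have [xy|xy] := pselect (ball x (e / 2) y).
    have /eP[_ sg] : ball x e y by apply: le_ball xy; lra.
    rewrite (mulrCA s (b y) (g y)).
    exact: (mulr_ge0 (bump_ge0 _ _ _) (ltW sg)).
  have -> : b y = 0 by exact: bump_out.
  by rewrite mul0r mulr0.
- rewrite (mulrCA s (b x) (g x)).
  exact: (mulr_gt0 (bump_gt0 _ e20) sg0).
Qed.

Lemma sublaplacian_rho_comp (w w' w'' : R -> R) x : x != 0 ->
  (forall r : R, 0 < r -> is_derive r 1 w (w' r)) ->
  (forall r : R, 0 < r -> is_derive r 1 w' (w'' r)) ->
  (forall r : R, 0 < r -> {for r, continuous w''}) ->
  L (w \o rho) x = w'' (rho x) * hdot X rho rho x + w' (rho x) * L rho x.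
Proof.
move=> /eqP x0 dw dw' cw.
exact: (sublaplacian_comp X_smooth oP rho_punctured (rho_smooth 2) dw dw' cw x0).
Qed.

Lemma sublaplacian_rho x : x != 0 ->
  L rho x = (Q - 1) * hdot X rho rho x / rho x.
Proof.
move=> x0; have r0 := rho_gt0 x0.
have D1 (r : R) : 0 < r -> is_derive r 1 (fun r => r `^ (2 - Q))
    ((2 - Q) * r `^ (2 - Q - 1)).
  by move=> rr; exact: is_derive1_powR.
have D2 (r : R) : 0 < r -> is_derive r 1 (fun r => (2 - Q) * r `^ (2 - Q - 1))
    ((2 - Q) * ((2 - Q - 1) * r `^ (2 - Q - 1 - 1))).
  by move=> rr; apply: is_derive_mull; exact: is_derive1_powR.
have D3 (r : R) : 0 < r ->
    {for r, continuous (fun r => (2 - Q) * ((2 - Q - 1) * r `^ (2 - Q - 1 - 1)))}.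
  move=> rr; do 2 (apply: continuousM; first exact: cst_continuous).
  exact: (Ck1d_continuous (@Ck1d_powR R 0 _)).
have := etrans (esym (sublaplacian_rho_comp x0 D1 D2 D3)) (sublaplacian_fundamental x0).
have -> : rho x `^ (2 - Q - 1 - 1) = rho x `^ (2 - Q - 1) / rho x.
  by rewrite powRB ?(gt_eqF r0) ?implybT// powRr1// ltW.
(* The expansion of [L (rho^(2-Q))] is [(2 - Q) rho^(1-Q)] times
   [L rho - (Q - 1) |grad rho|^2 / rho], and the first factor is not zero. *)
have gen (P psi Lr r : R) : 0 < r -> 0 < P ->
    (2 - Q) * ((2 - Q - 1) * (P / r)) * psi + (2 - Q) * P * Lr = 0 ->
    Lr = (Q - 1) * psi / r.
  move=> r1 P0 E; have Q2 : 2 - Q != 0 by rewrite lt_eqF// subr_lt0.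
  have : (2 - Q) * P * (Lr - (Q - 1) * psi / r) = 0 by rewrite -E; field; rewrite gt_eqF.
  by move/eqP; rewrite !mulf_eq0 (negbTE Q2) gt_eqF//= subr_eq0 => /eqP.
exact: gen (powR_gt0 _ r0).
Qed.

End fundamental.

(** * Young's inequality and the algebra of the Rellich field *)

Section young.
Variable R : realType.

(** The convex function [x^p] lies above its tangent at [y]; this is Young's inequality for [x] and
    [y^(p-1)]. *)
Lemma young_tangent (p x y : R) : 1 < p -> 0 <= x -> 0 <= y ->
  p * x * y `^ (p - 1) - (p - 1) * y `^ p <= x `^ p.
Proof.
move=> p1 x0 y0; have p0 : 0 < p by lra.
have q0 : 0 < p / (p - 1) by rewrite divr_gt0//; lra.
have pq : p^-1 + (p / (p - 1))^-1 = 1 by field; rewrite !gt_eqF//; lra.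
have := conjugate_powR x0 (powR_ge0 y (p - 1)) p0 q0 pq.
rewrite -powRrM mulrCA mulfV ?mulr1; last by rewrite gt_eqF//; lra.
move=> h; rewrite lerBlDr -mulrA mulrC -ler_pdivlMr//.
apply: (le_trans h); rewrite mulrDl lerD2l.
by rewrite le_eqVlt; apply/orP; left; apply/eqP; field; rewrite !gt_eqF//; lra.
Qed.

(** Here [psi] is [|grad rho|^2], [l] is [L u] and [D] the divergence. The tangent to the power [p]
    is taken at [y = A |U| psi / r^2], the value of [|L u|] for [u = rho^-a]. Dividing by the weight
    removes [psi] from the term linear in [|l|], which is then bounded below by the hypothesis on
    [D]. *)
Lemma weighted_young (p th A U l psi r D : R) : 2 <= p -> 0 <= A -> 0 < psi ->
  0 < r ->
  A * `|U| `^ p * psi / r `^ (p * (th + 2)) - D <=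
    - (spow (p - 2) U * r `^ (2 - p * (th + 2)) * l) ->
  A `^ p * (`|U| `^ p / r `^ (p * (th + 2)) * psi) - p * A `^ (p - 1) * D <=
    `|l| `^ p * (r `^ (p * th) * psi `^ (p - 1))^-1.
Proof.
move=> p2 A0 psi0 r0 hD.
have p0 : 0 < p by lra. have p1 : 0 < p - 1 by lra.
have r20 : 0 < r `^ 2 by exact: powR_gt0.
pose y := A * `|U| * psi / r `^ 2.
have y0 : 0 <= y by rewrite divr_ge0 ?(ltW r20)// mulr_ge0 ?(ltW psi0)// mulr_ge0.
have := @young_tangent p `|l| y _ (normr_ge0 l) y0.
rewrite (_ : 1 < p); last by lra.
move=> /(_ isT) hy.
have w0 : 0 < r `^ (p * th) * psi `^ (p - 1) by rewrite mulr_gt0// powR_gt0.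
rewrite ler_pdivlMr//; apply: le_trans hy.
have yE q : y `^ q = A `^ q * `|U| `^ q * psi `^ q / r `^ (2 * q).
  rewrite /y !powRM ?mulr_ge0 ?invr_ge0 ?(ltW psi0) ?(ltW r20)//.
  by congr (_ * _); rewrite -[LHS]/(((r `^ 2)^-1) `^ q) -powRN -powRrM mulNr powRN.
rewrite !yE.
have rE : r `^ (p * (th + 2)) = r `^ (p * th) * r `^ (2 * (p - 1)) * r `^ 2.
  by rewrite -!powRD ?(gt_eqF r0) ?implybT//; congr powR; ring.
have rE' : r `^ (2 * p) = r `^ (2 * (p - 1)) * r `^ 2.
  by rewrite -!powRD ?(gt_eqF r0) ?implybT//; congr powR; ring.
have rE2 : r `^ (2 - p * (th + 2)) = (r `^ (p * th) * r `^ (2 * (p - 1)))^-1.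
  by rewrite -powRD ?(gt_eqF r0) ?implybT// -powRN; congr powR; ring.
have psiE : psi `^ p = psi * psi `^ (p - 1) by rewrite mulr_powRB1 ?(ltW psi0).
have AE : A `^ p = A * A `^ (p - 1) by rewrite mulr_powRB1.
have UE : `|U| `^ p = `|U| * `|U| `^ (p - 1) by rewrite mulr_powRB1.
have UE1 : `|U| `^ (p - 1) = `|spow (p - 2) U|.
  rewrite /spow normrM [X in _ * X]ger0_norm ?powR_ge0//.
  have [->|U0] := eqVneq U 0; first by rewrite normr0 powR0 ?mul0r// gt_eqF.
  rewrite -[X in X * _]powRr1// -powRD ?normr_eq0 ?U0 ?implybT//.
  by congr powR; ring.
rewrite rE rE' psiE AE in hD *.
have a0 := powR_ge0 A (p - 1).
have t0 := powR_gt0 (p * th) r0.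
have v0 := powR_gt0 (2 * (p - 1)) r0.
have f0 := powR_gt0 (p - 1) psi0.
have sl : - (spow (p - 2) U * l) <= `|U| `^ (p - 1) * `|l|.
  by rewrite UE1 -normrM -normrN ler_norm.
rewrite rE2 in hD.
rewrite UE in hD *.
move: sl hD a0 t0 v0 f0 r20.
move: (A `^ _) (r `^ (p * th)) (r `^ (2 * _)) (psi `^ _) (r `^ 2)
  (`|U|) (`|U| `^ _) (`|l|) (spow _ _).
move=> a t v f r2 u u1 l' S sl hD a0 t0 v0 f0 r20.
have hD' : A * (u * u1) * psi / r2 - D * (t * v) <= u1 * l'.
  apply: le_trans sl.
  move: hD; rewrite -(ler_pM2r (mulr_gt0 t0 v0)) => hD.
  apply: le_trans (le_trans hD _); rewrite le_eqVlt; apply/orP; left; apply/eqP.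
    by field; rewrite !gt_eqF.
  by field; rewrite !gt_eqF.
rewrite -subr_ge0.
(* The powers being now variables, the claim is [hD'] multiplied by
   [p A^(p-1) psi^(p-1) / r^(2(p-1))]. *)
rewrite [X in 0 <= X](_ : _ =
    (u1 * l' - (A * (u * u1) * psi / r2 - D * (t * v))) * (p * a * f / v)).
  by rewrite mulr_ge0 ?subr_ge0// divr_ge0 ?mulr_ge0// ltW.
by field; rewrite !gt_eqF.
Qed.

(** The letters stand for [u], [M = |u|^(p-2)], [r = rho], [h = rho^-g], the derivatives [al], [be]
    of [u] and [rho] along one field, and the second ones [l], [la]. The value of [s] gives [al be]
    the coefficient that completes the square; since [Q - 2 - g = p a], what remains of [be^2] has
    the coefficient [a (Q - 2 - a)]. The last term sums to zero over the fields by the equation for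
    [L rho]. *)
Lemma rellich_field_identity (Q p g a s U M r h al be l la : R) :
  r != 0 -> p != 0 -> Q = p * a + g + 2 -> s = (2 * (p - 1) * a + g) / p ->
  ((U * M) * (- g * (h / r) * be) + h * ((p - 1) * M * al)) * al + (U * M * h) * l +
  s * (((U * (U * M)) * (- (g + 1) * (h / r ^+ 2) * be) + (h / r) * (p * (U * M) * al)) * be
       + (U * (U * M)) * (h / r) * la) =
  U * M * h * l + (p - 1) * M * h * (al + a * (U / r) * be) ^+ 2 +
  a * (Q - 2 - a) * (U * (U * M)) * (h / r ^+ 2) * be ^+ 2 +
  s * (U * (U * M)) * (h / r) * (la - (Q - 1) * be ^+ 2 / r).
Proof. by move=> r0 p0 -> ->; field; rewrite r0 p0. Qed.

End young.

Section integral_monotonicity.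
Local Open Scope ereal_scope.

(** The integral of a nonnegative function is a supremum over the simple functions below it, hence
    monotone without measurability; the right-hand integrand of the theorem is handled in this
    way. *)
Lemma ge0_le_integralT d (T : measurableType d) (R : realType)
    (mu : {measure set T -> \bar R}) (f g : T -> \bar R) :
  (forall x, 0 <= f x) -> (forall x, f x <= g x) ->
  \int[mu]_x f x <= \int[mu]_x g x.
Proof.
move=> f0 fg; have g0 x : 0 <= g x by exact: le_trans (fg x).
rewrite !ge0_integralTE//; apply: ereal_sup_le => _ [h hf <-]; exists h => // x.
exact: le_trans (hf x) (fg x).
Qed.

End integral_monotonicity.

(** * The Rellich inequality *)

Section rellich_inequality.
Variables (R : realType) (n m : nat) (X : 'I_m -> vfield R n).
Hypothesis X_smooth : forall j k i, Ck k setT (fun x => X j x 0 i).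
Hypothesis X_divfree : forall j i x, partial i (fun y => X j y 0 i) x = 0.

Local Notation punctured := (~` [set (0 : 'rV[R]_n)]).
Local Notation L := (sublaplacian X).

Variables (rho : 'rV[R]_n -> R) (Q p theta : R).
Hypothesis rho_gt0 : forall x, x != 0 -> 0 < rho x.
Hypothesis rho_smooth : forall k, Ck k punctured rho.
Hypothesis Lrho : forall x, x != 0 -> L rho x = (Q - 1) * hdot X rho rho x / rho x.
Hypothesis p_ge2 : 2 <= p.

Let oP := @open_punctured R n.
Let a := (Q - p * (theta + 2)) / p.
Let g := p * (theta + 2) - 2.
Let s := (2 * (p - 1) * a + g) / p.
Let A := a * (Q - 2 - a).
Hypothesis A_ge0 : 0 <= A.

Lemma rellich_weight_ge0 x : (0 <= rellich_weight X rho p theta x)%E.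
Proof. by rewrite /rellich_weight inve_ge0 lee_fin mulr_ge0// powR_ge0. Qed.

Lemma rellich_rhs_ge0 u x : (0 <= rellich_rhs X rho p theta u x)%E.
Proof. by rewrite mule_ge0 ?lee_fin ?powR_ge0// rellich_weight_ge0. Qed.

Lemma rellich_weight_critical x : hdot X rho rho x = 0 ->
  rellich_weight X rho p theta x = +oo%E.
Proof.
move=> psi0; rewrite /rellich_weight.
have -> : hgrad_norm X rho x = 0.
  by apply/eqP; rewrite -sqrf_eq0 hgrad_norm_sqr psi0.
by rewrite powR0 ?mulr0 ?inve0// gt_eqF//; have := p_ge2; lra.
Qed.

Lemma rellich_weight_regular x : x != 0 -> 0 < hdot X rho rho x ->
  rellich_weight X rho p theta x =
  ((rho x `^ (p * theta) * hdot X rho rho x `^ (p - 1))^-1)%:E.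
Proof.
move=> x0 psi0; rewrite /rellich_weight.
have -> : hgrad_norm X rho x `^ (2 * (p - 1)) = hdot X rho rho x `^ (p - 1).
  by rewrite powRrM -hgrad_norm_sqr (powR_mulrn 2) ?hgrad_norm_ge0.
by rewrite inver gt_eqF// mulr_gt0// powR_gt0// rho_gt0.
Qed.

Lemma Cc_rellich_lhs u : (forall k, Ck k punctured u) -> cpt_punctured u ->
  Cc (rellich_lhs X rho p theta u).
Proof.
move=> cu su; rewrite /rellich_lhs.
under eq_fun do rewrite hgrad_norm_sqr -powRN.
have p0 : 0 < p by have := p_ge2; lra.
apply: Cc_cpt_punctured.
  move=> x x0; apply: continuousM; last first.
    by apply: (Ck_continuous (k := 0)) x0; apply: Ck_hdot.
  apply: continuousM; last exact: (Ck_continuous (Ck_rho_powR rho_gt0 rho_smooth 0 _)).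
  apply: (@continuous_comp _ _ _ u (fun t => `|t| `^ p)).
    exact: (Ck_continuous (cu 0)).
  exact: continuous_norm_powR (ltW p0) _.
do 2 apply: cpt_puncturedMl.
case: su => r [M [r0 rM]]; exists r, M; split=> // x /rM ->.
by rewrite normr0 powR0// gt_eqF.
Qed.

(** The factor [|u|^p] is written [u * spow (p - 2) u], visibly of class C^1. *)
Definition rellich_field (u : 'rV[R]_n -> R) (j : 'I_m) (x : 'rV[R]_n) : R :=
  spow (p - 2) (u x) * rho x `^ (- g) * vderiv (X j) u x +
  s * ((u x * spow (p - 2) (u x)) * rho x `^ (- g - 1)) * vderiv (X j) rho x.

Lemma p2_ge0 : 0 <= p - 2. Proof. by have := p_ge2; lra. Qed.

Lemma Ck_rellich_field u j : (forall k, Ck k punctured u) ->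
  Ck 1 punctured (rellich_field u j).
Proof.
move=> cu.
have cS : Ck 1 punctured (spow (p - 2) \o u).
  by apply: (Ck_comp oP (U := setT)) => //; exact: Ck1d_spow p2_ge0.
have ch b := Ck_rho_powR rho_gt0 rho_smooth 1 b.
have cXu := Ck_vderivX X_smooth j oP (cu 2%N).
have cXr := Ck_vderivX X_smooth j oP (rho_smooth 2).
have cuSk := CkM oP (CkM oP (cu 1%N) cS) (ch (- g - 1)).
exact: (CkD oP (CkM oP (CkM oP cS (ch (- g))) cXu)
  (CkM oP (CkM oP (Ck_cst 1 punctured s) cuSk) cXr)).
Qed.

Lemma cpt_rellich_field u j : cpt_punctured u -> cpt_punctured (rellich_field u j).
Proof.
move=> su; have sS : cpt_punctured (spow (p - 2) \o u).
  case: su => r [M [r0 rM]]; exists r, M; split=> // x /rM /= ->.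
  by rewrite /spow mul0r.
apply: cpt_puncturedD; apply: cpt_puncturedMl; first exact: cpt_puncturedMl.
by apply: cpt_puncturedM; do 2 apply: cpt_puncturedMl.
Qed.

Lemma vderiv_rellich_field u j x : (forall k, Ck k punctured u) -> x != 0 ->
  vderiv (X j) (rellich_field u j) x =
  ((spow (p - 2) (u x)) * (- g * (rho x `^ (- g) / rho x) * vderiv (X j) rho x) +
     rho x `^ (- g) * ((p - 1) * `|u x| `^ (p - 2) * vderiv (X j) u x)) *
     vderiv (X j) u x +
  spow (p - 2) (u x) * rho x `^ (- g) * vderiv (X j) (vderiv (X j) u) x +
  s * (((u x * spow (p - 2) (u x)) *
      (- (g + 1) * (rho x `^ (- g) / rho x ^+ 2) * vderiv (X j) rho x) +
    (rho x `^ (- g) / rho x) * (p * spow (p - 2) (u x) * vderiv (X j) u x)) *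
      vderiv (X j) rho x +
   (u x * spow (p - 2) (u x)) * (rho x `^ (- g) / rho x) *
     vderiv (X j) (vderiv (X j) rho) x).
Proof.
move=> cu x0; have Px : punctured x by move/eqP : x0.
have r0 := rho_gt0 x0.
have cS : Ck 1 punctured (spow (p - 2) \o u).
  by apply: (Ck_comp oP (U := setT)) => //; exact: Ck1d_spow p2_ge0.
have cu1 := cu 1%N; have cu2 := cu 2%N.
have ch := Ck_rho_powR rho_gt0 rho_smooth 1 (- g).
have ck := Ck_rho_powR rho_gt0 rho_smooth 1 (- g - 1).
have cXu := Ck_vderivX X_smooth j oP cu2.
have cXr := Ck_vderivX X_smooth j oP (rho_smooth 2).
have cSh := CkM oP cS ch.
have cuS := CkM oP cu1 cS.
have cuSk := CkM oP cuS ck.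
have csuSk := CkM oP (Ck_cst 1 punctured s) cuSk.
have DS : vderiv (X j) (spow (p - 2) \o u) x =
    (p - 1) * `|u x| `^ (p - 2) * vderiv (X j) u x.
  rewrite (vderiv_comp _ cu1 Px (is_derive_spow (u x) p2_ge0)).
  by congr (_ * _ * _); ring.
have Dpow b : vderiv (X j) (fun y => rho y `^ b) x =
    b * rho x `^ (b - 1) * vderiv (X j) rho x.
  exact: (vderiv_comp _ (rho_smooth 1) Px (is_derive1_powR b r0)).
have r1 : rho x `^ (- g - 1) = rho x `^ (- g) / rho x.
  by rewrite powRB ?(gt_eqF r0) ?implybT// powRr1// ltW.
have r2 : rho x `^ (- g - 1 - 1) = rho x `^ (- g) / rho x ^+ 2.
  by rewrite powRB ?(gt_eqF r0) ?implybT// powRr1 ?(ltW r0)// r1 expr2 invfM mulrA.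
have E := vderivD (X j) (CkM oP cSh cXu) (CkM oP csuSk cXr) Px.
have E1 := vderivM (X j) cSh cXu Px.
have E2 := vderivM (X j) csuSk cXr Px.
have E3 := vderivM (X j) cS ch Px.
have E4 := vderivZ (X j) s cuSk Px.
have E5 := vderivM (X j) cuS ck Px.
have E6 := vderivM (X j) cu1 cS Px.
apply: (etrans E); apply: (etrans (congr2 +%R E1 E2)).
move: E3 E4 E5 E6 DS (Dpow (- g)) (Dpow (- g - 1)) => /=.
rewrite r2 r1.
have gen (S M h r al be ll la U DSh DsuSk DuSk DuS DSv Dh Dk : R) : S = U * M ->
  DSh = S * Dh + h * DSv -> DsuSk = s * DuSk -> DuSk = U * S * Dk + h / r * DuS ->
  DuS = U * DSv + S * al -> DSv = (p - 1) * M * al ->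
  Dh = - g * (h / r) * be -> Dk = (- g - 1) * (h / r ^+ 2) * be ->
  S * h * ll + al * DSh + (s * (U * S * (h / r)) * la + be * DsuSk) =
  (S * (- g * (h / r) * be) + h * ((p - 1) * M * al)) * al + S * h * ll +
  s * ((U * S * (- (g + 1) * (h / r ^+ 2) * be) + h / r * (p * S * al)) * be +
     U * S * (h / r) * la).
  by move=> -> -> -> -> -> -> -> ->; ring.
by move=> E3 E4 E5 E6 E7 E8 E9; exact: (gen _ (`|u x| `^ (p - 2))
  _ _ _ _ _ _ _ _ _ _ _ _ _ _ _ E3 E4 E5 E6 E7 E8 E9).
Qed.

Lemma mul_spow (U : R) : U * spow (p - 2) U = `|U| `^ p.
Proof.
rewrite /spow mulrA -expr2 -real_normK ?num_real// -(powR_mulrn 2)//.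
have [->|U0] := eqVneq U 0.
  have p0 : 0 < p by have := p_ge2; lra.
  by rewrite normr0 powR_mulrn// expr0n mul0r powR0// gt_eqF.
by rewrite -powRD ?normr_eq0 ?U0 ?implybT//; congr powR; ring.
Qed.

Definition rellich_div (u : 'rV[R]_n -> R) (x : 'rV[R]_n) : R :=
  \sum_(j < m) vderiv (X j) (rellich_field u j) x.

(* The divergence of the field exceeds the right-hand side by [(p - 1)
   |u|^(p-2) rho^-g |grad u + a (u / rho) grad rho|^2], which vanishes for
   [u = rho^-a]. *)
Lemma rellich_div_ge u x : (forall k, Ck k punctured u) -> x != 0 ->
  A * `|u x| `^ p * hdot X rho rho x / rho x `^ (p * (theta + 2)) - rellich_div u x <=
  - (spow (p - 2) (u x) * rho x `^ (2 - p * (theta + 2)) * L u x).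
Proof.
move=> cu x0; have r0 := rho_gt0 x0.
have p0 : p != 0 by rewrite gt_eqF//; have := p_ge2; lra.
pose S := spow (p - 2) (u x); pose M := `|u x| `^ (p - 2).
pose h := rho x `^ (- g); pose r := rho x; pose U := u x.
pose al j := vderiv (X j) u x; pose be j := vderiv (X j) rho x.
pose l j := vderiv (X j) (vderiv (X j) u) x.
pose la j := vderiv (X j) (vderiv (X j) rho) x.
have DE : rellich_div u x = \sum_(j < m) (S * h * l j +
    (p - 1) * M * h * (al j + a * (U / r) * be j) ^+ 2 +
    A * (U * S) * (h / r ^+ 2) * (be j * be j) +
    (s * (U * S) * (h / r) * la j - s * (U * S) * (h / r) * (Q - 1) / r * (be j * be j))).
  apply: eq_bigr => j _; apply: (etrans (vderiv_rellich_field j cu x0)).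
  have Qe : Q = p * a + g + 2 by rewrite /a /g; field.
  have := @rellich_field_identity R Q p g a s U M r h (al j) (be j) (l j) (la j)
    (lt0r_neq0 r0) p0 Qe erefl.
  rewrite -[U * M]/S => E; apply: (etrans E); rewrite -/A; field; exact: lt0r_neq0.
have {DE} -> : rellich_div u x = S * h * L u x +
    (p - 1) * M * h * \sum_(j < m) (al j + a * (U / r) * be j) ^+ 2 +
    A * (U * S) * (h / r ^+ 2) * hdot X rho rho x +
    (s * (U * S) * (h / r) * L rho x -
      s * (U * S) * (h / r) * (Q - 1) / r * hdot X rho rho x).
  have gsum (c1 c2 c3 c4 c5 : R) (f1 f2 f3 f4 : 'I_m -> R) :
      \sum_(j < m) (c1 * f1 j + c2 * f2 j + c3 * f3 j + (c4 * f4 j - c5 * f3 j)) =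
      c1 * (\sum_(j < m) f1 j) + c2 * (\sum_(j < m) f2 j) + c3 * (\sum_(j < m) f3 j) +
      (c4 * (\sum_(j < m) f4 j) - c5 * (\sum_(j < m) f3 j)).
    by rewrite !big_split/= sumrN !mulr_sumr.
  exact: etrans DE (gsum _ _ _ _ _ _ _ _ _).
have SQ : 0 <= (p - 1) * M * h * \sum_(j < m) (al j + a * (U / r) * be j) ^+ 2.
  apply: mulr_ge0; last by apply: sumr_ge0 => j _; exact: sqr_ge0.
  by rewrite !mulr_ge0 ?powR_ge0//; have := p_ge2; lra.
have hr : h / r ^+ 2 = (rho x `^ (p * (theta + 2)))^-1.
  rewrite /h /r -(powR_mulrn 2) ?(ltW r0)// -powRB ?(gt_eqF r0) ?implybT//.
  by rewrite -powRN; congr powR; rewrite /g; ring.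
have hE : rho x `^ (2 - p * (theta + 2)) = h by congr powR; rewrite /g; ring.
rewrite (Lrho x0) hE hr -[spow _ _]/S [U * S]mul_spow.
have gen (B psi w T Up k ri : R) : 0 <= T ->
    A * Up * psi * w - (B + T + A * Up * w * psi +
      (k * ((Q - 1) * psi * ri) - k * (Q - 1) * ri * psi)) <= - B.
  move=> T0; rewrite -subr_ge0; have -> // : - B - (A * Up * psi * w - (B + T + A * Up * w * psi +
      (k * ((Q - 1) * psi * ri) - k * (Q - 1) * ri * psi))) = T by ring.
exact: gen.
Qed.

(** Off the critical set of [rho] this is [weighted_young]. On it the weight is infinite: if [L u x]
    is not zero the right side is infinite, and otherwise it is 0 times infinity, that is 0, while
    the divergence on the left is nonnegative by [rellich_div_ge]. *)
Lemma rellich_pointwise u x : (forall k, Ck k punctured u) -> x != 0 ->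
  ((A `^ p * rellich_lhs X rho p theta u x - p * A `^ (p - 1) * rellich_div u x)%:E
    <= rellich_rhs X rho p theta u x)%E.
Proof.
move=> cu x0; have r0 := rho_gt0 x0.
have p0 : 0 < p by have := p_ge2; lra.
have D := rellich_div_ge cu x0.
have [psi0|psi0] := eqVneq (hdot X rho rho x) 0; last first.
  have psi1 : 0 < hdot X rho rho x by rewrite lt_def psi0 hdot_ge0.
  have Y := weighted_young p_ge2 A_ge0 psi1 r0 D.
  by rewrite /rellich_rhs rellich_weight_regular// -EFinM lee_fin /rellich_lhs hgrad_norm_sqr.
rewrite /rellich_rhs rellich_weight_critical//.
have [Lu0|Lu0] := eqVneq (L u x) 0; last first.
  by rewrite gt0_muley ?leey// lte_fin powR_gt0// normr_gt0.
rewrite Lu0 normr0 powR0 ?gt_eqF// mul0e lee_fin /rellich_lhs hgrad_norm_sqr psi0.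
rewrite mulr0 mulr0 sub0r oppr_le0 mulr_ge0// ?mulr_ge0 ?powR_ge0 ?(ltW p0)//.
by move: D; rewrite psi0 Lu0 !mulr0 mul0r sub0r oppr0 oppr_le0.
Qed.

Lemma rellich_inequality u : test_function punctured u ->
  ((A `^ p)%:E * integral_rV (EFin \o rellich_lhs X rho p theta u)
    <= integral_rV (rellich_rhs X rho p theta u))%E.
Proof.
move=> /test_function_cpt[cuT su].
have cu k : Ck k punctured u by exact: Ck_subset (cuT k).
have cl := Cc_rellich_lhs cu su.
have [cD D0] := cint_div X_smooth X_divfree (fun j => Ck_rellich_field j cu)
  (fun j => cpt_rellich_field j su).
have cAl := CcZ (A `^ p) cl.
have ckD := CcZ (p * A `^ (p - 1)) cD.
have cf := CcB cAl ckD.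
have -> : ((A `^ p)%:E * integral_rV (EFin \o rellich_lhs X rho p theta u))%E =
    integral_rV (EFin \o (fun x => A `^ p * rellich_lhs X rho p theta u x -
      p * A `^ (p - 1) * rellich_div u x)).
  rewrite (integral_rV_cint cf) (integral_rV_cint cl) -EFinM; congr EFin.
  apply/esym/(etrans (cintB cAl ckD)).
  by rewrite (cintZ _ cl) (cintZ _ cD) D0 mulr0 subr0.
(* Integrals are compared for nonnegative functions, so the left integrand is first replaced by its
   positive part, which is still continuous with compact support. *)
have cp : Cc (fun x => Num.max (A `^ p * rellich_lhs X rho p theta u x -
      p * A `^ (p - 1) * rellich_div u x) 0).
  case: (cf) => cc [N fN]; split.
    by move=> x; have /= := continuous_max (cc x) (@cst_continuous _ _ (0 : R) x); apply.
  by exists N => x xN; have := fN x xN => /= ->; rewrite maxxx.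
apply: (@le_trans _ _ (integral_rV (EFin \o (fun x =>
  Num.max (A `^ p * rellich_lhs X rho p theta u x -
      p * A `^ (p - 1) * rellich_div u x) 0)))).
  rewrite (integral_rV_cint cf) (integral_rV_cint cp) lee_fin.
  by apply: (le_cint cf cp) => x; rewrite le_max lexx.
apply: ge0_le_integralT => t; first by rewrite lee_fin le_max lexx orbT.
rewrite /= EFin_max ge_max rellich_rhs_ge0 andbT.
have [x0|x0] := eqVneq (rv_of_tuple t) 0; last exact: rellich_pointwise.
rewrite x0; apply: le_trans (rellich_rhs_ge0 _ _); rewrite lee_fin.
have -> : rellich_lhs X rho p theta u 0 = 0.
  rewrite /rellich_lhs cpt_punctured0// normr0 powR0 ?mul0r// gt_eqF//.
  by have := p_ge2; lra.
have -> : rellich_div u 0 = 0; last by rewrite !mulr0 subr0.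
apply: big1 => j _; apply: cpt_punctured0; apply: cpt_punctured_vderiv.
exact: cpt_rellich_field.
Qed.

End rellich_inequality.

(** * Smooth cutoffs and trapezoids on the line *)

Section cutoff.
Variable R : realType.

(** [c] is the value of [flat 0 (1 - t)] at [t = 0], and [e] normalises [step] to the value 1 for
    [t >= 1]. Nesting two flat functions avoids a quotient. *)
Let c : R := flat 0 1.
Let e : R := flat 0 c.
Let dflat2 (t : R) : R := flat 4 t - 2 * flat 3 t.

Lemma is_derive_chain (f g : R -> R) (x df dg : R) :
  is_derive (g x) 1 f df -> is_derive x 1 g dg ->
  is_derive x 1 (fun y => f (g y)) (df * dg).
Proof. exact: is_derive1_comp. Qed.

Lemma continuous_chain (f g : R -> R) : continuous g -> continuous f ->
  continuous (fun y => f (g y)).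
Proof. by move=> cg cf x; apply: continuous_comp; [exact: cg|exact: cf]. Qed.

Lemma is_derive_flat0 (t : R) : is_derive t 1 (flat 0) (flat 2 t).
Proof. by have := is_derive_flat 0 t; rewrite mul0r subr0. Qed.

Lemma is_derive_flat2 (t : R) : is_derive t 1 (flat 2) (dflat2 t).
Proof. exact: is_derive_flat. Qed.

Lemma continuous_flat k : continuous (@flat R k).
Proof. by move=> t; exact: (Ck1d_continuous (@Ck1d_flat R 0 k setT)). Qed.

Lemma dflat2_le0 (t : R) : t <= 0 -> dflat2 t = 0.
Proof. by move=> t0; rewrite /dflat2 !flat_le0// mulr0 subr0. Qed.

Lemma norm_flat_le k (t : R) : `|flat k t| <= k`!%:R.
Proof. by rewrite ger0_norm ?flat_ge0// flat_le. Qed.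

(** The bound is [4! + 2 * 3!]. *)
Lemma norm_dflat2_le (t : R) : `|dflat2 t| <= 36.
Proof.
rewrite (le_trans (ler_normB _ _))// normrM ger0_norm//.
have := norm_flat_le 4 t; have := norm_flat_le 3 t.
by rewrite !factS fact0 /= => h1 h2; lra.
Qed.

(* [flat 0 (1 - t)] is at least [c] for [t <= 0] and vanishes for [t >= 1]. *)
Definition step (t : R) : R := e^-1 * flat 0 (c - flat 0 (1 - t)).
Definition dstep (t : R) : R :=
  e^-1 * (flat 2 (c - flat 0 (1 - t)) * flat 2 (1 - t)).
Definition d2step (t : R) : R :=
  e^-1 * (dflat2 (c - flat 0 (1 - t)) * flat 2 (1 - t) ^+ 2 -
    flat 2 (c - flat 0 (1 - t)) * dflat2 (1 - t)).

Let e_gt0 : 0 < e. Proof. by do 2 apply: flat_gt0. Qed.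

Lemma is_derive_1B (t : R) : is_derive t 1 (fun t => 1 - t) (-1).
Proof.
by rewrite -[X in is_derive _ _ _ X]sub0r; apply: is_deriveB; exact: is_derive_cst.
Qed.

Lemma is_derive_step_arg (t : R) :
  is_derive t 1 (fun t => c - flat 0 (1 - t)) (flat 2 (1 - t)).
Proof.
have D := is_derive_chain (g := fun t => 1 - t) (is_derive_flat0 (1 - t)) (is_derive_1B t).
have := is_deriveB (is_derive_cst c t 1) D.
by rewrite mulrN1 opprK add0r.
Qed.

Lemma is_derive_step (t : R) : is_derive t 1 step (dstep t).
Proof.
apply: is_derive_mull.
exact: (is_derive_chain (g := fun t => c - flat 0 (1 - t))
  (is_derive_flat0 (c - flat 0 (1 - t))) (is_derive_step_arg t)).
Qed.

Lemma is_derive_dstep (t : R) : is_derive t 1 dstep (d2step t).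
Proof.
apply: is_derive_mull.
have D1 := is_derive_chain (g := fun t => c - flat 0 (1 - t))
  (is_derive_flat2 (c - flat 0 (1 - t))) (is_derive_step_arg t).
have D2 := is_derive_chain (g := fun t => 1 - t) (is_derive_flat2 (1 - t)) (is_derive_1B t).
apply: (is_derive_eq (is_deriveM D1 D2)).
by rewrite /= /GRing.scale/=; ring.
Qed.

Lemma continuous_dflat2 : continuous dflat2.
Proof.
move=> t; apply: continuousB; first exact: continuous_flat.
by apply: continuousM; [exact: cst_continuous|exact: continuous_flat].
Qed.

Lemma continuous_d2step : continuous d2step.
Proof.
have c1 : continuous (fun t : R => 1 - t).
  by move=> t; apply: continuousB => //; exact: cst_continuous.
have cf k : continuous (fun t : R => flat k (1 - t)).
  exact: continuous_chain c1 (@continuous_flat k).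
have ca : continuous (fun t : R => c - flat 0 (1 - t)).
  by move=> t; exact: (continuousB (@cst_continuous _ _ c t) (cf 0%N t)).
have cfg1 := continuous_chain ca continuous_dflat2.
have cfg2 := continuous_chain (cf 2) (@exprn_continuous R 2).
have cfg3 := continuous_chain ca (@continuous_flat 2).
have cfg4 := continuous_chain c1 continuous_dflat2.
move=> t; rewrite /d2step; apply: (continuousM (@cst_continuous _ _ e^-1 t)).
exact: (continuousB (continuousM (cfg1 t) (cfg2 t)) (continuousM (cfg3 t) (cfg4 t))).
Qed.

Lemma step_arg_le0 (t : R) : t <= 0 -> c - flat 0 (1 - t) <= 0.
Proof.
move=> t0; have t1 : 0 < 1 - t by lra.
rewrite subr_le0 /c /flat ltr01 t1 !expr0 !mul1r ler_expR lerN2 lef_pV2 ?posrE//.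
lra.
Qed.

Lemma step0 (t : R) : t <= 0 -> [/\ step t = 0, dstep t = 0 & d2step t = 0].
Proof.
move=> /step_arg_le0 t0; rewrite /step /dstep /d2step (dflat2_le0 t0) !(flat_le0 _ t0).
by rewrite !(mul0r, mulr0, subr0).
Qed.

Lemma step1 (t : R) : 1 <= t -> [/\ step t = 1, dstep t = 0 & d2step t = 0].
Proof.
move=> t1; have t0 : 1 - t <= 0 by lra.
rewrite /step /dstep /d2step (dflat2_le0 t0) !(flat_le0 _ t0) subr0.
rewrite !(mul0r, mulr0, subr0, expr0n)/= ?(mulr0, subr0); split => //.
by rewrite -/e mulVf// gt_eqF.
Qed.

Lemma step_bounded : exists2 K, 0 <= K &
  forall t, [/\ `|step t| <= K, `|dstep t| <= K & `|d2step t| <= K].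
Proof.
have f0 (t : R) : `|flat 0 t| <= 1 by exact: (norm_flat_le 0).
have f2 (t : R) : `|flat 2 t| <= 2 by exact: (norm_flat_le 2).
have d2 := norm_dflat2_le.
have ci : 0 <= e^-1 by rewrite invr_ge0 ltW.
(* The bounds 2 for [flat 2] and 36 for [dflat2], inserted in [d2step]; the result also exceeds the
   bounds for [step] and [dstep]. *)
exists (e^-1 * (36 * 2 ^+ 2 + 2 * 36)) => [|t].
  by rewrite mulr_ge0//; lra.
have h1 : 1 <= 36 * 2 ^+ 2 + 2 * 36 :> R by lra.
have h2 : 2 * 2 <= 36 * 2 ^+ 2 + 2 * 36 :> R by lra.
rewrite /step /dstep /d2step !(normrM e^-1) (ger0_norm ci).
split; apply: ler_wpM2l => //.
- exact: le_trans (f0 _) h1.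
- by rewrite normrM; apply: le_trans h2; exact: ler_pM.
- have sq : `|flat 2 (1 - t) ^+ 2| <= 2 ^+ 2.
    by rewrite normrX lerXn2r ?nnegrE.
  rewrite (le_trans (ler_normB _ _))//.
  by apply: lerD; rewrite normrM; apply: ler_pM.
Qed.

Lemma Ck_step n k (O : set 'rV[R]_n) f : open O -> Ck k O f -> Ck k O (step \o f).
Proof.
move=> oO cf.
have c1 : Ck k O (fun x => 1 - f x) by apply: CkB => //; exact: Ck_cst.
have c2 : Ck k O (flat 0 \o (fun x => 1 - f x)).
  by apply: (Ck_comp (U := setT)) => //; exact: Ck1d_flat.
have c3 : Ck k O (fun x => c - flat 0 (1 - f x)) by apply: CkB => //; exact: Ck_cst.
have c4 : Ck k O (flat 0 \o (fun x => c - flat 0 (1 - f x))).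
  by apply: (Ck_comp (U := setT)) => //; exact: Ck1d_flat.
by apply: (CkM oO) c4; exact: Ck_cst.
Qed.

Definition cut (T t : R) := step (t + (T + 1)) * step (T + 1 - t).
Definition dcut (T t : R) :=
  dstep (t + (T + 1)) * step (T + 1 - t) - step (t + (T + 1)) * dstep (T + 1 - t).
Definition d2cut (T t : R) :=
  d2step (t + (T + 1)) * step (T + 1 - t)
  - 2 * (dstep (t + (T + 1)) * dstep (T + 1 - t))
  + step (t + (T + 1)) * d2step (T + 1 - t).

Lemma is_derive_shift_comp (f df : R -> R) (a t : R) :
  (forall s : R, is_derive s 1 f (df s)) ->
  is_derive t 1 (fun t => f (t + a)) (df (t + a)) /\
  is_derive t 1 (fun t => f (a - t)) (- df (a - t)).
Proof.
move=> fd; split.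
  have Ds : is_derive t 1 (fun t : R => t + a) 1.
    by rewrite -[X in is_derive _ _ _ X]addr0; apply: is_deriveD; exact: is_derive_cst.
  by have := is_derive_chain (g := fun t => t + a) (fd (t + a)) Ds; rewrite mulr1.
have Ds : is_derive t 1 (fun t : R => a - t) (-1).
  by rewrite -[X in is_derive _ _ _ X]sub0r; apply: is_deriveB; exact: is_derive_cst.
by have := is_derive_chain (g := fun t => a - t) (fd (a - t)) Ds; rewrite mulrN1.
Qed.

Lemma is_derive_cut (T t : R) : is_derive t 1 (cut T) (dcut T t).
Proof.
have [D1 _] := is_derive_shift_comp (T + 1) t is_derive_step.
have [_ D2] := is_derive_shift_comp (T + 1) t is_derive_step.
apply: (is_derive_eq (is_deriveM D1 D2)).
by rewrite /dcut /GRing.scale/=; ring.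
Qed.

Lemma is_derive_dcut (T t : R) : is_derive t 1 (dcut T) (d2cut T t).
Proof.
have [D1 D2] := is_derive_shift_comp (T + 1) t is_derive_step.
have [E1 E2] := is_derive_shift_comp (T + 1) t is_derive_dstep.
apply: (is_derive_eq (is_deriveB (is_deriveM E1 D2) (is_deriveM D1 E2))).
by rewrite /d2cut /GRing.scale/=; ring.
Qed.

Lemma continuous_is_derive (f df : R -> R) :
  (forall s : R, is_derive s 1 f (df s)) -> continuous f.
Proof.
by move=> D t; apply: differentiable_continuous; apply/derivable1_diffP; have [] := D t.
Qed.

Lemma continuous_d2cut T : continuous (d2cut T).
Proof.
have cl (f : R -> R) : continuous f -> continuous (fun t => f (t + (T + 1))).
  apply: (continuous_chain (g := fun t => t + (T + 1))) => t.
  exact: (continuousD (@cvg_id _ (nbhs t)) (@cst_continuous _ _ (T + 1) t)).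
have cr (f : R -> R) : continuous f -> continuous (fun t => f (T + 1 - t)).
  apply: (continuous_chain (g := fun t => T + 1 - t)) => t.
  exact: (continuousB (@cst_continuous _ _ (T + 1) t) (@cvg_id _ (nbhs t))).
have c0 := continuous_is_derive is_derive_step.
have c1 := continuous_is_derive is_derive_dstep.
have c2 := continuous_d2step.
move=> t; rewrite /d2cut.
have A := continuousM (cl _ c2 t) (cr _ c0 t).
have B := continuousM (@cst_continuous _ _ (2 : R) t) (continuousM (cl _ c1 t) (cr _ c1 t)).
exact: (continuousD (continuousB A B) (continuousM (cl _ c0 t) (cr _ c2 t))).
Qed.

Lemma cut1 (T t : R) : `|t| <= T -> [/\ cut T t = 1, dcut T t = 0 & d2cut T t = 0].
Proof.
rewrite ler_norml => /andP[t1 t2].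
have h1 : 1 <= t + (T + 1) by lra. have h2 : 1 <= T + 1 - t by lra.
have [a0 a1 a2] := step1 h1; have [b0 b1 b2] := step1 h2.
by rewrite /cut /dcut /d2cut a0 a1 a2 b0 b1 b2; split; ring.
Qed.

Lemma cut0 (T t : R) : T + 1 <= `|t| -> [/\ cut T t = 0, dcut T t = 0 & d2cut T t = 0].
Proof.
rewrite ler_normr => /orP[] h.
  have h2 : T + 1 - t <= 0 by lra.
  have [b0 b1 b2] := step0 h2.
  by rewrite /cut /dcut /d2cut b0 b1 b2; split; ring.
have h2 : t + (T + 1) <= 0 by lra.
have [b0 b1 b2] := step0 h2.
by rewrite /cut /dcut /d2cut b0 b1 b2; split; ring.
Qed.

(** The transition layers have width 1 for every [T], so that [K] does not depend on [T]. *)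
Lemma cut_bounded : exists2 K, 0 <= K &
  forall T t, [/\ `|cut T t| <= K, `|dcut T t| <= K & `|d2cut T t| <= K].
Proof.
have [K K0 sK] := step_bounded.
have KK : 0 <= K * K by rewrite mulr_ge0.
exists (4 * (K * K)) => [|T t]; first by rewrite mulr_ge0.
have [a0 a1 a2] := sK (t + (T + 1)); have [b0 b1 b2] := sK (T + 1 - t).
have P (x y : R) : `|x| <= K -> `|y| <= K -> `|x * y| <= K * K.
  by move=> xK yK; rewrite normrM; exact: ler_pM.
have p00 := P _ _ a0 b0; have p10 := P _ _ a1 b0; have p01 := P _ _ a0 b1.
have p11 := P _ _ a1 b1; have p20 := P _ _ a2 b0; have p02 := P _ _ a0 b2.
rewrite /cut /dcut /d2cut; split.
- by apply: (le_trans p00); lra.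
- by rewrite (le_trans (ler_normB _ _))//; lra.
- rewrite (le_trans (ler_normD _ _))//.
  have := ler_normB (d2step (t + (T + 1)) * step (T + 1 - t))
    (2 * (dstep (t + (T + 1)) * dstep (T + 1 - t))).
  by rewrite (normrM 2) (ger0_norm (ler0n _ _)); lra.
Qed.

(* A trapezoid rather than [cut T], as its primitive is explicit and its integral
   is affine in [T]. *)
Definition trap (T t : R) : R :=
  2^-1 * (`|t + (T + 1)| - `|t + T| - `|t - T| + `|t - (T + 1)|).

Lemma trap_in (T t : R) : 0 <= T -> `|t| <= T -> trap T t = 1.
Proof.
move=> T0; rewrite ler_norml => /andP[t1 t2]; rewrite /trap.
rewrite (@ger0_norm _ (t + (T + 1))) ?(@ger0_norm _ (t + T)) ?(@ler0_norm _ (t - T))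
  ?(@ler0_norm _ (t - (T + 1))); lra.
Qed.

Lemma trap_out (T t : R) : 0 <= T -> T + 1 <= `|t| -> trap T t = 0.
Proof.
move=> T0; rewrite ler_normr /trap => /orP[] h.
  by rewrite !ger0_norm; lra.
by rewrite !ler0_norm; lra.
Qed.

Lemma trap_bounds (T t : R) : 0 <= T -> 0 <= trap T t <= 1.
Proof.
move=> T0; rewrite /trap.
have [h1|h1] := ger0P (t + (T + 1)); have [h2|h2] := ger0P (t + T);
have [h3|h3] := ger0P (t - T); have [h4|h4] := ger0P (t - (T + 1));
apply/andP; split; lra.
Qed.

Lemma continuous_trap T : continuous (trap T).
Proof.
have cn b : continuous (fun t : R => `|t + b|).
  apply: (continuous_chain (g := fun t => t + b) (f := fun y => `|y|)) => t.
    exact: (continuousD (@cvg_id _ (nbhs t)) (@cst_continuous _ _ b t)).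
  exact: norm_continuous.
move=> t; exact: (continuousM (@cst_continuous _ _ (2^-1 : R) t)
  (continuousD (continuousB (continuousB (cn _ t) (cn _ t)) (cn (- T) t))
    (cn (- (T + 1)) t))).
Qed.

(** [trap (T - 1)] is at most 1 and vanishes for [|t| >= T], and [trap (T + 1)] is 1 for
    [|t| <= T + 1]. Hence the combination is at most [delta] on the plateau, equals [- K] in the
    layers and is at most 0 beyond. *)
Lemma trap_minorant (delta K T t S : R) : 1 <= T -> 0 <= delta -> 0 <= K ->
  (`|t| <= T -> S = delta) -> (T + 1 <= `|t| -> S = 0) -> - K <= S ->
  (delta + K) * trap (T - 1) t - K * trap (T + 1) t <= S.
Proof.
move=> T1 d0 K0 S1 S0 SK.
have Tm : 0 <= T - 1 by rewrite subr_ge0.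
have Tp : 0 <= T + 1 by rewrite addr_ge0// (le_trans ler01).
have /andP[b1 b2] := trap_bounds t Tm; have /andP[b3 b4] := trap_bounds t Tp.
have [tT|tT] := leP `|t| T.
  rewrite (trap_in Tp) ?mulr1 ?S1//; last by rewrite (le_trans tT)// lerDl.
  by rewrite lerBlDr ler_piMr// addr_ge0.
rewrite (trap_out Tm) ?mulr0 ?sub0r; last by rewrite subrK ltW.
have [tT1|tT1] := leP `|t| (T + 1); first by rewrite (trap_in Tp tT1) mulr1.
by rewrite (S0 (ltW tT1)) oppr_le0 mulr_ge0.
Qed.

Definition trap_prim (T t : R) : R :=
  4^-1 * (spow 1 (t + (T + 1)) - spow 1 (t + T) - spow 1 (t - T) + spow 1 (t - (T + 1))).

Lemma is_derive_trap_prim (T t : R) : is_derive t 1 (trap_prim T) (trap T t).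
Proof.
have Ds (b : R) : is_derive t 1 (fun t => spow 1 (t + b)) (2 * `|t + b|).
  have D (s : R) : is_derive s 1 (spow 1) (2 * `|s|).
    by have := @is_derive_spow R 1 s ler01; rewrite powRr1.
  by have [] := is_derive_shift_comp b t D.
have := is_derive_mull 4^-1
  (is_deriveD (is_deriveB (is_deriveB (Ds (T + 1)) (Ds T)) (Ds (- T))) (Ds (- (T + 1)))).
move=> D; apply: (is_derive_eq D).
by rewrite /trap; field.
Qed.

(** The primitive is odd, hence equal to plus or minus [T + 1/2], half the integral of [trap T], on
    either side of the support. The factor [2 * T + 1] matches both ends at once. *)
Lemma trap_prim_out (T t : R) : 0 <= T -> T + 1 <= `|t| ->
  trap_prim T t - (2 * T + 1) * trap_prim 0 t = 0.
Proof.
move=> T0; rewrite ler_normr /trap_prim /spow !powRr1// => /orP[] h.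
  rewrite !ger0_norm; try lra; by field.
rewrite !ler0_norm; try lra; by field.
Qed.

End cutoff.

(** * Functions of the logarithm of the norm *)

Section log_lift.
Variable R : realType.

(* [H (ln r)], cut to [0] at [r <= 0], where the library sets [ln r = 0]. *)
Definition lnlift (H : R -> R) (r : R) : R := if 0 < r then H (ln r) else 0.

Lemma lnliftE H r : 0 < r -> lnlift H r = H (ln r).
Proof. by rewrite /lnlift => ->. Qed.

Lemma lnlift_le0 H r : r <= 0 -> lnlift H r = 0.
Proof. by rewrite /lnlift leNgt => /negbTE ->. Qed.

(** Products of a function of [ln r] and a power of [r] are stable under differentiation, which acts
    on the first factor as [G' + c G]; second-order operators thus acquire constant coefficients in
    [t = ln r]. *)
Lemma is_derive_lnlift_powR (G dG : R -> R) (c r : R) :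
  (forall t : R, is_derive t 1 G (dG t)) -> 0 < r ->
  is_derive r 1 (fun r => lnlift G r * r `^ c)
    (lnlift (fun t => dG t + c * G t) r * r `^ (c - 1)).
Proof.
move=> GD r0.
have D1 : is_derive r 1 (fun r => G (ln r)) (dG (ln r) * r^-1).
  exact: (is_derive_chain (GD (ln r)) (is_derive1_ln r0)).
have D2 := is_derive1_powR c r0.
have E : dG (ln r) * r^-1 * r `^ c + G (ln r) * (c * r `^ (c - 1)) =
    lnlift (fun t => dG t + c * G t) r * r `^ (c - 1).
  have -> : r `^ (c - 1) = r `^ c / r.
    by rewrite powRB ?(gt_eqF r0) ?implybT// powRr1// ltW.
  by rewrite lnliftE//; ring.
have D : is_derive r 1 (fun r => G (ln r) * r `^ c)
    (lnlift (fun t => dG t + c * G t) r * r `^ (c - 1)).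
  rewrite -E; apply: (is_derive_eq (is_deriveM D1 D2)).
  by rewrite /GRing.scale/=; ring.
apply: near_eq_is_derive D; near=> y.
by rewrite lnliftE//; near: y; exact: lt_nbhsr.
Unshelve. all: by end_near. Qed.

Lemma continuous_lnlift_powR H (c r : R) : continuous H -> 0 < r ->
  {for r, continuous (fun r => lnlift H r * r `^ c)}.
Proof.
move=> cH r0.
have O0 : open [set y : R | 0 < y] by exact: open_gt.
have cHl : {for r, continuous (fun y => H (ln y))}.
  apply: (@continuous_comp _ _ _ (@ln R) H); last exact: cH.
  exact: (Ck1d_continuous (@Ck1d_ln R 0)).
have cHr : {for r, continuous (lnlift H)}.
  rewrite /prop_for /continuous_at (lnliftE _ r0); apply: cvg_trans cHl.
  apply: (near_eq_cvg (F := nbhs r)); near=> y.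
  by rewrite lnliftE//; near: y; exact: lt_nbhsr.
apply: continuousM cHr _.
exact: (Ck1d_continuous (@Ck1d_powR R 0 c)).
Unshelve. all: by end_near. Qed.

End log_lift.

(** * Sharpness of the constant *)

Section sharpness.
Variables (R : realType) (n m : nat) (X : 'I_m -> vfield R n).
Hypothesis X_smooth : forall j k i, Ck k setT (fun x => X j x 0 i).
Hypothesis X_divfree : forall j i x, partial i (fun y => X j y 0 i) x = 0.

Local Notation punctured := (~` [set (0 : 'rV[R]_n)]).
Local Notation L := (sublaplacian X).

Variables (rho : 'rV[R]_n -> R) (Q p theta : R).
Hypothesis rho_gt0 : forall x, x != 0 -> 0 < rho x.
Hypothesis rho_smooth : forall k, Ck k punctured rho.
Hypothesis Lrho : forall x, x != 0 -> L rho x = (Q - 1) * hdot X rho rho x / rho x.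
Hypothesis p_ge2 : 2 <= p.
Hypothesis rho0 : rho 0 = 0.
Hypothesis rho_cont : continuous rho.
Hypothesis rho_proper : forall B, exists M, forall x, M < `|x| -> B < rho x.
Hypothesis rho_one : exists x, rho x = 1.
Hypothesis weight_int : locally_integrable_rV (rellich_weight X rho p theta).

Let oP := @open_punctured R n.
Let a := (Q - p * (theta + 2)) / p.
Let A := a * (Q - 2 - a).
Hypothesis A_ge0 : 0 <= A.

(** [rho] tends to 0 at 0 and to infinity at infinity, so [|ln rho| < T] confines [x] to an
    annulus. *)
Lemma cpt_lnlift H (T : R) f : (forall t, T <= `|t| -> H t = 0) ->
  cpt_punctured (fun x => lnlift H (rho x) * f x).
Proof.
move=> H0; apply: cpt_puncturedMl.
have [M rM] := rho_proper (expR T).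
have : nbhs (0 : 'rV[R]_n) [set x | rho x < expR (- T)].
  have := @rho_cont 0; rewrite /continuous_at rho0.
  move=> /(_ [set y | y < expR (- T)]); apply.
  by apply: lt_nbhsl; exact: expR_gt0.
move=> /nbhs_ballP[r /= r0 rP]; exists r, M; split=> // x.
have [rx|rx] := leP (rho x) 0; first by rewrite lnlift_le0.
rewrite lnliftE// => -[xr|/rM xM]; apply: H0; rewrite ler_normr.
  have : ball (0 : 'rV[R]_n) r x by rewrite -ball_normE/= sub0r normrN.
  move=> /rP /ltW; rewrite -[X in X <= _](lnK rx) ler_expR => h.
  by apply/orP; right; rewrite lerNr.
apply/orP; left; move: xM => /ltW.
by rewrite -[X in _ <= X](lnK rx) ler_expR.
Qed.

Definition radial (H : R -> R) (x : 'rV[R]_n) : R :=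
  lnlift H (rho x) * (rho x `^ (- Q) * hdot X rho rho x).

Lemma Cc_radial H (T : R) : continuous H -> (forall t, T <= `|t| -> H t = 0) ->
  Cc (radial H).
Proof.
move=> cH H0; apply: Cc_cpt_punctured; last exact: cpt_lnlift H0.
move=> x Px; have r0 : 0 < rho x by apply: rho_gt0; apply/eqP.
have ch : {for x, continuous (hdot X rho rho)}.
  by apply: (Ck_continuous (Ck_hdot X_smooth oP (rho_smooth 1) (rho_smooth 1))).
have cw : {for x, continuous (fun x => lnlift H (rho x) * rho x `^ (- Q))}.
  apply: (@continuous_comp _ _ _ rho (fun r => lnlift H r * r `^ (- Q))).
    exact: rho_cont.
  exact: continuous_lnlift_powR.
have -> : radial H = fun x => (lnlift H (rho x) * rho x `^ (- Q)) * hdot X rho rho x.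
  by apply/funext => y; rewrite /radial mulrA.
exact: continuousM cw ch.
Qed.

(* The field [H (ln rho) rho^(1-Q) grad rho] has divergence [radial dH], since
   [rho^(2-Q)] is harmonic. *)
Lemma cint_radial_derive (H dH : R -> R) (T : R) :
  (forall t : R, is_derive t 1 H (dH t)) -> continuous dH ->
  (forall t, T <= `|t| -> H t = 0) -> (forall t, T <= `|t| -> dH t = 0) ->
  cint (radial dH) = 0.
Proof.
move=> HD cdH H0 dH0.
pose w r := lnlift H r * r `^ (1 - Q).
pose dw r := lnlift (fun t => dH t + (1 - Q) * H t) r * r `^ (1 - Q - 1).
have wD (r : R) : 0 < r -> is_derive r 1 w (dw r).
  by move=> r0; exact: is_derive_lnlift_powR.
have cH : continuous H := continuous_is_derive HD.
have cw : Ck 1 punctured (w \o rho).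
  apply: (Ck_comp oP (rho_punctured rho_gt0) _ (rho_smooth 1)).
  exists dw => // r r0; apply: continuous_lnlift_powR => // t.
  exact: (continuousD (cdH t) (continuousM (@cst_continuous _ _ (1 - Q) t) (cH t))).
pose F j x := (w \o rho) x * vderiv (X j) rho x.
have cF j : Ck 1 punctured (F j).
  exact: (CkM oP cw (Ck_vderivX X_smooth j oP (rho_smooth 2))).
have sF j : cpt_punctured (F j).
  by apply: cpt_puncturedMl; exact: cpt_lnlift H0.
have [_ <-] := cint_div X_smooth X_divfree cF sF; congr cint.
apply: eq_cpt_punctured.
- exact: cpt_lnlift dH0.
- by apply: cpt_punctured_sum => j; exact: cpt_punctured_vderiv.
move=> x x0; have r0 := rho_gt0 x0.
have Px : punctured x by move/eqP : x0.
pose be j := vderiv (X j) rho x; pose la j := vderiv (X j) (vderiv (X j) rho) x.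
have E : \sum_(j < m) vderiv (X j) (F j) x =
    \sum_(j < m) (w (rho x) * la j + dw (rho x) * (be j * be j)).
  apply: eq_bigr => j _.
  apply: (etrans (vderivM (X j) cw (Ck_vderivX X_smooth j oP (rho_smooth 2)) Px)).
  congr (_ + _); rewrite (vderiv_comp (X j) (rho_smooth 1) Px (wD _ r0)).
  by rewrite -/(be j) mulrCA.
apply/esym/(etrans E).
have gsum (c1 c2 : R) (f1 f2 : 'I_m -> R) : \sum_(j < m) (c1 * f1 j + c2 * f2 j) =
    c1 * (\sum_(j < m) f1 j) + c2 * (\sum_(j < m) f2 j).
  by rewrite big_split/= !mulr_sumr.
apply: (etrans (gsum _ _ _ _)).
apply: (etrans (congr2 (fun l h => w (rho x) * l + dw (rho x) * h) (Lrho x0)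
  (erefl (hdot X rho rho x)))).
rewrite /w /dw /radial !lnliftE//.
have -> : 1 - Q - 1 = - Q by ring.
have -> : rho x `^ (1 - Q) = rho x * rho x `^ (- Q).
  by rewrite powRD ?(gt_eqF r0) ?implybT// powRr1// ltW.
have gen (h dh r P psi : R) : r != 0 -> h * (r * P) * ((Q - 1) * psi / r) +
   (dh + (1 - Q) * h) * P * psi = dh * (P * psi) by move=> ?; field.
by apply: gen; exact: lt0r_neq0.
Qed.

(** [2 * T + 1] is the ratio of the integrals of [trap T] and [trap 0]; the difference formed with
    this factor has a compactly supported primitive, and [cint_radial_derive] applies. *)
Lemma cint_radial_trap (T : R) : 0 <= T ->
  cint (radial (trap T)) = (2 * T + 1) * cint (radial (trap 0)).
Proof.
move=> T0.
have c1 : Cc (radial (trap T)).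
  by apply: (@Cc_radial _ (T + 1)); [exact: continuous_trap|move=> t; exact: trap_out].
have c2 : Cc (radial (trap 0)).
  by apply: (@Cc_radial _ (0 + 1)); [exact: continuous_trap|move=> t; exact: trap_out].
have E : cint (fun x => radial (trap T) x - (2 * T + 1) * radial (trap 0) x) = 0.
  have := @cint_radial_derive (fun t => trap_prim T t - (2 * T + 1) * trap_prim 0 t)
    (fun t => trap T t - (2 * T + 1) * trap 0 t) (T + 1).
  have -> : radial (fun t => trap T t - (2 * T + 1) * trap 0 t) =
     fun x => radial (trap T) x - (2 * T + 1) * radial (trap 0) x.
    apply/funext => x; rewrite /radial /lnlift; case: ifP => _; last by ring.
    have gen (x' y k Z : R) : (x' - k * y) * Z = x' * Z - k * (y * Z) by ring.
    exact: gen.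
  apply.
  - move=> t; apply: (is_deriveB (is_derive_trap_prim T t)).
    exact: is_derive_mull (is_derive_trap_prim 0 t).
  - move=> t; exact: (continuousB (@continuous_trap _ T t)
      (continuousM (@cst_continuous _ _ (2 * T + 1) t) (@continuous_trap _ 0 t))).
  - by move=> t; exact: trap_prim_out.
  - move=> t tT; rewrite (trap_out T0 tT) trap_out ?mulr0 ?subr0//.
    by apply: le_trans tT; rewrite lerD2r.
apply/eqP; rewrite -subr_eq0 -(cintZ _ c2); apply/eqP.
exact: etrans (esym (cintB c1 (CcZ _ c2))) E.
Qed.

(** The integrand is continuous and nonnegative; if its integral were not positive it would vanish
    identically, and so would the gradient of [rho] in a ball around a point where [rho = 1], since
    [trap 0] is positive at [ln 1]. *)
Lemma cint_radial_trap_gt0 : 0 < cint (radial (trap 0)).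
Proof.
have c0 : Cc (radial (trap 0)).
  by apply: (@Cc_radial _ (0 + 1)); [exact: continuous_trap|move=> t; exact: trap_out].
have r_ge0 x : 0 <= radial (trap 0) x.
  rewrite /radial /lnlift; case: ifP => _; last by rewrite mul0r.
  have /andP[t0 _] := trap_bounds (ln (rho x)) (lexx (0 : R)).
  by rewrite mulr_ge0// mulr_ge0 ?powR_ge0// hdot_ge0.
rewrite ltNge; apply/negP => I0.
have r0 x : radial (trap 0) x = 0.
  apply/eqP; rewrite eq_le r_ge0 andbT leNgt; apply/negP => /(cint_gt0 c0 r_ge0).
  by rewrite ltNge I0.
(* The factor with exponent 0 below equals 1; it gives the function the form required by
   [continuous_lnlift_powR]. *)
have [x1 x1E] := rho_one.
have : nbhs x1 [set x | 0 < lnlift (trap 0) (rho x) * rho x `^ 0].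
  have cx : {for x1, continuous (fun x => lnlift (trap 0) (rho x) * rho x `^ 0)}.
    apply: (@continuous_comp _ _ _ rho (fun r => lnlift (trap 0) r * r `^ 0)).
      exact: rho_cont.
    by rewrite x1E; apply: continuous_lnlift_powR => //; exact: continuous_trap.
  apply: (cx [set r | 0 < r]); apply: lt_nbhsr.
  by rewrite x1E lnliftE// ln1 powRr0 trap_in ?normr0// mulr1.
move=> /nbhs_ballP[e /= e0 eP].
have wy x : ball x1 e x -> rellich_weight X rho p theta x = +oo%E.
  move=> /eP; rewrite /= powRr0 mulr1 => h; apply: rellich_weight_critical => //.
  have rx : 0 < rho x.
    by rewrite ltNge; apply/negP => /(lnlift_le0 (trap 0)) E; rewrite E ltxx in h.
  have := r0 x; rewrite /radial => /eqP; rewrite mulf_eq0 gt_eqF//= mulf_eq0.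
  by rewrite (gt_eqF (powR_gt0 _ rx))/= => /eqP.
have := weight_int (@compact_le_norm R n (`|x1| + e)).
pose B := @rv_of_tuple R n @^-1` ball x1 e.
have mB : measurable B by exact: measurable_rv_ball.
move=> /(@integrableS _ _ _ _ _ B).
have mK : measurable (@rv_of_tuple R n @^-1` [set x | `|x| <= `|x1| + e]).
  by apply: measurable_rv_closed; exact: closed_le_norm.
have sBK : B `<=` @rv_of_tuple R n @^-1` [set x | `|x| <= `|x1| + e].
  move=> t; rewrite /B /= -ball_normE/= => te.
  rewrite -(subrK x1 (rv_of_tuple t)) addrC (le_trans (ler_normD _ _))// lerD2l.
  by rewrite distrC ltW.
move=> /(_ mK mB sBK) /integrableP[_]; apply/negP; rewrite -leNgt.
rewrite (_ : (\int[_]_(x in B) _)%E =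
    (\int[lebesgue_tuple (n := n)]_(x in B) (cst +oo) x)%E); last first.
  by apply: eq_integral => t; rewrite inE => Bt; rewrite /= wy.
rewrite integral_cst// gt0_mulye//.
exact: lebesgue_tuple_ball_gt0.
Qed.

Definition near_extremal (T : R) (x : 'rV[R]_n) : R :=
  lnlift (cut T) (rho x) * rho x `^ (- a).

(** What [L] becomes on [phi (ln rho) rho^-a], up to the factor [rho^(-a-2) |grad rho|^2], applied
    to [phi = cut T]. On the plateau its value is [- A]. *)
Definition near_extremal_lap (T t : R) : R :=
  d2cut T t + (Q - 2 - 2 * a) * dcut T t - A * cut T t.

Lemma near_extremal_test T : test_function punctured (near_extremal T).
Proof.
apply: cpt_test_function => [k|]; last first.
  by apply: (@cpt_lnlift _ (T + 1)) => t /cut0[].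
apply: CkM => //; last exact: Ck_rho_powR.
have cl : Ck k punctured (@ln R \o rho).
  exact: (Ck_comp oP (rho_punctured rho_gt0) (@Ck1d_ln R k) (rho_smooth k)).
have c1 : Ck k punctured (fun x => ln (rho x) + (T + 1)).
  exact: (CkD oP cl (Ck_cst k punctured (T + 1))).
have c2 : Ck k punctured (fun x => T + 1 - ln (rho x)).
  exact: (CkB oP (Ck_cst k punctured (T + 1)) cl).
apply: (Ck_eq_open oP _ (CkM oP (Ck_step oP c1) (Ck_step oP c2))) => x Px.
by rewrite lnliftE//; apply: rho_gt0; apply/eqP.
Qed.

Lemma sublaplacian_near_extremal T x : x != 0 -> L (near_extremal T) x =
  near_extremal_lap T (ln (rho x)) * rho x `^ (- a - 2) * hdot X rho rho x.
Proof.
move=> x0; have r0 := rho_gt0 x0.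
pose G1 t := dcut T t + (- a) * cut T t.
pose dG1 t := d2cut T t + (- a) * dcut T t.
have D0 (r : R) : 0 < r -> is_derive r 1 (fun r => lnlift (cut T) r * r `^ (- a))
    (lnlift G1 r * r `^ (- a - 1)).
  by move=> rr; apply: is_derive_lnlift_powR => // t; exact: is_derive_cut.
have D1 (r : R) : 0 < r -> is_derive r 1 (fun r => lnlift G1 r * r `^ (- a - 1))
    (lnlift (fun t => dG1 t + (- a - 1) * G1 t) r * r `^ (- a - 1 - 1)).
  move=> rr; apply: is_derive_lnlift_powR => // t.
  exact: (is_deriveD (is_derive_dcut T t) (is_derive_mull (- a) (is_derive_cut T t))).
have c0 := continuous_is_derive (is_derive_cut T).
have c1 := continuous_is_derive (is_derive_dcut T).
have D2 (r : R) : 0 < r -> {for r, continuous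
    (fun r => lnlift (fun t => dG1 t + (- a - 1) * G1 t) r * r `^ (- a - 1 - 1))}.
  apply: continuous_lnlift_powR => t.
  have cm (c : R) f : continuous f -> {for t, continuous (fun t : R => c * f t)}.
    by move=> cf; exact: (continuousM (@cst_continuous _ _ c t) (cf t)).
  apply: (continuousD (continuousD (@continuous_d2cut _ T t) (cm _ _ c1))).
  apply: cm => s; apply: (continuousD (c1 s)).
  exact: (continuousM (@cst_continuous _ _ (- a) s) (c0 s)).
apply: (etrans (sublaplacian_rho_comp X_smooth rho_gt0 rho_smooth x0 D0 D1 D2)).
rewrite Lrho// !lnliftE//.
have -> : - a - 1 - 1 = - a - 2 by ring.
have -> : rho x `^ (- a - 1) = rho x * rho x `^ (- a - 2).
  rewrite -[X in X * _]powRr1 ?(ltW r0)// -powRD ?(gt_eqF r0) ?implybT//.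
  by congr powR; ring.
rewrite /dG1 /G1 /near_extremal_lap /A.
have gen (d2 d1 d0 P psi r : R) : r != 0 ->
    (d2 + - a * d1 + (- a - 1) * (d1 + - a * d0)) * P * psi +
      (d1 + - a * d0) * (r * P) * ((Q - 1) * psi / r) =
    (d2 + (Q - 2 - 2 * a) * d1 - a * (Q - 2 - a) * d0) * P * psi.
  by move=> ?; field.
by apply: gen; exact: lt0r_neq0.
Qed.

Let p_gt0 : 0 < p. Proof. by have := p_ge2; lra. Qed.

(** The exponents of [rho] add up to [- a p - p (theta + 2) = - Q]. *)
Lemma rellich_lhs_near_extremal T :
  rellich_lhs X rho p theta (near_extremal T) = radial (fun t => `|cut T t| `^ p).
Proof.
apply/funext => x; rewrite /rellich_lhs hgrad_norm_sqr /radial /near_extremal.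
have [rx|r0] := leP (rho x) 0.
  by rewrite !lnlift_le0// !mul0r normr0 powR0 ?gt_eqF// !mul0r.
rewrite !lnliftE// normrM powRM// (ger0_norm (powR_ge0 _ _)) -powRrM -powRN -!mulrA.
congr (_ * _); rewrite mulrA -powRD ?(gt_eqF r0) ?implybT//.
by congr (_ `^ _ * _); rewrite /a; field; rewrite gt_eqF.
Qed.

(** Again [(- a - 2) p - p theta = - Q], and the power [p] of [|grad rho|^2] against the power
    [p - 1] in the weight leaves one factor. At a critical point the sub-Laplacian vanishes with
    this factor, and 0 times the infinite weight is 0. *)
Lemma rellich_rhs_near_extremal T :
  rellich_rhs X rho p theta (near_extremal T) =
  EFin \o radial (fun t => `|near_extremal_lap T t| `^ p).
Proof.
apply/funext => x; rewrite /rellich_rhs /=.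
have [->|x0] := eqVneq x 0.
  have [_ s0] := test_function_cpt (near_extremal_test T).
  rewrite (cpt_punctured0 (cpt_punctured_sublaplacian X s0)).
  rewrite normr0 powR0 ?gt_eqF// mul0e /radial rho0 lnlift_le0//.
  by rewrite mul0r.
have r0 := rho_gt0 x0; rewrite sublaplacian_near_extremal// /radial lnliftE//.
have [psi0|psi0] := eqVneq (hdot X rho rho x) 0.
  by rewrite psi0 !mulr0 normr0 powR0 ?gt_eqF// mul0e.
have psi1 : 0 < hdot X rho rho x by rewrite lt_def psi0 hdot_ge0.
rewrite rellich_weight_regular// -EFinM; congr EFin.
rewrite !normrM (ger0_norm (powR_ge0 _ _)) (gtr0_norm psi1).
rewrite !powRM ?mulr_ge0 ?powR_ge0 ?(ltW psi1)//.
have -> : hdot X rho rho x `^ p = hdot X rho rho x * hdot X rho rho x `^ (p - 1).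
  by rewrite mulr_powRB1 ?(ltW psi1).
rewrite -powRrM invfM -powRN.
have -> : rho x `^ (- Q) = rho x `^ ((- a - 2) * p) * rho x `^ (- (p * theta)).
  rewrite -powRD ?(gt_eqF r0) ?implybT//; congr powR; rewrite /a; field.
  by rewrite gt_eqF.
have := powR_gt0 (p - 1) psi1.
have gen (z y v psi f : R) : 0 < f -> z * y * (psi * f) * (v * f^-1) = z * (y * v * psi).
  by move=> f0; field; rewrite gt_eqF.
exact: gen.
Qed.

Lemma rellich_sharp C' : (forall u, test_function punctured u ->
    (C'%:E * integral_rV (EFin \o rellich_lhs X rho p theta u)
      <= integral_rV (rellich_rhs X rho p theta u))%E) ->
  C' <= A `^ p.
Proof.
move=> hC; rewrite leNgt; apply/negP => CA.
have C0 : 0 < C' by apply: le_lt_trans CA; exact: powR_ge0.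
have [K0 K00 cutK] := @cut_bounded R.
pose K := (K0 + `|Q - 2 - 2 * a| * K0 + `|A| * K0) `^ p.
have KE T t : `|near_extremal_lap T t| `^ p <= K.
  have [k0 k1 k2] := cutK T t.
  apply: ge0_ler_powR; rewrite ?nnegrE ?(ltW p_gt0)//.
    by rewrite !addr_ge0// mulr_ge0.
  rewrite /near_extremal_lap (le_trans (ler_normB _ _))//.
  apply: lerD; last by rewrite normrM ler_wpM2l.
  rewrite (le_trans (ler_normD _ _))//.
  by apply: lerD => //; rewrite normrM ler_wpM2l.
have Kge0 : 0 <= K by exact: powR_ge0.
pose delta := C' - A `^ p.
have d0 : 0 < delta by rewrite subr_gt0.
(* With [J] the integral for [trap 0], the minorant integrates to [(delta (2 T - 1) - 4 K) J], and
   this [T] makes it [delta J], which is positive. *)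
pose T := 1 + 2 * K / delta.
have T1 : 1 <= T by rewrite lerDl divr_ge0 ?(ltW d0)// mulr_ge0.
pose phi t := `|cut T t| `^ p; pose E t := `|near_extremal_lap T t| `^ p.
have cp := continuous_norm_powR (ltW p_gt0).
have c0 := continuous_is_derive (is_derive_cut T).
have c1 := continuous_is_derive (is_derive_dcut T).
have cphi : Cc (radial phi).
  apply: (@Cc_radial _ (T + 1)); first exact: (continuous_chain c0 cp).
  by move=> t /cut0[c _ _]; rewrite /phi c normr0 powR0// gt_eqF.
have cE : Cc (radial E).
  apply: (@Cc_radial _ (T + 1)).
    apply: (continuous_chain (g := near_extremal_lap T) _ cp) => t.
    exact: (continuousB (continuousD (@continuous_d2cut _ T t)
      (continuousM (@cst_continuous _ _ (Q - 2 - 2 * a) t) (c1 t)))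
      (continuousM (@cst_continuous _ _ A t) (c0 t))).
  move=> t /cut0[c d1 d2]; rewrite /E /near_extremal_lap c d1 d2 !mulr0 addr0 subr0.
  by rewrite normr0 powR0// gt_eqF.
have := hC _ (near_extremal_test T).
rewrite rellich_lhs_near_extremal rellich_rhs_near_extremal.
rewrite (integral_rV_cint cphi) (integral_rV_cint cE) -EFinM lee_fin => CE.
have T0 : 0 <= T - 1 by rewrite subr_ge0.
have T2 : 0 <= T + 1 by rewrite addr_ge0// (le_trans ler01).
have ctr S : 0 <= S -> Cc (radial (trap S)).
  move=> S0; apply: (@Cc_radial _ (S + 1)); first exact: continuous_trap.
  by move=> t; exact: trap_out.
have cl := CcB (CcZ (delta + K) (ctr _ T0)) (CcZ K (ctr _ T2)).
have cr := CcB (CcZ C' cphi) cE.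
have := le_cint cl cr.
rewrite (cintB (CcZ _ (ctr _ T0)) (CcZ _ (ctr _ T2))) (cintB (CcZ _ cphi) cE).
rewrite (cintZ _ (ctr _ T0)) (cintZ _ (ctr _ T2)) (cintZ _ cphi).
rewrite (cint_radial_trap T0) (cint_radial_trap T2).
have I0 := cint_radial_trap_gt0.
move: I0 CE; set J := cint (radial (trap 0)) => J0 CE h.
have /h {h} : forall x, (delta + K) * radial (trap (T - 1)) x - K * radial (trap (T + 1)) x <=
    C' * radial phi x - radial E x.
  move=> x; rewrite /radial /lnlift; case: ifP => _; last by rewrite !mul0r !mulr0.
  set t := ln (rho x).
  have z0 : 0 <= rho x `^ (- Q) * hdot X rho rho x by rewrite mulr_ge0 ?powR_ge0 ?hdot_ge0.
  have gen (k1 k2 k3 t1 t2 f g z : R) : 0 <= z -> k1 * t1 - k2 * t2 <= k3 * f - g ->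
      k1 * (t1 * z) - k2 * (t2 * z) <= k3 * (f * z) - g * z.
    by move=> zz /(ler_wpM2r zz); lra.
  apply: gen => //.
  apply: (trap_minorant T1 (ltW d0) Kge0).
  - move=> /cut1[k0 k1 k2].
    rewrite /phi /E /near_extremal_lap k0 k1 k2 !mulr0 mulr1 addr0 sub0r normrN.
    by rewrite (ger0_norm A_ge0) normr1 powR1 mulr1.
  - move=> /cut0[k0 k1 k2].
    rewrite /phi /E /near_extremal_lap k0 k1 k2 !mulr0 addr0 subr0 normr0 powR0 ?gt_eqF//.
    by rewrite mulr0 subr0.
  - have EK : E t <= K by exact: KE.
    rewrite lerBrDr (le_trans _ (mulr_ge0 (ltW C0) (powR_ge0 `|cut T t| p)))//.
    by rewrite addrC subr_le0.
apply/negP; rewrite -ltNge.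
have CE0 : C' * cint (radial phi) - cint (radial E) <= 0 by rewrite subr_le0.
apply: (le_lt_trans CE0).
have -> : (delta + K) * ((2 * (T - 1) + 1) * J) - K * ((2 * (T + 1) + 1) * J) = delta * J.
  by rewrite /T; field; rewrite gt_eqF.
exact: mulr_gt0.
Qed.

End sharpness.

(** * The formal extremal *)

Section equality.
Variables (R : realType) (n m : nat) (X : 'I_m -> vfield R n).
Hypothesis X_smooth : forall j k i, Ck k setT (fun x => X j x 0 i).

Local Notation punctured := (~` [set (0 : 'rV[R]_n)]).
Local Notation L := (sublaplacian X).

Variables (rho : 'rV[R]_n -> R) (Q p theta : R).
Hypothesis rho_gt0 : forall x, x != 0 -> 0 < rho x.
Hypothesis rho_smooth : forall k, Ck k punctured rho.
Hypothesis Lrho : forall x, x != 0 -> L rho x = (Q - 1) * hdot X rho rho x / rho x.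
Hypothesis p_ge2 : 2 <= p.
Let a := (Q - p * (theta + 2)) / p.
Let A := a * (Q - 2 - a).
Hypothesis A_ge0 : 0 <= A.

(** Both sides are [A^p |c|^p rho^-Q |grad rho|^2]; the sign of [A] matters, since the right side
    produces [|A|^p]. *)
Lemma rellich_equality (c : R) x : x != 0 -> hgrad_norm X rho x != 0 ->
  (A `^ p * rellich_lhs X rho p theta (fun x => c * rho x `^ (- a)) x)%:E =
  rellich_rhs X rho p theta (fun x => c * rho x `^ (- a)) x.
Proof.
move=> x0 psi0; have r0 := rho_gt0 x0.
have p0 : 0 < p by have := p_ge2; lra.
have psi1 : 0 < hdot X rho rho x.
  by rewrite lt_def hdot_ge0 andbT -hgrad_norm_sqr sqrf_eq0.
have D0 (r : R) : 0 < r -> is_derive r 1 (fun r => c * r `^ (- a))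
    (c * (- a * r `^ (- a - 1))).
  by move=> rr; apply: is_derive_mull; exact: is_derive1_powR.
have D1 (r : R) : 0 < r -> is_derive r 1 (fun r => c * (- a * r `^ (- a - 1)))
    (c * (- a * ((- a - 1) * r `^ (- a - 1 - 1)))).
  by move=> rr; do 2 apply: is_derive_mull; exact: is_derive1_powR.
have D2 (r : R) : 0 < r ->
    {for r, continuous (fun r => c * (- a * ((- a - 1) * r `^ (- a - 1 - 1))))}.
  move=> rr; do 3 (apply: continuousM; first exact: cst_continuous).
  exact: (Ck1d_continuous (@Ck1d_powR R 0 _)).
have LE : L (fun x => c * rho x `^ (- a)) x =
    - (A * c * rho x `^ (- a - 2) * hdot X rho rho x).
  apply: (etrans (sublaplacian_rho_comp X_smooth rho_gt0 rho_smooth x0 D0 D1 D2)).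
  rewrite Lrho//.
  have -> : - a - 1 - 1 = - a - 2 by ring.
  have -> : rho x `^ (- a - 1) = rho x * rho x `^ (- a - 2).
    rewrite -[X in X * _]powRr1 ?(ltW r0)// -powRD ?(gt_eqF r0) ?implybT//.
    by congr powR; ring.
  rewrite /A.
  have gen (P psi r : R) : r != 0 ->
      c * (- a * ((- a - 1) * P)) * psi + c * (- a * (r * P)) * ((Q - 1) * psi / r) =
      - (a * (Q - 2 - a) * c * P * psi) by move=> ?; field.
  by apply: gen; exact: lt0r_neq0.
rewrite /rellich_rhs rellich_weight_regular// -EFinM LE; congr EFin.
move: A_ge0; clear LE; generalize A => B B_ge0.
rewrite /rellich_lhs hgrad_norm_sqr normrN (normrM c) (normrM (B * c * _)) (normrM (B * c))
  (normrM B) (ger0_norm (powR_ge0 _ (- a))) (ger0_norm (powR_ge0 _ (- a - 2))).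
rewrite (gtr0_norm psi1) (ger0_norm B_ge0).
rewrite !powRM ?mulr_ge0 ?powR_ge0 ?normr_ge0 ?B_ge0 ?(ltW psi1)//.
have -> : hdot X rho rho x `^ p = hdot X rho rho x * hdot X rho rho x `^ (p - 1).
  by rewrite mulr_powRB1 ?(ltW psi1).
rewrite -!powRrM invfM -!powRN.
have -> : rho x `^ ((- a - 2) * p) = rho x `^ (- a * p) * rho x `^ (- (2 * p)).
  by rewrite -powRD ?(gt_eqF r0) ?implybT//; congr powR; ring.
have -> : rho x `^ (- (p * (theta + 2))) = rho x `^ (- (2 * p)) * rho x `^ (- (p * theta)).
  by rewrite -powRD ?(gt_eqF r0) ?implybT//; congr powR; ring.
rewrite [in RHS]powRN.
have := powR_gt0 (p - 1) psi1.
have gen (z y v w t psi f : R) : 0 < f ->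
    z * (y * v * (w * t) * psi) = z * y * (v * w) * (psi * f) * (t * f^-1).
  by move=> f0; field; rewrite gt_eqF.
by rewrite !powRN; exact: gen.
Qed.

End equality.

(** * Properties of the norm at 0 and at infinity *)

Section fundamental_norms.
Variables (R : realType) (d : seq nat) (X : 'I_(head 0%N d) -> vfield R (sumn d)).
Variables (rho : 'rV[R]_(sumn d) -> R).
Hypothesis Q_gt3 : (3 < homogeneous_dim d)%N.
Hypothesis rho_norm : homogeneous_norm rho.
Hypothesis X_smooth : forall j k i, Ck k setT (fun x => X j x 0 i).

(** In dimension 0 the homogeneous dimension would be 0. Nonzero vectors are needed for a point with
    [rho = 1] and for points arbitrarily close to 0. *)
Lemma sumn_gt0 : (0 < sumn d)%N.
Proof.
have nth_le (s : seq nat) j : (nth 0 s j <= sumn s)%N.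
  elim: s j => [[]//|k s IH] [|j] /=; first exact: leq_addr.
  by rewrite (leq_trans (IH j))// leq_addl.
rewrite lt0n; apply/negP => /eqP d0; move: Q_gt3; rewrite /homogeneous_dim big1// => i _.
by have := nth_le d i; rewrite d0 leqn0 => /eqP ->; rewrite muln0.
Qed.

Lemma small_nonzero (e : R) : 0 < e -> exists2 x : 'rV[R]_(sumn d), x != 0 & `|x| < e.
Proof.
move=> e0; pose i := Ordinal sumn_gt0.
have e20 : 0 < e / 2 by rewrite divr_gt0.
exists ((e / 2) *: delta_mx 0 i).
  rewrite scaler_eq0 negb_or (gt_eqF e20)/=; apply/eqP => /rowP/(_ i).
  by rewrite !mxE !eqxx/= => /eqP; rewrite oner_eq0.
have : `|(e / 2) *: delta_mx 0 i : 'rV[R]_(sumn d)| <= e / 2.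
  apply: norm_le_coord => [|k]; first exact: ltW.
  rewrite !mxE eqxx/=; case: (k == i); rewrite ?mulr1 ?mulr0 ?normr0 ?(ltW e20)//.
  by rewrite gtr0_norm.
by move=> /le_lt_trans; apply; lra.
Qed.

Lemma hnorm0 : rho 0 = 0.
Proof.
have d0 : dilation 2 (0 : 'rV[R]_(sumn d)) = 0.
  by apply/rowP => i; rewrite !mxE mulr0.
have := hnorm_dilation rho_norm 0 (ltr0Sn R 1); rewrite d0; lra.
Qed.

Lemma hnorm_one : exists x, rho x = 1.
Proof.
have [x x0 _] := small_nonzero (ltr01 : 0 < 1 :> R).
have r0 := hnorm_gt0 rho_norm x0.
exists (dilation (rho x)^-1 x); rewrite (hnorm_dilation rho_norm) ?invr_gt0//.
by rewrite mulVf// gt_eqF.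
Qed.

(** The exponent [2 - Q] is negative, so the decay of the fundamental solution at infinity forces
    [rho] to grow. [B] is raised to at least 1 so that its powers can be compared. *)
Lemma fundamental_norm_proper (Q c : R) : 2 < Q -> c != 0 ->
  fundamental_solution X (fun x => c * rho x `^ (2 - Q)) ->
  forall B, exists M, forall x, M < `|x| -> B < rho x.
Proof.
move=> Q2 c0 fs B; pose B' := Num.max B 1.
have B0 : 0 < B' by rewrite lt_max ltr01 orbT.
have cn0 : 0 < `|c| by rewrite normr_gt0.
have [M MP] := fsol_infty fs (mulr_gt0 cn0 (powR_gt0 (2 - Q) B0)).
exists (Num.max M 0) => x; rewrite gt_max normr_gt0 => /andP[/MP + x0].
have r0 := hnorm_gt0 rho_norm x0.
rewrite normrM (ger0_norm (powR_ge0 _ _)) ltr_pM2l ?normr_gt0// => h.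
apply: (@le_lt_trans _ _ B'); first by rewrite le_max lexx.
rewrite ltNge; apply/negP => rB; move: h; apply/negP; rewrite -leNgt.
rewrite -(opprB Q) !powRN lef_pV2 ?posrE ?powR_gt0//.
have q0 : 0 <= Q - 2 by rewrite subr_ge0 ltW.
by apply: (ge0_ler_powR q0); rewrite ?nnegrE ?(ltW r0) ?(ltW B0).
Qed.

Lemma hnorm_power_not_test (c b : R) : c != 0 ->
  ~ test_function (~` [set 0]) (fun x => c * rho x `^ b).
Proof.
move=> c0 /test_function_cpt[_ [r [M [r0 rM]]]].
have [x x0 xr] := small_nonzero r0.
have := rM x (or_introl xr) => /eqP; rewrite mulf_eq0 (negbTE c0)/=.
by rewrite gt_eqF// powR_gt0//; exact: hnorm_gt0.
Qed.

End fundamental_norms.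

Unset Implicit Arguments.

Theorem corollary4p6 (R : realType) (d : seq nat)
    (op : 'rV[R]_(sumn d) -> 'rV[R]_(sumn d) -> 'rV[R]_(sumn d))
    (X : 'I_(head 0%N d) -> vfield R (sumn d))
    (rho : 'rV[R]_(sumn d) -> R) (p theta : R) :
  let Q : R := (homogeneous_dim d)%:R in
  let C : R :=
    ((Q - p * (theta + 2)) * (p * theta + Q * (p - 1)) / p ^+ 2) `^ p in
  homogeneous_carnot_group op X ->
  (3 < homogeneous_dim d)%N ->
  fundamental_norm X rho ->
  2 <= p ->
  0 <= (Q - p * (theta + 2)) * (p * theta + Q * (p - 1)) ->
  locally_integrable_rV (rellich_weight X rho p theta) ->
  [/\ forall u, test_function (~` [set 0]) u ->
        (C%:E * integral_rV (EFin \o rellich_lhs X rho p theta u)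
           <= integral_rV (rellich_rhs X rho p theta u))%E,
      forall C' : R,
        (forall u, test_function (~` [set 0]) u ->
           (C'%:E * integral_rV (EFin \o rellich_lhs X rho p theta u)
              <= integral_rV (rellich_rhs X rho p theta u))%E) ->
        C' <= C
    & forall c : R, c != 0 ->
        let u := fun x => c * rho x `^ ((p * (theta + 2) - Q) / p) in
        ~ test_function (~` [set 0]) u /\
        forall x, x != 0 -> hgrad_norm X rho x != 0 ->
          (C * rellich_lhs X rho p theta u x)%:E
            = rellich_rhs X rho p theta u x].
move=> Q C carnot Q_gt3 [rho_norm /smooth_onP rho_smooth [c fsol]] p_ge2 C_ge0 weight_int.
have p0 : 0 < p by lra.
have Q_gt2 : 2 < Q by rewrite ltr_nat; exact: ltnW.
have X_smooth := carnot_field_smooth carnot.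
have X_divfree := carnot_field_divfree carnot.
have rho_gt0 := hnorm_gt0 rho_norm.
have Lrho x : x != 0 -> sublaplacian X rho x = (Q - 1) * hdot X rho rho x / rho x.
  exact: (sublaplacian_rho X_smooth X_divfree Q_gt2 rho_gt0 rho_smooth fsol).
pose a := (Q - p * (theta + 2)) / p.
(* [Q - 2 - a = (p theta + Q (p - 1)) / p], so the base of the constant splits as [a] times this
   factor. *)
have AE : (Q - p * (theta + 2)) * (p * theta + Q * (p - 1)) / p ^+ 2 = a * (Q - 2 - a).
  by rewrite /a; field; rewrite gt_eqF.
have A_ge0 : 0 <= a * (Q - 2 - a) by rewrite -AE divr_ge0// exprn_ge0// ltW.
have c0 := fundamental_coef_neq0 fsol.
have rho_proper := fundamental_norm_proper rho_norm Q_gt2 c0 fsol.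
rewrite /C AE; split.
- move=> u tu.
  exact: (rellich_inequality X_smooth X_divfree rho_gt0 rho_smooth Lrho p_ge2 A_ge0 tu).
- exact: (rellich_sharp X_smooth X_divfree rho_gt0 rho_smooth Lrho p_ge2
    (hnorm0 rho_norm) (hnorm_continuous rho_norm) rho_proper
    (hnorm_one Q_gt3 rho_norm) weight_int A_ge0).
- move=> c' c'0 /=; split; first exact: (hnorm_power_not_test Q_gt3 rho_norm).
  move=> x x0 gx.
  have -> : (p * (theta + 2) - Q) / p = - a by rewrite /a -mulNr opprB.
  exact: (rellich_equality X_smooth rho_gt0 rho_smooth Lrho p_ge2 A_ge0 c' x0 gx).
Qed.
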